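(* Let $\alpha>1$, $\lambda>0$, and let $X_1,X_2,\dots$ be i.i.d. positive random variables with distribution function $F$ such that $1-F(x)=L(x)x^{-\alpha}$ with $L$ slowly varying at infinity. Let $N(t)$, $t\ge 0$, be a homogeneous Poisson process with rate $\lambda$, independent of $(X_i)_{i\ge1}$, and $S(t)=\sum_{i=1}^{N(t)}X_i$. Let $p_D\in\mathbb{R}$, $c=p_D-\lambda\,\mathbb{E}X_1$, $r\in\mathbb{N}=\{1,2,\dots\}$, and let $R(t)$ be either the LCR reinsured amount $R(t)=L_r(t)$ or the ECOMOR reinsured amount $R(t)=E_r(t)$ (defined in the context). For $u\ge 0$ and $T>0$ let $$\psi(u,T)=\mathbb{P}\Big(\sup_{0\le t\le T}\{S(t)-p_D t-R(t)\}>u\Big).$$ Suppose $a>0$, $c+a>0$ and $c\neq 0$. Then, as $n\to\infty$ ($n\in\mathbb{N}$), $$\psi(na,n)\sim \mathcal{C}_{r+1}\,\big(\lambda L(n)\big)^{r+1}\,n^{-(r+1)(\alpha-1)},$$ i.e. the ratio of both sides tends to $1$, where $$\mathcal{C}_{r+1}=\frac{\kappa}{(r+1)!}\times\begin{cases} a^{-(r+1)\alpha}\;{}_2F_1\big(r+1,(r+1)\alpha;\,r+2;\,-c/a\big), & c>0,\\ (a+c)^{-(r+1)\alpha}, & c<0,\end{cases}$$ with $\kappa=1$ if $R(t)=L_r(t)$ (LCR) and $\kappa=(r+1)^{(r+1)\alpha}$ if $R(t)=E_r(t)$ (ECOMOR).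
   Context: For each $t\ge0$, $X^\star_{1,N(t)}\ge X^\star_{2,N(t)}\ge\cdots\ge X^\star_{N(t),N(t)}$ denote the order statistics (in decreasing order) of $X_1,\dots,X_{N(t)}$. If $N(t)\le r$, set $X^\star_{i,N(t)}=0$ for $i=N(t)+1,\dots,r+1$. The LCR reinsured amount is $L_r(t)=\sum_{i=1}^r X^\star_{i,N(t)}$ and the ECOMOR reinsured amount is $E_r(t)=\sum_{i=1}^r X^\star_{i,N(t)}-r\,X^\star_{r+1,N(t)}$. At each time $t$ the currently applicable reinsured amount $R(t)$ is deducted in the surplus. ${}_2F_1(b,e;d;z)=\sum_{k=0}^\infty \frac{(b)_k(e)_k}{(d)_k}\frac{z^k}{k!}$ is the hypergeometric function, with Pochhammer symbol $(b)_k=b(b+1)\cdots(b+k-1)$; for $z\le -1$ it is understood through its analytic continuation to $\mathbb{C}\setminus[1,\infty)$. *)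

(* Defs.v *)
From HB Require Import structures.
From mathcomp Require Import all_boot all_order all_algebra.
From mathcomp Require Import finmap.
From mathcomp Require Import all_classical all_reals all_analysis.
From mathcomp Require Import complex.
Set Implicit Arguments.
Unset Strict Implicit.
Unset Printing Implicit Defensive.
Import Order.TTheory GRing.Theory Num.Theory.
Import numFieldNormedType.Exports.
Local Open Scope classical_set_scope.
Local Open Scope ring_scope.

Section hypergeometric.
Variable K : numFieldType.
Implicit Types (b e d z : K) (U : set K).

Definition has_power_series_sum (u : nat -> K) z (s : K) : Prop :=
  series (fun k => u k * z ^+ k) @ \oo --> s.

Definition analytic_on U (f : K -> K) : Prop :=
  forall z0, U z0 -> exists u : nat -> K,
    \forall z \near z0, has_power_series_sum u (z - z0) (f z).

Definition pochhammer b (k : nat) : K := \prod_(j < k) (b + j%:R).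

Definition hyp2F1_coef b e d (k : nat) : K :=
  pochhammer b k * pochhammer e k / pochhammer d k / k`!%:R.

(* When K is the field R[i] of complex numbers, [1 <= z] says that z is real and
   at least 1, so this is the complement of the ray [1, +oo). *)
Definition slit_plane : set K := [set z | ~~ (1 <= z)].

(* G is an analytic continuation to the slit plane of the hypergeometric series
   on the open unit disc. *)
Definition is_hyp2F1 b e d (G : K -> K) : Prop :=
  analytic_on slit_plane G /\
  forall z, `|z| < 1 -> has_power_series_sum (hyp2F1_coef b e d) z (G z).

(* Used with K = R[i], whose slit plane is connected, so that the values off
   [1, +oo) are uniquely determined; those on [1, +oo) are unspecified. The
   default only matters when there is no continuation, e.g. when d is a
   nonpositive integer. *)
Definition hyp2F1 b e d : K -> K :=
  xget (fun=> 0) [set G | is_hyp2F1 b e d G].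

End hypergeometric.

(* With real parameters and a real argument z < 1 the continuation takes a real
   value, so nothing is lost by taking the real part. *)
Definition hyp2F1_real (R : realType) (b e d z : R) : R :=
  complex.Re (@hyp2F1 R[i] b%:C%C e%:C%C d%:C%C z%:C%C).

Definition slowly_varying (R : realType) (L : R -> R) : Prop :=
  (exists M : R, measurable_fun `]M, +oo[ L /\ (forall x, M < x -> 0 < L x)) /\
  (forall x, 0 < x -> L (x * t) / L t @[t --> +oo] --> (1 : R)).

Section probability.
Context (d : measure_display) (T : measurableType d) (R : realType).
Variable P : probability T R.

Definition independent_RVs (I : choiceType) d' (T' : measurableType d')
    (Y : I -> T -> T') : Prop :=
  forall (J : {fset I}) (A : I -> set T'),
    (forall i, i \in J -> measurable (A i)) ->
    P (\bigcap_(i in [set` J]) (Y i @^-1` A i)) =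
    (\prod_(i <- J) P (Y i @^-1` A i))%E.

Definition sigma_family (I : Type) (D : set I) d' (T' : measurableType d')
    (Y : I -> T -> T') : set (set T) :=
  <<s \bigcup_(i in D) g_sigma_algebra_preimage (Y i) >>.

Definition independent_sigma (F G : set (set T)) : Prop :=
  forall A B, F A -> G B -> P (A `&` B) = (P A * P B)%E.

(* Paths are right-continuous step functions everywhere on T, which makes suprema
   over time intervals measurable. N at negative times is unconstrained. *)
Definition poisson_process (rate : R) (N : R -> {RV P >-> nat}) : Prop :=
  [/\ forall w, N 0 w = 0%N,
      forall w s t, 0 <= s -> s <= t -> (N s w <= N t w)%N,
      forall w t, 0 <= t -> \forall s \near t^'+, N s w = N t w,
      forall t : nat -> R, 0 <= t 0%N -> nondecreasing_seq t ->
        independent_RVs (fun i w => (N (t i.+1) w - N (t i) w)%N)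
    & forall s t, 0 <= s -> s < t -> forall k : nat,
        P [set w | (N t w - N s w)%N = k] =
        (poisson_pmf (rate * (t - s)) k)%:E ].

End probability.

Variant reinsurance := LCR | ECOMOR.

Section risk.
Context (T : Type) (R : realType).
Variables (X : nat -> T -> R) (N : R -> T -> nat).

Definition aggregate_claims (t : R) (w : T) : R := \sum_(i < N t w) X i w.

(* Indices start at 0: X 0 is the first claim and order_stat t w 0 is the
   largest of the first N t w claims; the default value of nth makes the
   statistics of index at least N t w equal to 0. *)
Definition order_stat (t : R) (w : T) (i : nat) : R :=
  nth 0 (sort >=%O [seq X j w | j <- iota 0 (N t w)]) i.

Definition reinsured_amount (m : reinsurance) (r : nat) (t : R) (w : T) : R :=
  match m with
  | LCR => \sum_(i < r) order_stat t w i
  | ECOMOR => \sum_(i < r) order_stat t w i - r%:R * order_stat t w r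
  end.

Definition ruin_event (m : reinsurance) (r : nat) (pD u h : R) : set T :=
  [set w | (u%:E < ereal_sup
     [set (aggregate_claims t w - pD * t - reinsured_amount m r t w)%:E
        | t in `[0%R, h]])%E].

End risk.

Definition ruin_prob (d : measure_display) (T : measurableType d)
    (R : realType) (P : probability T R) (X : nat -> T -> R)
    (N : R -> T -> nat) (m : reinsurance) (r : nat) (pD u h : R) : R :=
  fine (P (ruin_event X N m r pD u h)).

Definition kappa (R : realType) (m : reinsurance) (alpha : R) (r : nat) : R :=
  match m with
  | LCR => 1
  | ECOMOR => r.+1%:R `^ (r.+1%:R * alpha)
  end.

Definition asymp_const (R : realType) (m : reinsurance) (alpha a c : R)
    (r : nat) : R :=
  kappa m alpha r / r.+1`!%:R *
  (if 0 < c then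
     a `^ (- (r.+1%:R * alpha)) *
     hyp2F1_real r.+1%:R (r.+1%:R * alpha) r.+2%:R (- (c / a))
   else (a + c) `^ (- (r.+1%:R * alpha))).

(* Main.v *)
Require Import Defs.
From HB Require Import structures.
From mathcomp Require Import all_boot all_order all_algebra.
From mathcomp Require Import finmap.
From mathcomp Require Import all_classical all_reals all_analysis.
From mathcomp Require Import measurable_realfun.
From mathcomp Require Import complex ring lra.
Set Implicit Arguments.
Unset Strict Implicit.
Unset Printing Implicit Defensive.
Import Order.TTheory GRing.Theory Num.Theory.
Import numFieldNormedType.Exports.
Local Open Scope classical_set_scope.
Local Open Scope ring_scope.

(** Write Fbar = 1 - F and k = r + 1. Ruin at the linear level n a within time n is
    caused by k large claims, and the proof makes the following heuristics rigorous.

    The r largest claims are reinsured. Hence S(t) - R(t) equals the k-th largest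
    claim, with multiplicity kap = 1 for LCR and kap = k for ECOMOR, plus the
    remaining smaller claims ([net_amount_le], [net_amount_ge]). Sums of truncated
    claims follow their mean up to an error of order n, except with a probability
    smaller than any given power of n ([truncated_sum_upper], [truncated_sum_lower]);
    this is negligible because Fbar decreases only polynomially
    ([power_negligible]). So the surplus without its large claims follows the drift
    c, and ruin by time n means that at some time s n, 0 < s <= 1, at least k claims
    exceed n (a + c s) / kap ([ruin_upper], [ruin_lower]).

    By thinning, the number of claims above y n up to time s n is a Poisson variable
    with mean lambda s n Fbar (y n), which by regular variation is asymptotic to
    s y ^ (- alpha) times the small quantity lambda n Fbar n. Having k exceedances
    has probability (s y ^ (- alpha)) ^ k / k! times (lambda n Fbar n) ^ k, up to a
    factor tending to 1, and a further exceedance is negligible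
    ([many_exceedances_cvg], [many_exceedances_succ_cvg0]).

    For c < 0 the level is lowest at s = 1, where most claims have arrived, so s = 1
    alone gives the constant. For c > 0 the time interval is cut into M blocks. The
    level is first crossed in the j-th block with a probability governed by
    (s_(j+1) ^ k - s_j ^ k) (a + c s_(j+1)) ^ (- k alpha), and summing over j gives a
    Riemann-Stieltjes sum for the integral of k s ^ (k - 1) (a + c s) ^ (- k alpha)
    over [0, 1] ([block_union_upper], [block_union_lower]).

    This is Euler's integral for the hypergeometric function. Euler's integral with
    complex argument is analytic on the plane cut along [1, +oo), where it has the
    power series obtained by integrating the Taylor expansion of its integrand, and
    at the origin this is the hypergeometric series ([euler_integral_is_hyp2F1]). An
    identity theorem along the negative axis shows that every continuation agrees
    with it there ([hyp2F1_real_neg]). *)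

(** * Complex powers off the negative real axis *)

Section complex_power.
Variable R : realType.
Local Notation C := R[i].
Local Notation Re := complex.Re.
Local Notation Im := complex.Im.
Implicit Types (v z g : C) (b s x y : R).

(** The modulus as a real number: the norm of R[i] takes values in R[i], which is
    only partially ordered. *)
Definition cabs v : R := Num.sqrt (Re v ^+ 2 + Im v ^+ 2).

Lemma normr_cabs v : `|v| = (cabs v)%:C%C.
Proof. by rewrite normc_def. Qed.

Lemma cabs_ge0 v : 0 <= cabs v.
Proof. exact: sqrtr_ge0. Qed.

Lemma realC_inj : injective (fun x : R => (x%:C)%C).
Proof. by move=> x y [->]. Qed.

Lemma cabs_le x v : (`|v| <= (x%:C)%C) = (cabs v <= x).
Proof. by rewrite normr_cabs lecR. Qed.

Lemma cabs_lt x v : (`|v| < (x%:C)%C) = (cabs v < x).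
Proof. by rewrite normr_cabs ltcR. Qed.

Lemma cabsM v z : cabs (v * z) = cabs v * cabs z.
Proof. by apply: realC_inj; rewrite -normr_cabs normrM !normr_cabs rmorphM. Qed.

Lemma cabsX v n : cabs (v ^+ n) = cabs v ^+ n.
Proof. by apply: realC_inj; rewrite -normr_cabs normrX normr_cabs rmorphXn. Qed.

Lemma ler_cabsB v z : cabs v - cabs z <= cabs (v - z).
Proof.
have := lerB_dist v z; rewrite !normr_cabs -rmorphB /= lecR //.
Qed.

Lemma ler_cabsD v z : cabs (v + z) <= cabs v + cabs z.
Proof. by have := ler_normD v z; rewrite !normr_cabs -rmorphD /= lecR. Qed.

Lemma cabsN v : cabs (- v) = cabs v.
Proof. by apply: realC_inj; rewrite -!normr_cabs normrN. Qed.

Lemma cabs_real x : cabs (x%:C)%C = `|x|.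
Proof. by rewrite /cabs /= expr0n addr0 sqrtr_sqr. Qed.

Lemma sqr_cabs v : cabs v ^+ 2 = Re v ^+ 2 + Im v ^+ 2.
Proof. by rewrite sqr_sqrtr // addr_ge0 ?sqr_ge0. Qed.

Lemma normRe_cabs v : `|Re v| <= cabs v.
Proof. by rewrite -sqrtr_sqr ler_wsqrtr // lerDl sqr_ge0. Qed.

Lemma normIm_cabs v : `|Im v| <= cabs v.
Proof. by rewrite -sqrtr_sqr ler_wsqrtr // lerDr sqr_ge0. Qed.

Lemma cabs_le_ReIm v : cabs v <= `|Re v| + `|Im v|.
Proof.
rewrite -(@ler_pXn2r _ 2) ?nnegrE ?cabs_ge0 ?addr_ge0 // sqr_cabs.
rewrite sqrrD !real_normK ?num_real // -addrA lerD2l lerDr.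
by rewrite mulrn_wge0 // mulr_ge0.
Qed.

Lemma complexM (a b c d : R) :
  ((a +i* b) * (c +i* d))%C = ((a * c - b * d) +i* (a * d + b * c))%C :> C.
Proof. by []. Qed.

(** Re v + |v| vanishes exactly on the ray (-oo, 0] and is the denominator of the
    half-angle formula for the argument, so this is the cut plane in the form in
    which it is used. *)
Definition slit v := 0 < Re v + cabs v.

(** Half-angle formula tan (arg v / 2) = Im v / (Re v + |v|): a single smooth
    expression of the principal argument on the whole cut plane. *)
Definition slit_arg v : R := 2 * atan (Im v / (Re v + cabs v)).

(** Principal branch of v ^ (- b). *)
Definition cpowN b v : C :=
  ((expR (- b * ln (cabs v)) * cos (b * slit_arg v)) +i*
   (- (expR (- b * ln (cabs v)) * sin (b * slit_arg v))))%C.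

Lemma slit_cabs_gt0 v : slit v -> 0 < cabs v.
Proof.
move=> hv; rewrite lt_def cabs_ge0 andbT; apply/eqP => v0.
move: hv; rewrite /slit v0 addr0 => h.
by have := normRe_cabs v; rewrite v0 normr_le0 => /eqP e; rewrite e ltxx in h.
Qed.

Lemma slit_oneB z : slit_plane z -> slit (1 - z).
Proof.
move=> hz; rewrite /slit ltNge; apply/negP => h; move/negP: hz; apply.
have /eqP r0 : Re (1 - z) + cabs (1 - z) == 0.
  rewrite eq_le h /= -lerBlDl sub0r; apply: le_trans (normRe_cabs _).
  by rewrite -normrN ler_norm.
have cE : cabs (1 - z) = - Re (1 - z) by apply/eqP; rewrite -addr_eq0 addrC r0.
have := sqr_cabs (1 - z); rewrite cE sqrrN => /esym/eqP.
rewrite -subr_eq0 addrAC subrr add0r sqrf_eq0 => /eqP I0.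
move: h; rewrite lecE; case: z {r0} cE I0 => x y /= cE; rewrite sub0r => /eqP.
rewrite oppr_eq0 => -> /= _.
by have := cabs_ge0 (1 - (x +i* y)%C); rewrite cE /= oppr_ge0 subr_le0.
Qed.

Lemma slit_arg_cos v : slit v -> cos (slit_arg v) = Re v / cabs v.
Proof.
move=> hv; have r0 := slit_cabs_gt0 hv; rewrite /slit in hv.
rewrite /slit_arg mulr_natl cos_mulr2n cos_atan exprVn sqr_sqrtr ?addr_ge0 ?sqr_ge0 //.
set w := Re v + cabs v in hv *.
have -> : 1 + (Im v / w) ^+ 2 = 2 * cabs v / w.
  have e : w ^+ 2 + Im v ^+ 2 = 2 * cabs v * w.
    by have := sqr_cabs v; rewrite /w => /eqP; rewrite -subr_eq0 => /eqP h; nra.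
  transitivity ((w ^+ 2 + Im v ^+ 2) / w ^+ 2); first by field; rewrite gt_eqF.
  by rewrite e; field; rewrite gt_eqF.
rewrite invf_div /w; field.
by rewrite gt_eqF.
Qed.

Lemma slit_arg_sin v : slit v -> sin (slit_arg v) = Im v / cabs v.
Proof.
move=> hv; have r0 := slit_cabs_gt0 hv.
have hc := slit_arg_cos hv; rewrite /slit in hv.
have cN : cos (atan (Im v / (Re v + cabs v))) != 0.
  by rewrite cos_atan invr_neq0 // sqrtr_eq0 -ltNge ltr_pwDl ?sqr_ge0.
move: hc; rewrite /slit_arg mulr_natl cos_mulr2n sin_mulr2n.
have := atanK (Im v / (Re v + cabs v)); rewrite /tan.
set a := atan _ in cN *.
move/(congr1 (fun t => t * cos a)); rewrite divfK // => ->.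
move=> /eqP; rewrite subr_eq => /eqP hc.
have -> : cos a * (Im v / (Re v + cabs v) * cos a) *+ 2 =
          (cos a ^+ 2 *+ 2) * Im v / (Re v + cabs v) by field; rewrite gt_eqF.
rewrite hc; field; by rewrite !gt_eqF.
Qed.

Lemma cabs_cpowN b v : slit v -> cabs (cpowN b v) = cabs v `^ (- b).
Proof.
move=> /slit_cabs_gt0 r0; rewrite /cabs /cpowN /= sqrrN !exprMn -mulrDr.
by rewrite cos2Dsin2 mulr1 sqrtr_sqr ger0_norm ?expR_ge0 // /powR gt_eqF.
Qed.

Lemma cpowN_real b x : 0 < x -> cpowN b (x%:C)%C = ((x `^ (- b))%:C)%C.
Proof.
move=> x0; rewrite /cpowN /slit_arg /= mul0r atan0 !mulr0 cos0 sin0.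
by rewrite cabs_real gtr0_norm // mulr1 mulr0 oppr0 /powR gt_eqF.
Qed.

Lemma cpowN1 b : cpowN b 1 = 1.
Proof. by rewrite (@cpowN_real b 1) // powR1. Qed.

(** In [cpowN_is_cderive] the derivatives of modulus and argument carry a factor 1 /
    v; this turns it into a shift of the exponent. *)
Lemma cpowNS b v : slit v -> cpowN (b + 1) v * v = cpowN b v.
Proof.
move=> hv; have r0 := slit_cabs_gt0 hv.
have vE : v = ((cabs v * cos (slit_arg v)) +i* (cabs v * sin (slit_arg v)))%C.
  rewrite slit_arg_cos // slit_arg_sin // !(mulrC (cabs v)) !divfK ?gt_eqF //.
  by case: {+}v.
rewrite {2}vE /cpowN; move: (slit_arg v) (cabs v) r0 => th r r0.
have -> : - (b + 1) * ln r = - b * ln r - ln r by ring.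
rewrite expRD [in expR (- ln r)]expRN lnK ?posrE //.
have -> : (b + 1) * th = b * th + th by ring.
rewrite (cosD (b * th) th) (sinD (b * th) th); have := cos2Dsin2 th.
have rV : r^-1 * r = 1 by rewrite mulVf ?gt_eqF.
move: (expR _) (cos (b * th)) (sin _) (cos th) (sin th) => E cb sb c s cs.
rewrite complexM; congr (_ +i* _)%C.
  transitivity (E * cb * (r^-1 * r) * (c ^+ 2 + s ^+ 2)); first by ring.
  by rewrite rV cs !mulr1.
transitivity (- (E * sb * (r^-1 * r) * (c ^+ 2 + s ^+ 2))); first by ring.
by rewrite rV cs !mulr1.
Qed.

(** Componentwise, so that the rules for real derivatives apply: all differentiation
    takes place along real segments. *)
Definition is_cderive (f : R -> C) (t : R) (df : C) : Prop :=
  is_derive t 1 (fun u => Re (f u)) (Re df) /\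
  is_derive t 1 (fun u => Im (f u)) (Im df).

Lemma ReM v z : Re (v * z) = Re v * Re z - Im v * Im z.
Proof. by case: v => a b; case: z. Qed.

Lemma ImM v z : Im (v * z) = Re v * Im z + Im v * Re z.
Proof. by case: v => a b; case: z. Qed.

Lemma Re_real x : Re (x%:C)%C = x. Proof. by []. Qed.
Lemma Im_real x : Im (x%:C)%C = 0. Proof. by []. Qed.

Lemma ReD v z : Re (v + z) = Re v + Re z.
Proof. by case: v => a b; case: z. Qed.

Lemma ImD v z : Im (v + z) = Im v + Im z.
Proof. by case: v => a b; case: z. Qed.

Lemma ReN v : Re (- v) = - Re v. Proof. by case: v. Qed.
Lemma ImN v : Im (- v) = - Im v. Proof. by case: v. Qed.

Lemma complex_eq v z : Re v = Re z -> Im v = Im z -> v = z.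
Proof. by case: v => a b; case: z => c d /= -> ->. Qed.

Lemma is_cderive_eq f t df df' : is_cderive f t df -> df = df' -> is_cderive f t df'.
Proof. by move=> ? <-. Qed.

Lemma is_cderiveD (f g : R -> C) t df dg : is_cderive f t df -> is_cderive g t dg ->
  is_cderive (fun u => f u + g u) t (df + dg).
Proof.
move=> [f1 f2] [g1 g2]; split.
  under eq_fun do rewrite ReD.
  by apply: is_derive_eq; rewrite ReD.
under eq_fun do rewrite ImD.
by apply: is_derive_eq; rewrite ImD.
Qed.

Lemma is_cderiveM (f g : R -> C) t df dg : is_cderive f t df -> is_cderive g t dg ->
  is_cderive (fun u => f u * g u) t (f t * dg + df * g t).
Proof.
move=> [f1 f2] [g1 g2]; split.
  under eq_fun do rewrite ReM.
  by apply: is_derive_eq; rewrite ReD !ReM /GRing.scale /=; ring.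
under eq_fun do rewrite ImM.
by apply: is_derive_eq; rewrite ImD !ImM /GRing.scale /=; ring.
Qed.

Lemma is_cderive_cst v t : is_cderive (fun=> v) t 0.
Proof. by split; apply: is_derive_eq. Qed.

Lemma is_cderive_real (f : R -> R) t df : is_derive t (1 : R) f df ->
  is_cderive (fun u => (f u)%:C%C) t (df%:C)%C.
Proof. by move=> h; split => //=; apply: is_derive_eq. Qed.

(** Differentiate the polar form: ln |v - t g| and the half-angle formula give the
    radial and the angular part of - g / (v - t g), and their combination is the
    multiplication by this quotient. *)
Lemma cpowN_is_cderive b v g t : slit (v - (t%:C)%C * g) ->
  is_cderive (fun u => cpowN b (v - (u%:C)%C * g)) t
             ((b%:C)%C * g * cpowN (b + 1) (v - (t%:C)%C * g)).
Proof.
move=> hs; have r0 := slit_cabs_gt0 hs; have := cpowNS b hs.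
set w := v - _ in hs r0 *.
pose x u := Re v - u * Re g; pose y u := Im v - u * Im g.
have xE u : Re (v - (u%:C)%C * g) = x u by rewrite ReD ReN ReM /= mul0r subr0.
have yE u : Im (v - (u%:C)%C * g) = y u by rewrite ImD ImN ImM /= mul0r addr0.
pose r u := Num.sqrt (x u ^+ 2 + y u ^+ 2).
have rE u : cabs (v - (u%:C)%C * g) = r u by rewrite /cabs xE yE.
have wr : cabs w = r t by rewrite rE.
rewrite wr in r0.
have r2 : r t ^+ 2 = x t ^+ 2 + y t ^+ 2 by rewrite sqr_sqrtr // addr_ge0 ?sqr_ge0.
have p0 : 0 < x t ^+ 2 + y t ^+ 2 by rewrite -r2 exprn_gt0.
have dx : is_derive t 1 x (- Re g).
  by apply: is_derive_eq; rewrite /GRing.scale /=; ring.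
have dy : is_derive t 1 y (- Im g).
  by apply: is_derive_eq; rewrite /GRing.scale /=; ring.
have dr : is_derive t 1 r (- (x t * Re g + y t * Im g) / r t).
  rewrite /r; have d1 := is_derive1_sqrt p0.
  apply: is_derive_eq; rewrite /GRing.scale /= -/(r t); field.
  by rewrite gt_eqF.
have dln : is_derive t 1 (fun u => ln (r u)) (- (x t * Re g + y t * Im g) / r t ^+ 2).
  have d1 := is_derive1_ln r0.
  by apply: is_derive_eq; rewrite /GRing.scale /=; field; rewrite gt_eqF.
have w0 : 0 < x t + r t by move: hs; rewrite /slit wr xE.
pose th u := 2 * atan (y u / (x u + r u)).
have dV : is_derive t 1 (fun u => (x u + r u)^-1)
   (- (- Re g - (x t * Re g + y t * Im g) / r t) / (x t + r t) ^+ 2).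
  have h : x t + r t != 0 by rewrite gt_eqF.
  have dw : is_derive t 1 (fun u => x u + r u) (- Re g - (x t * Re g + y t * Im g) / r t).
    by apply: is_derive_eq; rewrite mulNr.
  have hh := is_deriveV (f := fun u => x u + r u) h dw.
  apply: (is_derive_eq hh).
  by rewrite /GRing.scale /= !mulNr; congr (- _); exact: mulrC.
have dth : is_derive t 1 th (- (x t * Im g - y t * Re g) / r t ^+ 2).
  have n1 : (x t + r t) ^+ 2 + y t ^+ 2 = 2 * r t * (x t + r t) by nra.
  have n2 : 1 + (y t / (x t + r t)) ^+ 2 = 2 * r t / (x t + r t).
    transitivity (((x t + r t) ^+ 2 + y t ^+ 2) / (x t + r t) ^+ 2).
      by field; rewrite gt_eqF.
    by rewrite n1; field; rewrite gt_eqF.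
  have d1 := is_derive1_atan (y t / (x t + r t)).
  rewrite n2 in d1.
  apply: is_derive_eq; rewrite /GRing.scale /=.
  transitivity ((y t * Re g * (x t + r t) + y t ^+ 2 * Im g - Im g * x t * r t
     - Im g * r t ^+ 2) / (r t ^+ 2 * (x t + r t))).
    by field; rewrite !gt_eqF.
  have -> : y t * Re g * (x t + r t) + y t ^+ 2 * Im g - Im g * x t * r t
     - Im g * r t ^+ 2 = (y t * Re g - x t * Im g) * (x t + r t) -
       Im g * (r t ^+ 2 - (x t ^+ 2 + y t ^+ 2)) by ring.
  by rewrite r2 subrr mulr0 subr0; field; rewrite !gt_eqF // exprn_gt0.
have thE u : slit_arg (v - (u%:C)%C * g) = th u by rewrite /slit_arg xE yE rE.
move=> pwE.
have E1 : expR (- b * ln (r t)) * cos (b * th t) =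
   Re (cpowN (b + 1) w) * x t - Im (cpowN (b + 1) w) * y t.
  by rewrite -xE -yE -/w -ReM pwE /cpowN /= rE thE.
have E2 : expR (- b * ln (r t)) * sin (b * th t) =
   - (Re (cpowN (b + 1) w) * y t + Im (cpowN (b + 1) w) * x t).
  by rewrite -xE -yE -/w -ImM pwE /cpowN /= rE thE opprK.
move: (cpowN (b + 1) w) E1 E2 {pwE} => W E1 E2.
(* Re (conj w * g * (w * W)) / |w| ^ 2 = Re (g * W), with w = p + i q, g = A + i B
   and W = P + i Q; the imaginary part is the case of - i W. *)
have key (P Q A B p q : R) : r t ^+ 2 = p ^+ 2 + q ^+ 2 ->
  b * (p * A + q * B) / r t ^+ 2 * (P * p - Q * q) -
  b * (p * B - q * A) / r t ^+ 2 * (P * q + Q * p) = b * (A * P - B * Q).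
  move=> e; transitivity (b * (A * P - B * Q) * (p ^+ 2 + q ^+ 2) / r t ^+ 2).
    by field; rewrite gt_eqF.
  by rewrite -e mulfK // expf_neq0 // gt_eqF.
split.
  under eq_fun do rewrite /cpowN /= rE thE.
  apply: is_derive_eq; rewrite /GRing.scale /=.
  transitivity (b * (x t * Re g + y t * Im g) / r t ^+ 2 *
     (expR (- b * ln (r t)) * cos (b * th t)) +
     b * (x t * Im g - y t * Re g) / r t ^+ 2 * (expR (- b * ln (r t)) * sin (b * th t))).
    by field; rewrite gt_eqF.
  rewrite E1 E2 mulrN key // !ReM !ImM Re_real Im_real.
  ring.
under eq_fun do rewrite /cpowN /= rE thE.
apply: is_derive_eq; rewrite /GRing.scale /=.
transitivity (- (b * (x t * Re g + y t * Im g) / r t ^+ 2 *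
     (expR (- b * ln (r t)) * sin (b * th t))) +
     b * (x t * Im g - y t * Re g) / r t ^+ 2 * (expR (- b * ln (r t)) * cos (b * th t))).
  by field; rewrite gt_eqF.
rewrite E1 E2 mulrN opprK.
have := key (Im W) (- Re W) (Re g) (Im g) _ _ r2.
move=> h; rewrite !ImM ReM Re_real Im_real; transitivity (b * (Re g * Im W - Im g * - Re W)); last by ring.
by rewrite -h; ring.
Qed.

End complex_power.

(** * Taylor expansion of complex powers *)

Section taylor.
Variable R : realType.
Local Notation C := R[i].
Local Notation Re := complex.Re.
Local Notation Im := complex.Im.
Implicit Types (v z g : C) (b s x y : R).

Lemma pochhammerS (K : numFieldType) (b : K) n :
  pochhammer b n.+1 = pochhammer b n * (b + n%:R).
Proof. by rewrite /pochhammer big_ord_recr. Qed.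

Lemma pochhammer0 (K : numFieldType) (b : K) : pochhammer b 0 = 1.
Proof. by rewrite /pochhammer big_ord0. Qed.

Lemma pochhammer_ge0 b n : 0 <= b -> 0 <= pochhammer b n.
Proof. by move=> b0; apply: prodr_ge0 => i _; rewrite addr_ge0. Qed.

Lemma cvg0_ratio (u : nat -> R) p N0 : 0 <= p < 1 -> (forall n, 0 <= u n) ->
  (forall n, (N0 <= n)%N -> u n.+1 <= p * u n) -> u @ \oo --> (0 : R).
Proof.
move=> /andP[p0 p1] u0 hu; rewrite -(cvg_shiftn N0).
apply: (@squeeze_cvgr _ _ _ _ (fun=> 0) (fun n => u N0 * p ^+ n)).
- apply: nearW => n /=; rewrite u0 /=; elim: n => [|n IH]; first by rewrite mulr1.
  rewrite addSn (le_trans (hu _ _)) ?leq_addl // exprS mulrCA.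
  by rewrite ler_wpM2l.
- exact: cvg_cst.
- rewrite -(mulr0 (u N0)); apply: cvgMr.
  by apply: cvg_expr; rewrite ger0_norm.
Qed.

(** The quotient of consecutive terms tends to q < 1. *)
Lemma cvg_pochhammer_geometric b q : 0 < b -> 0 <= q < 1 ->
  pochhammer b M.+1 / M`!%:R * q ^+ M @[M --> \oo] --> (0 : R).
Proof.
move=> b0 /andP[q0 q1]; pose p := (1 + q) / 2.
have pq : 0 < p - q by rewrite /p; lra.
apply: (@cvg0_ratio _ p (Num.truncn (b * q / (p - q))).+1).
- by rewrite /p; lra.
- by move=> n; rewrite !mulr_ge0 ?invr_ge0 ?exprn_ge0 // pochhammer_ge0 // ltW.
move=> n hn.
rewrite pochhammerS factS natrM exprS invfM.
have f0 : (0 : R) < n`!%:R by rewrite ltr0n fact_gt0.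
set P := pochhammer b n.+1 / n`!%:R * q ^+ n.
have -> : pochhammer b n.+1 * (b + n.+1%:R) * (n.+1%:R^-1 / n`!%:R) * (q * q ^+ n) =
   (b + n.+1%:R) * q / n.+1%:R * P.
  by rewrite /P; field; rewrite gt_eqF //= lt0r_neq0.
rewrite ler_wpM2r //.
  by rewrite !mulr_ge0 ?invr_ge0 ?exprn_ge0 // pochhammer_ge0 // ltW.
rewrite ler_pdivrMr ?ltr0n //.
have : b * q / (p - q) <= n.+1%:R.
  by rewrite (le_trans (ltW (truncnS_gt _))) // ler_nat (leq_trans hn).
rewrite ler_pdivrMr // => h; nra.
Qed.

(** A complex-valued function need not attain its mean slope; the mean value theorem
    is applied to both components, at the price of a factor 2. *)
Lemma cabs_mean_value (f df : R -> C) (B : R) :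
  (forall t, 0 <= t <= 1 -> is_cderive f t (df t)) ->
  (forall t, 0 <= t <= 1 -> cabs (df t) <= B) -> cabs (f 1 - f 0) <= 2 * B.
Proof.
move=> hf hB; apply: (le_trans (cabs_le_ReIm _)); rewrite mulr_natl mulr2n.
have itvP (t : R) : t \in `]0, 1[ -> 0 <= t <= 1 by rewrite in_itv /= => /andP[/ltW-> /ltW->].
rewrite ReD ReN ImD ImN; apply: lerD.
- have [|||c] := @MVT_segment R (fun t => Re (f t)) (fun t => Re (df t)) 0 1.
  + exact: ler01.
  + by move=> t /itvP/hf[].
  + apply: derivable_within_continuous => t; rewrite in_itv /= => /hf[h _].
    exact: (@ex_derive _ _ _ _ _ _ _ h).
  rewrite in_itv /= => hc -> ; rewrite subr0 mulr1.
  exact: le_trans (normRe_cabs _) (hB _ hc).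
- have [|||c] := @MVT_segment R (fun t => Im (f t)) (fun t => Im (df t)) 0 1.
  + exact: ler01.
  + by move=> t /itvP/hf[].
  + apply: derivable_within_continuous => t; rewrite in_itv /= => /hf[_ h].
    exact: (@ex_derive _ _ _ _ _ _ _ h).
  rewrite in_itv /= => hc -> ; rewrite subr0 mulr1.
  exact: le_trans (normIm_cabs _) (hB _ hc).
Qed.

Definition binom_coef b m : R := pochhammer b m / m`!%:R.

(** Taylor polynomial of u |-> cpowN b (v - u g) based at t and evaluated at 1. As t
    runs from 0 to 1 it moves from the Taylor polynomial at 0 to the function
    itself. *)
Definition cpowN_taylor b v g M (t : R) : C :=
  \sum_(m < M.+1) ((binom_coef b m * (1 - t) ^+ m)%:C)%C * g ^+ m *
     cpowN (b + m%:R) (v - (t%:C)%C * g).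

(** The derivative telescopes: differentiating the power of 1 - t in one term
    cancels the derivative of cpowN in the previous one. *)
Lemma cpowN_taylor_cderive b v g M t : slit (v - (t%:C)%C * g) ->
  is_cderive (cpowN_taylor b v g M) t
   (((pochhammer b M.+1 / M`!%:R * (1 - t) ^+ M)%:C)%C * g ^+ M.+1 *
     cpowN (b + M.+1%:R) (v - (t%:C)%C * g)).
Proof.
move=> hs; elim: M => [|M IH].
  rewrite /cpowN_taylor; under eq_fun do
    rewrite big_ord1 /binom_coef pochhammer0 fact0 invr1 !expr0 !mulr1 mul1r addr0.
  apply: is_cderive_eq; first exact: cpowN_is_cderive.
  by rewrite pochhammerS pochhammer0 fact0 divr1 mul1r addr0 expr0 mulr1 expr1.
rewrite /cpowN_taylor; under eq_fun do rewrite big_ord_recr /=.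
apply: is_cderive_eq.
  apply: is_cderiveD; first exact: IH.
  apply: is_cderiveM; last exact: cpowN_is_cderive.
  apply: is_cderiveM; last exact: is_cderive_cst.
  have h : is_derive t (1 : R) (fun u => binom_coef b M.+1 * (1 - u) ^+ M.+1)
     (- (pochhammer b M.+1 / M`!%:R * (1 - t) ^+ M)).
    have h1 : is_derive t (1 : R) (fun u : R => 1 - u) (- 1).
      by apply: is_derive_eq; rewrite add0r mul1r.
    have h2 := is_deriveX M.+1 h1.
    have h3 := is_deriveZ (binom_coef b M.+1) h2.
    rewrite (_ : (fun u => _) = binom_coef b M.+1 \*: ((fun u : R => 1 - u) ^+ M.+1)); last first.
      by apply/funext => u; rewrite /= exprfctE.
    apply: (is_derive_eq h3).
    rewrite /GRing.scale /= /binom_coef factS natrM invfM.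
    have q0 : M.+1%:R != 0 :> R by rewrite pnatr_eq0.
    move: (pochhammer b M.+1) (M.+1%:R) ((1 - t) ^+ M) q0 (M`!%:R^-1) => p q e q0 f.
    transitivity (- (p * (q^-1 * q) * f * e)); first by ring.
    by rewrite mulVf // mulr1.
  exact: (is_cderive_real h).
rewrite mulr0 add0r rmorphN !mulNr addrCA addrA addrK.
rewrite -addrA natr1 mulrA; congr (_ * _).
have -> : pochhammer b M.+2 / M.+1`!%:R * (1 - t) ^+ M.+1 =
  (binom_coef b M.+1 * (1 - t) ^+ M.+1) * (b + M.+1%:R).
  by rewrite /binom_coef pochhammerS; ring.
move: (binom_coef b M.+1 * _) => A.
rewrite (rmorphM (@real_complex R) A) /= (exprSr g M.+1) -!mulrA; congr (_ * _).
by rewrite mulrCA.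
Qed.

(** Mean value bound for [cpowN_taylor]. The quotient (1 - t) |g| / |v - t g| is at
    most eta / D, which makes the bound geometric in M. *)
Lemma cpowN_taylor_error b v g D eta M : 0 < b -> eta < D ->
  D <= cabs v -> cabs g <= eta ->
  (forall t, 0 <= t <= 1 -> slit (v - (t%:C)%C * g)) ->
  cabs (cpowN b (v - g) - \sum_(m < M.+1) ((binom_coef b m)%:C)%C * g ^+ m *
     cpowN (b + m%:R) v) <=
  2 * (pochhammer b M.+1 / M`!%:R * (eta / D) ^+ M * (eta * (D - eta) `^ (- (b + 1)))).
Proof.
move=> b0 etaD Dv geta hs.
have eta0 : 0 <= eta by rewrite (le_trans (cabs_ge0 _) geta).
have D0 : 0 < D by rewrite (le_lt_trans eta0).
have e1 : cpowN_taylor b v g M 1 = cpowN b (v - g).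
  rewrite /cpowN_taylor big_ord_recl big1 ?addr0.
    by rewrite /binom_coef pochhammer0 fact0 invr1 !expr0 !mulr1 rmorph1 !mul1r.
  by move=> i _; rewrite subrr expr0n /= mulr0 !mul0r.
have e0 : cpowN_taylor b v g M 0 = \sum_(m < M.+1) ((binom_coef b m)%:C)%C * g ^+ m *
     cpowN (b + m%:R) v.
  by apply: eq_bigr => i _; rewrite subr0 expr1n mulr1 mul0r subr0.
rewrite -e1 -e0; apply: cabs_mean_value => t ht.
  exact/cpowN_taylor_cderive/hs.
case/andP: (ht) => t0 t1.
have := hs _ ht; set w := v - _ => hw; have w0 := slit_cabs_gt0 hw.
have wD : D - t * eta <= cabs w.
  apply: le_trans (ler_cabsB _ _); rewrite cabsM cabs_real ger0_norm //.
  by rewrite lerB // ler_wpM2l.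
rewrite !cabsM cabs_real cabsX (cabs_cpowN _ hw) ger0_norm; last first.
  by rewrite mulr_ge0 ?divr_ge0 ?exprn_ge0 ?subr_ge0 // pochhammer_ge0 // ltW.
have -> : cabs w `^ (- (b + M.+1%:R)) = (cabs w ^+ M)^-1 * cabs w `^ (- (b + 1)).
  rewrite -natr1 addrCA opprD powRD; last by rewrite (gt_eqF w0) implybT.
  by rewrite (powRN _ M%:R) powR_mulrn // ltW.
rewrite exprS.
have -> : pochhammer b M.+1 / M`!%:R * (1 - t) ^+ M * (cabs g * cabs g ^+ M) *
    ((cabs w ^+ M)^-1 * cabs w `^ (- (b + 1))) =
   pochhammer b M.+1 / M`!%:R * ((1 - t) * cabs g / cabs w) ^+ M *
     (cabs g * cabs w `^ (- (b + 1))).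
  by rewrite !exprMn exprVn; ring.
have P0 : 0 <= pochhammer b M.+1 / M`!%:R by rewrite divr_ge0 // pochhammer_ge0 // ltW.
have r1 : 0 <= (1 - t) * cabs g / cabs w.
  by rewrite divr_ge0 ?mulr_ge0 ?cabs_ge0 // subr_ge0.
apply: ler_pM.
- by rewrite mulr_ge0 ?exprn_ge0.
- by rewrite mulr_ge0 ?powR_ge0 ?cabs_ge0.
- rewrite ler_wpM2l // lerXn2r ?nnegrE //; first by rewrite divr_ge0 // ltW.
  rewrite ler_pdivrMr // mulrAC ler_pdivlMr //.
  have : (1 - t) * cabs g * D <= (1 - t) * eta * D.
    by rewrite ler_wpM2r ?ler_wpM2l // ?subr_ge0 // ltW.
  have : eta * (D - t * eta) <= eta * cabs w by rewrite ler_wpM2l.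
  have : 0 <= eta * (t * (D - eta)) by rewrite !mulr_ge0 // subr_ge0 ltW.
  nra.
- apply: ler_pM; rewrite ?powR_ge0 ?cabs_ge0 // !powRN lef_pV2 ?posrE ?powR_gt0 ?subr_gt0 //.
  rewrite ge0_ler_powR ?nnegrE ?cabs_ge0 ?subr_ge0 ?addr_ge0 ?(ltW b0) ?(ltW etaD) //.
  by apply: le_trans wD; rewrite lerB // ler_piMl.
Qed.

End taylor.

(** * Euler's integral *)

Section euler_integral.
Variable R : realType.
Local Notation C := R[i].
Local Notation Re := complex.Re.
Local Notation Im := complex.Im.
Local Notation mu := (@lebesgue_measure R).
Implicit Types (v z g h : C) (b s x y : R).

Definition cintegrable (f : R -> C) : Prop :=
  mu.-integrable `[0%R, 1%R] (EFin \o (fun t => Re (f t))) /\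
  mu.-integrable `[0%R, 1%R] (EFin \o (fun t => Im (f t))).

Definition cintegral (f : R -> C) : C :=
  ((\int[mu]_(t in `[0%R, 1%R]) Re (f t)) +i*
   (\int[mu]_(t in `[0%R, 1%R]) Im (f t)))%C.

Lemma continuous_integrable01 (f : R -> R) (a c : R) :
  {within `[a, c], continuous f} -> mu.-integrable `[a, c] (EFin \o f).
Proof. by apply: continuous_compact_integrable; exact: segment_compact. Qed.

Lemma cintegrable_cderive (f df : R -> C) :
  (forall t, 0 <= t <= 1 -> is_cderive f t (df t)) -> cintegrable f.
Proof.
move=> hf; split; apply: continuous_integrable01;
  apply: derivable_within_continuous => t; rewrite in_itv /= => /hf[h1 h2].
- exact: (@ex_derive _ _ _ _ _ _ _ h1).
- exact: (@ex_derive _ _ _ _ _ _ _ h2).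
Qed.

Lemma cintegrableD (f g : R -> C) : cintegrable f -> cintegrable g ->
  cintegrable (fun t => f t + g t).
Proof.
move=> [f1 f2] [g1 g2]; split.
  rewrite (_ : _ \o _ = (EFin \o (fun t => Re (f t))) \+ (EFin \o (fun t => Re (g t))))%E.
    exact: integrableD.
  by apply/funext => t /=; rewrite ReD.
rewrite (_ : _ \o _ = (EFin \o (fun t => Im (f t))) \+ (EFin \o (fun t => Im (g t))))%E.
  exact: integrableD.
by apply/funext => t /=; rewrite ImD.
Qed.

Lemma cintegralD (f g : R -> C) : cintegrable f -> cintegrable g ->
  cintegral (fun t => f t + g t) = cintegral f + cintegral g.
Proof.
move=> [f1 f2] [g1 g2]; apply: complex_eq; rewrite ?ReD ?ImD /=.
  by rewrite -RintegralD //; apply: eq_Rintegral => t _; rewrite ReD.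
by rewrite -RintegralD //; apply: eq_Rintegral => t _; rewrite ImD.
Qed.

Lemma cintegrableZ (f : R -> C) v : cintegrable f -> cintegrable (fun t => v * f t).
Proof.
move=> [f1 f2].
have h (x y : R) : mu.-integrable `[0%R, 1%R] (EFin \o (fun t => x * Re (f t) + y * Im (f t))).
  rewrite (_ : _ \o _ = (fun t => x%:E * (EFin \o (fun t => Re (f t))) t) \+
     (fun t => y%:E * (EFin \o (fun t => Im (f t))) t))%E.
    by apply: integrableD => //; apply: integrableZl.
  by apply/funext => t.
split.
  have := h (Re v) (- Im v); congr integrable; apply/funext => t /=.
  by rewrite ReM mulNr.
have := h (Im v) (Re v); congr integrable; apply/funext => t /=.
by rewrite ImM addrC.
Qed.

Lemma cintegralZ (f : R -> C) v : cintegrable f ->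
  cintegral (fun t => v * f t) = v * cintegral f.
Proof.
move=> [f1 f2].
have h (x : R) (g : R -> R) : mu.-integrable `[0%R, 1%R] (EFin \o g) ->
   mu.-integrable `[0%R, 1%R] (EFin \o (fun t => x * g t)).
  move=> hg; rewrite (_ : _ \o _ = (fun t => x%:E * (EFin \o g) t))%E //.
  exact: integrableZl.
apply: complex_eq.
  rewrite ReM /= -!RintegralZl // -RintegralB //; [|exact: h|exact: h].
  by apply: eq_Rintegral => t _; rewrite ReM.
rewrite ImM /= -!RintegralZl // -RintegralD //; [|exact: h|exact: h].
by apply: eq_Rintegral => t _; rewrite ImM.
Qed.

Lemma cintegrable_sum (F : nat -> R -> C) n :
  (forall m, cintegrable (F m)) -> cintegrable (fun t => \sum_(m < n) F m t).
Proof.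
move=> hF; elim: n => [|n IH].
  under eq_fun do rewrite big_ord0.
  by have := cintegrableZ 0 (hF 0%N); under eq_fun do rewrite mul0r.
under eq_fun do rewrite big_ord_recr /=.
exact: cintegrableD.
Qed.

Lemma cintegral_sum (F : nat -> R -> C) n :
  (forall m, cintegrable (F m)) ->
  cintegral (fun t => \sum_(m < n) F m t) = \sum_(m < n) cintegral (F m).
Proof.
move=> hF; elim: n => [|n IH].
  under [in LHS]eq_fun do rewrite big_ord0.
  rewrite big_ord0 -[RHS](mul0r (cintegral (F 0%N))) -cintegralZ //.
  by congr cintegral; apply/funext => t; rewrite mul0r.
under [in LHS]eq_fun do rewrite big_ord_recr /=.
by rewrite cintegralD // ?IH ?big_ord_recr //; exact: cintegrable_sum.
Qed.

Lemma norm_Rintegral_le (f : R -> R) B :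
  mu.-integrable `[0%R, 1%R] (EFin \o f) ->
  (forall t, 0 <= t <= 1 -> `|f t| <= B) ->
  `|\int[mu]_(t in `[0%R, 1%R]) f t| <= B.
Proof.
move=> hf hB; apply: le_trans (le_normr_Rintegral _ hf) _ => //.
have -> : B = \int[mu]_(t in `[0%R, 1%R]) B.
  rewrite Rintegral_cst //; have := @lebesgue_measure_itv R `[0%R, 1%R].
  rewrite /= lte_fin ltr01 => ->.
  by rewrite -EFinD subr0 mulr1.
apply: le_Rintegral => //.
- by have := integrable_norm hf; congr integrable.
- apply: continuous_integrable01 => ?; exact: cvg_cst.
Qed.

(** Both components are bounded by B, hence the factor 2. *)
Lemma cabs_cintegral_le (f : R -> C) B : cintegrable f ->
  (forall t, 0 <= t <= 1 -> cabs (f t) <= B) -> cabs (cintegral f) <= 2 * B.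
Proof.
move=> [f1 f2] hB; apply: (le_trans (cabs_le_ReIm _)).
rewrite mulr_natl mulr2n lerD //= norm_Rintegral_le // => t ht.
  exact: le_trans (normRe_cabs _) (hB _ ht).
exact: le_trans (normIm_cabs _) (hB _ ht).
Qed.

Definition euler_integrand r b z (t : R) : C :=
  ((r.+1%:R * t ^+ r)%:C)%C * cpowN b (1 - (t%:C)%C * z).

(** Euler's integral for 2F1(r + 1, b; r + 2; z). The third parameter exceeds the
    first by 1, so that the beta density reduces to (r + 1) t ^ r. *)
Definition euler_integral r b z : C := cintegral (euler_integrand r b z).

Lemma is_derive_exp n t : is_derive t (1 : R) (fun u : R => u ^+ n) (n%:R * t ^+ n.-1).
Proof.
have := is_deriveX n (is_derive_id t (1 : R)).
rewrite (_ : id ^+ n = (fun u : R => u ^+ n)); last first.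
  by apply/funext => u; rewrite exprfctE.
by move=> /is_derive_eq; apply; rewrite /GRing.scale /= mulr1.
Qed.

Lemma Rintegral_monomial r x y : x < y ->
  \int[mu]_(t in `[x, y]) (r.+1%:R * t ^+ r) = y ^+ r.+1 - x ^+ r.+1.
Proof.
move=> xy; rewrite /Rintegral (continuous_FTC2 (F := fun t => t ^+ r.+1)) //.
- apply: derivable_within_continuous => t _.
  exact: (@ex_derive _ _ _ _ _ _ _ (is_deriveZ (r.+1%:R : R) (is_derive_exp r t))).
- split=> [t _||].
  + exact: (@ex_derive _ _ _ _ _ _ _ (is_derive_exp r.+1 t)).
  + by apply: cvg_at_right_filter; exact: exprn_continuous.
  + by apply: cvg_at_left_filter; exact: exprn_continuous.
- move=> t _; rewrite derive1E.
  exact: (@derive_val _ _ _ _ _ _ _ (is_derive_exp r.+1 t)).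
Qed.

Lemma euler_integrand_cintegrable r b z :
  (forall t, 0 <= t <= 1 -> slit (1 - (t%:C)%C * z)) ->
  cintegrable (euler_integrand r b z).
Proof.
move=> hs.
pose d t : C := ((r.+1%:R * (r%:R * t ^+ r.-1))%:C)%C.
apply: (@cintegrable_cderive _ (fun t =>
  ((r.+1%:R * t ^+ r)%:C)%C * ((b%:C)%C * z * cpowN (b + 1) (1 - (t%:C)%C * z)) +
   d t * cpowN b (1 - (t%:C)%C * z))) => t ht.
apply: is_cderiveM; last exact/cpowN_is_cderive/hs.
apply: is_cderive_real.
have := is_deriveZ (r.+1%:R : R) (is_derive_exp r t).
by congr (is_derive _ _ _ _).
Qed.

(** The segment from 1 to 1 - z avoids the cut, so the integrand is smooth on [0,
    1]. *)
Lemma slit_plane_scale z t : slit_plane z -> 0 <= t <= 1 ->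
  slit (1 - (t%:C)%C * z).
Proof.
move=> hz /andP[t0 t1]; apply: slit_oneB; rewrite /slit_plane /=.
apply/negP => h; move/negP: hz; apply.
move: h; rewrite !lecE /= ReM ImM Re_real Im_real !mul0r subr0 addr0.
rewrite mulf_eq0 => /andP[/orP[/eqP ->|/eqP ->]]; first by rewrite mul0r ler10.
move=> h; rewrite eqxx /=.
rewrite leNgt; apply/negP => z1.
have t_gt0 : 0 < t.
  by rewrite lt_def t0 andbT; apply/eqP => e; move: h; rewrite e mul0r ler10.
nra.
Qed.

(** By compactness of the segment; D bounds the radius of convergence at z from
    below. *)
Lemma slit_plane_dist z : slit_plane z ->
  exists2 D : R, 0 < D & forall t, 0 <= t <= 1 -> D <= cabs (1 - (t%:C)%C * z).
Proof.
move=> hz.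
pose f t := cabs (1 - (t%:C)%C * z).
have cf : {within `[0%R, 1%R], continuous f}.
  rewrite /f /cabs; apply: derivable_within_continuous => t; rewrite in_itv /= => ht.
  have := slit_cabs_gt0 (slit_plane_scale hz ht).
  rewrite sqrtr_gt0 => h0.
  have hd := is_derive1_sqrt h0.
  have [h1 h2] : is_cderive (fun t => 1 - (t%:C)%C * z) t (0 + (- 1%:C%C) * z).
    apply: is_cderiveD; first exact: is_cderive_cst.
    under eq_fun do rewrite -mulNr.
    apply: is_cderive_eq.
      apply: is_cderiveM; last exact: is_cderive_cst.
      have : is_derive t (1 : R) (fun u : R => - u) (- 1) by apply: is_derive_eq.
      by move/is_cderive_real; under eq_fun do rewrite rmorphN /=; exact.
    by rewrite mulr0 add0r rmorphN.
  apply: ex_derive.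
have [c] := EVT_min ler01 cf.
rewrite in_itv /= => hc hmin; exists (f c).
  exact: slit_cabs_gt0 (slit_plane_scale hz hc).
by move=> t ht; apply: hmin; rewrite in_itv.
Qed.

End euler_integral.

(** * The hypergeometric function as Euler's integral *)

(** Convergence stated for a generic field, so that on R[i] the topology is always
    the one derived from the field norm. *)
Definition num_cvg (K : numFieldType) (u : nat -> K) (v : K) : Prop :=
  u @ \oo --> v.

Lemma num_cvgP (K : numFieldType) (u : nat -> K) (v : K) :
  num_cvg u v <-> forall e, 0 < e -> \forall n \near \oo, `|v - u n| <= e.
Proof. exact: cvgrPdist_le. Qed.

Lemma has_power_series_sumP (K : numFieldType) (u : nat -> K) (z s : K) :
  has_power_series_sum u z s <->
  num_cvg (fun n => \sum_(k < n.+1) u k * z ^+ k) s.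
Proof.
rewrite /has_power_series_sum /num_cvg -cvg_shiftS /series /=.
by under eq_fun do rewrite big_mkord.
Qed.

Section hypergeometric_continuation.
Variable R : realType.
Local Notation C := R[i].
Local Notation Re := complex.Re.
Local Notation Im := complex.Im.
Local Notation mu := (@lebesgue_measure R).
Implicit Types (v z g h : C) (b s x y : R).

Lemma pos_complexP (e : C) : 0 < e -> exists2 x : R, 0 < x & e = (x%:C)%C.
Proof.
by case: e => x y; rewrite ltcE /= => /andP[/eqP -> x0]; exists x.
Qed.

Lemma cvg_complex_squeeze (u : nat -> C) v (e : nat -> R) :
  (\forall n \near \oo, cabs (v - u n) <= e n) -> e @ \oo --> (0 : R) ->
  num_cvg u v.
Proof.
move=> hu he; apply/num_cvgP => eps /pos_complexP[x x0 ->].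
move/cvgrPdist_le : he => /(_ _ x0) he.
near=> n; rewrite cabs_le.
have : cabs (v - u n) <= e n by near: n.
move=> /le_trans; apply.
rewrite (le_trans (ler_norm _)) // -normrN -sub0r.
by near: n.
Unshelve. all: by end_near. Qed.

Lemma cvg_complexP (u : nat -> C) v : num_cvg u v ->
  forall e : R, 0 < e -> \forall n \near \oo, cabs (v - u n) <= e.
Proof.
move=> /num_cvgP hu e e0.
have e0' : 0 < (e%:C)%C by rewrite ltcR.
have := hu _ e0'; apply: filterS => n.
by rewrite cabs_le.
Qed.

(** The Taylor series of the integrand in h, integrated termwise. The m-th term
    carries t ^ (r + m), whose normalization is the quotient (r + 1) / (r + m + 1). *)
Definition euler_coef r b z m : C :=
  ((binom_coef b m * (r.+1%:R / (r + m).+1%:R))%:C)%C *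
  euler_integral (r + m) (b + m%:R) z.

(** The Taylor error of the integrand at 1 - t z with increment t h is uniform in t,
    since |t h| <= |h| < D <= |1 - t z|. *)
Lemma euler_integral_power_series r b z D h : 0 < b ->
  (forall t, 0 <= t <= 1 -> D <= cabs (1 - (t%:C)%C * z)) -> cabs h < D ->
  (forall s, 0 <= s <= 1 -> slit_plane (z + (s%:C)%C * h)) ->
  has_power_series_sum (euler_coef r b z) h (euler_integral r b (z + h)).
Proof.
move=> b0 hD hh hs.
have h0 := cabs_ge0 h; have D0 := le_lt_trans h0 hh.
have sz t : 0 <= t <= 1 -> slit (1 - (t%:C)%C * z).
  move=> ht; have /hs : 0 <= (0 : R) <= 1 by rewrite lexx ler01.
  by rewrite mul0r addr0 => /slit_plane_scale; apply.
have szh t : 0 <= t <= 1 -> slit (1 - (t%:C)%C * (z + h)).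
  move=> ht; have /hs : 0 <= (1 : R) <= 1 by rewrite lexx ler01.
  by rewrite mul1r => /slit_plane_scale; apply.
pose err M := 2 * (pochhammer b M.+1 / M`!%:R * (cabs h / D) ^+ M *
   (cabs h * (D - cabs h) `^ (- (b + 1)))).
apply/has_power_series_sumP.
apply: (@cvg_complex_squeeze _ _ (fun M => 2 * (r.+1%:R * err M))).
  apply: nearW => M.
  pose c m : C := ((binom_coef b m * (r.+1%:R / (r + m).+1%:R))%:C)%C * h ^+ m.
  have -> : \sum_(i < M.+1) euler_coef r b z i * h ^+ i =
     cintegral (fun t => \sum_(i < M.+1) c i * euler_integrand (r + i) (b + i%:R) z t).
    rewrite (cintegral_sum (F := fun i t => c i * euler_integrand (r + i) (b + i%:R) z t)).
      apply: eq_bigr => i _; rewrite cintegralZ; last exact: euler_integrand_cintegrable.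
      by rewrite /c /euler_coef /euler_integral mulrAC.
    by move=> m; apply/cintegrableZ/euler_integrand_cintegrable.
  rewrite -mulN1r -cintegralZ; last first.
    apply: (cintegrable_sum (F := fun i t => c i * euler_integrand (r + i) (b + i%:R) z t)) => m.
    exact/cintegrableZ/euler_integrand_cintegrable.
  have i1 := euler_integrand_cintegrable r b szh.
  have i2 : cintegrable (fun t => -1 * \sum_(i < M.+1) c i * euler_integrand (r + i) (b + i%:R) z t).
    apply/cintegrableZ/(cintegrable_sum (F := fun i t => c i * euler_integrand (r + i) (b + i%:R) z t)) => m.
    exact/cintegrableZ/euler_integrand_cintegrable.
  rewrite -cintegralD //; apply: cabs_cintegral_le; first exact: cintegrableD.
  move=> t ht; rewrite mulN1r.
  have -> : \sum_(i < M.+1) c i * euler_integrand (r + i) (b + i%:R) z t =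
     ((r.+1%:R * t ^+ r)%:C)%C * \sum_(i < M.+1) ((binom_coef b i)%:C)%C *
        ((t%:C)%C * h) ^+ i * cpowN (b + i%:R) (1 - (t%:C)%C * z).
    rewrite mulr_sumr; apply: eq_bigr => i _.
    have e : binom_coef b i * (r.+1%:R / (r + i).+1%:R) *
       ((r + i).+1%:R * t ^+ (r + i)) = r.+1%:R * t ^+ r * binom_coef b i * t ^+ i.
      have : (r + i).+1%:R != 0 :> R by rewrite pnatr_eq0.
      rewrite exprD; move: (r + i).+1%:R => q q0.
      transitivity (r.+1%:R * t ^+ r * binom_coef b i * t ^+ i * (q / q)); first by ring.
      by rewrite mulfV // mulr1.
    rewrite /c /euler_integrand; move: (cpowN _ _) => p.
    rewrite exprMn -rmorphXn; move/(congr1 (@real_complex R)): e.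
    rewrite !(rmorphM (@real_complex R) _ (t ^+ i)) /=.
    rewrite !(rmorphM (@real_complex R) _ (binom_coef b i)) /=.
    rewrite !(rmorphM (@real_complex R) (binom_coef b i * _)) /=.
    have alg (x1 x2 x3 x4 x5 x6 : C) : x1 * x2 = x3 * x4 * x5 ->
        x1 * x6 * (x2 * p) = x3 * (x4 * (x5 * x6) * p).
      by move=> e; transitivity ((x1 * x2) * x6 * p); [ring|rewrite e; ring].
    exact: alg.
  rewrite /euler_integrand -mulrBr cabsM.
  have -> : 1 - (t%:C)%C * (z + h) = 1 - (t%:C)%C * z - (t%:C)%C * h.
    by rewrite mulrDr opprD addrA.
  case/andP: (ht) => t0 t1.
  apply: ler_pM; rewrite ?cabs_ge0 //.
    rewrite cabs_real ger0_norm ?mulr_ge0 ?exprn_ge0 // ler_piMr //.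
    exact: exprn_ile1.
  apply: cpowN_taylor_error => //.
  - exact: hD.
  - by rewrite cabsM cabs_real ger0_norm // ler_piMl.
  move=> s /andP[s0 s1].
  have := hs _ (introT andP (conj s0 s1)) => /slit_plane_scale/(_ ht).
  by congr slit; rewrite mulrDr opprD addrA; congr (_ - _); rewrite mulrCA.
rewrite -[0](mulr0 2); apply: cvgMr; rewrite -(mulr0 r.+1%:R); apply: cvgMr.
rewrite /err -[0](mulr0 2); apply: cvgMr.
rewrite -[0](mul0r (cabs h * (D - cabs h) `^ (- (b + 1)))); apply: cvgMl.
apply: cvg_pochhammer_geometric => //.
by rewrite divr_ge0 ?(ltW D0) //= ltr_pdivrMr // mul1r.
Qed.

Lemma slit_plane_ball z D h s :
  (forall t, 0 <= t <= 1 -> D <= cabs (1 - (t%:C)%C * z)) -> cabs h < D ->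
  0 <= s <= 1 -> slit_plane (z + (s%:C)%C * h).
Proof.
move=> hD hh /andP[s0 s1]; apply/negP => h1.
(* If w = z + s h is real and at least 1, then t = 1 / w gives
   |1 - t z| = |s h| / w < D. *)
move: h1; rewrite lecE /= => /andP[/eqP I0 R1].
set w := z + _ in I0 R1.
have wE : w = ((Re w)%:C)%C by apply: complex_eq.
have w0 : 0 < Re w by rewrite (lt_le_trans ltr01).
have /hD : 0 <= (Re w)^-1 <= 1 by rewrite invr_ge0 ltW //= invf_le1.
have -> : 1 - (((Re w)^-1)%:C)%C * z = (((Re w)^-1)%:C)%C * ((s%:C)%C * h).
  have -> : 1 = (((Re w)^-1)%:C)%C * w.
    by rewrite [in RHS]wE -rmorphM /= mulVf ?gt_eqF.
  by rewrite -mulrBr /w addrAC subrr add0r.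
rewrite leNgt => /negP; apply; rewrite !cabsM !cabs_real !ger0_norm ?invr_ge0 //; last exact: ltW.
apply: le_lt_trans hh; rewrite mulrA ler_piMl ?cabs_ge0 //.
by rewrite mulr_ile1 ?invr_ge0 ?(ltW w0) // invf_le1.
Qed.

Lemma euler_integral_at0 r b : euler_integral r b 0 = 1.
Proof.
rewrite /euler_integral.
have -> : euler_integrand r b 0 = fun t => ((r.+1%:R * t ^+ r)%:C)%C.
  by apply/funext => t; rewrite /euler_integrand mulr0 subr0 cpowN1 mulr1.
apply: complex_eq => /=.
  by rewrite Rintegral_monomial // expr1n expr0n /= subr0.
by rewrite Rintegral_cst // mul0r.
Qed.

(** Because (r + 1) / (r + m + 1) is the quotient of the m-th Pochhammer symbols of
    r + 1 and r + 2. *)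
Lemma euler_coef0 r b m :
  euler_coef r b 0 m = hyp2F1_coef ((r.+1%:R)%:C)%C (b%:C)%C ((r.+2%:R)%:C)%C m.
Proof.
rewrite /euler_coef euler_integral_at0 mulr1 /hyp2F1_coef.
have pE (x : R) n : pochhammer (x%:C)%C n = ((pochhammer x n)%:C)%C.
  by rewrite /pochhammer rmorph_prod; apply: eq_bigr => i _; rewrite rmorphD rmorph_nat.
rewrite !pE -[m`!%:R](rmorph_nat (@real_complex R)) -!fmorphV -!rmorphM /=.
congr ((_)%:C)%C; rewrite /binom_coef.
have -> : r.+1%:R / (r + m).+1%:R = pochhammer r.+1%:R m / pochhammer r.+2%:R m :> R.
  elim: m => [|m IH]; first by rewrite !pochhammer0 addn0 !divff // pnatr_eq0.
  rewrite !pochhammerS invfM mulrACA -IH -!natrD -addSnnS !addSn.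
  have n1 : (r + m).+1%:R != 0 :> R by rewrite pnatr_eq0.
  by rewrite mulrA divfK.
move: (pochhammer b m) (pochhammer r.+1%:R m) (pochhammer r.+2%:R m)^-1 (m`!%:R^-1).
by move=> x1 x2 x3 x4; ring.
Qed.

Lemma euler_integral_is_hyp2F1 r b : 0 < b ->
  is_hyp2F1 ((r.+1%:R)%:C)%C (b%:C)%C ((r.+2%:R)%:C)%C (euler_integral r b).
Proof.
move=> b0; split.
  move=> z hz; have [D D0 hD] := slit_plane_dist hz.
  exists (euler_coef r b z).
  have D0' : 0 < (D%:C)%C by rewrite ltcR.
  apply/nbhs_ballP; exists (D%:C)%C => //= w; rewrite /ball /= => hw.
  have hh : cabs (w - z) < D by rewrite -cabsN opprB -cabs_lt.
  have -> : euler_integral r b w = euler_integral r b (z + (w - z)) by rewrite addrC subrK.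
  exact: (euler_integral_power_series b0 hD hh (fun s hs => slit_plane_ball hD hh hs)).
move=> z hz.
have hD (t : R) : 0 <= t <= 1 -> 1 <= cabs (1 - (t%:C)%C * 0).
  by move=> _; rewrite mulr0 subr0 (cabs_real 1) normr1.
have hh : cabs z < 1 by rewrite -cabs_lt.
have := @euler_integral_power_series r b _ _ _ b0 hD hh (fun s hs => slit_plane_ball hD hh hs).
rewrite add0r; congr has_power_series_sum; apply/funext => m; exact: euler_coef0.
Qed.

End hypergeometric_continuation.

(** * Uniqueness of the continuation on the negative axis *)

Section identity_theorem.
Variable R : realType.
Local Notation C := R[i].
Local Notation Re := complex.Re.
Local Notation Im := complex.Im.
Local Notation mu := (@lebesgue_measure R).
Implicit Types (v z g h : C) (b s x y : R).

Lemma power_series_coef_bounded (u : nat -> C) x v : 0 < x ->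
  has_power_series_sum u (x%:C)%C v ->
  exists2 B : R, 0 < B & forall n, cabs (u n) * x ^+ n <= B.
Proof.
move=> x0 /has_power_series_sumP hu.
have [N _ hN] := cvg_complexP hu ltr01.
pose S n := \sum_(k < n.+1) u k * (x%:C)%C ^+ k.
have SB : exists2 B : R, 0 < B & forall n, cabs (S n) <= B.
  exists (1 + cabs v + \sum_(k < N) cabs (S k)).
    by rewrite -addrA ltr_pwDl // addr_ge0 ?cabs_ge0 ?sumr_ge0 // => i _; exact: cabs_ge0.
  move=> n; case: (ltnP n N) => nN.
    rewrite (bigD1 (Ordinal nN)) //= addrCA -[X in X <= _]addr0 lerD2l.
    by rewrite !addr_ge0 ?cabs_ge0 ?sumr_ge0 // => i _; exact: cabs_ge0.
  have -> : S n = v + - (v - S n) by rewrite opprB addrC subrK.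
  rewrite (le_trans (ler_cabsD _ _)) // cabsN (addrC 1) -addrA lerD2l.
  rewrite (le_trans (hN _ nN)) // lerDl sumr_ge0 // => i _; exact: cabs_ge0.
have [B B0 hB] := SB; exists (2 * B); first by rewrite mulr_gt0.
have e n : cabs (u n) * x ^+ n = cabs (u n * (x%:C)%C ^+ n).
  by rewrite cabsM cabsX cabs_real gtr0_norm.
case=> [|n]; rewrite e.
  have := hB 0%N; rewrite /S big_ord1 /= => /le_trans; apply; lra.
have -> : u n.+1 * (x%:C)%C ^+ n.+1 = S n.+1 + - S n.
  by rewrite /S big_ord_recr /= addrAC subrr add0r.
rewrite (le_trans (ler_cabsD _ _)) // cabsN mulr_natl mulr2n.
by rewrite lerD.
Qed.

(** If u m is the first nonzero coefficient, then |u m| x ^ m is bounded by the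
    remaining terms, which are O(x ^ (m + 1)) as x decreases to 0. *)
Lemma power_series_zero (u : nat -> C) (e : R) : 0 < e ->
  (forall x, 0 < x < e -> has_power_series_sum u (x%:C)%C 0) -> forall n, u n = 0.
Proof.
move=> e0 hu; have e20 : 0 < e / 2 by rewrite divr_gt0.
have [|B B0 hB] := @power_series_coef_bounded u (e / 2) 0 e20.
  by apply: hu; rewrite e20 /=; lra.
set a := e / 2 in e20 hB.
elim/ltn_ind => m IH; apply/eqP/negPn/negP => um.
have um0 : 0 < cabs (u m).
  rewrite lt_def cabs_ge0 andbT; apply/eqP => c0; move/negP: um; apply.
  by rewrite -normr_eq0 normr_cabs c0.
(* B (x / a) ^ n bounds the n-th term, and x / a <= 1 / 2 sums the tail. *)
have key x : 0 < x <= a / 2 -> cabs (u m) * x ^+ m <= 2 * B * (x / a) ^+ m.+1.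
  move=> /andP[x0 xa].
  apply/ler_addgt0Pr => d d0.
  have /has_power_series_sumP hx : has_power_series_sum u (x%:C)%C 0.
    by apply: hu; rewrite x0 /=; move: xa; rewrite /a; lra.
  have [N _ hN] := cvg_complexP hx d0.
  have := hN (N + m)%N (leq_addr _ _).
  rewrite sub0r cabsN.
  rewrite -addnS -(big_mkord xpredT (fun k => u k * (x%:C)%C ^+ k)).
  rewrite (@big_cat_nat _ _ _ m) //=; last by rewrite (leq_trans (leqnSn _)) ?leq_addl.
  rewrite big_nat_cond big1 ?add0r; last first.
    by move=> i /andP[/andP[_ im] _]; rewrite IH // mul0r.
  rewrite big_ltn ?addnS ?ltnS ?leq_addl //.
  set T := \sum_(_ <= _ < _) _ => hS.
  have hT : cabs T <= 2 * B * (x / a) ^+ m.+1.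
    have hq : 0 <= x / a <= 2^-1.
      by rewrite divr_ge0 ?(ltW x0) ?(ltW e20) //= ler_pdivrMr // mulrC.
    have : forall n, cabs (\sum_(m.+1 <= i < n) u i * (x%:C)%C ^+ i) <=
       B * (2 * (x / a) ^+ m.+1 - 2 * (x / a) ^+ maxn n m.+1).
      elim=> [|n IHn]; first by rewrite big_geq // max0n subrr mulr0 /cabs /= expr0n addr0 sqrtr0.
      case: (leqP m.+1 n) => mn; last first.
        rewrite big_geq // (maxn_idPr _) // subrr mulr0.
        by rewrite /cabs /= expr0n addr0 sqrtr0.
      rewrite big_nat_recr //= (le_trans (ler_cabsD _ _)) //.
      have : cabs (u n * (x%:C)%C ^+ n) <= B * (x / a) ^+ n.
        rewrite cabsM cabsX cabs_real gtr0_norm //.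
        have -> : cabs (u n) * x ^+ n = cabs (u n) * a ^+ n * (x / a) ^+ n.
          by rewrite -mulrA -exprMn mulrCA mulfV ?mulr1 // gt_eqF.
        by rewrite ler_wpM2r // exprn_ge0 //; case/andP: hq.
      move: IHn; rewrite (maxn_idPl mn) (maxn_idPl (leqW mn)) [(x / a) ^+ n.+1]exprS.
      have : 0 <= B * ((x / a) ^+ n * (1 - 2 * (x / a))).
        case/andP: hq => q0 q1; rewrite !mulr_ge0 ?exprn_ge0 ?(ltW B0) //; lra.
      nra.
    move=> /(_ (N + m).+1)/le_trans; apply.
    rewrite mulrBr mulrA [B * 2]mulrC gerBl.
    by case/andP: hq => *; rewrite !mulr_ge0 ?exprn_ge0 // ltW.
  have : cabs (u m * (x%:C)%C ^+ m) <= d + 2 * B * (x / a) ^+ m.+1.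
    have -> : u m * (x%:C)%C ^+ m = (u m * (x%:C)%C ^+ m + T) + - T by rewrite addrK.
    by rewrite (le_trans (ler_cabsD _ _)) // cabsN lerD.
  by rewrite cabsM cabsX cabs_real gtr0_norm // addrC.
pose K := 2 * B / a ^+ m.+1.
have K0 : 0 < K by rewrite divr_gt0 ?mulr_gt0 ?exprn_gt0.
have key2 x : 0 < x <= a / 2 -> cabs (u m) <= K * x.
  move=> hx; have := key _ hx; case/andP: hx => x0 _.
  rewrite exprMn exprS exprVn => h.
  rewrite -(ler_pM2r (exprn_gt0 m x0)) (le_trans h) // /K le_eqVlt; apply/orP; left.
  by apply/eqP; ring.
pose x := Num.min (a / 2) (cabs (u m) / (2 * K)).
have x0 : 0 < x by rewrite lt_min !divr_gt0 // mulr_gt0.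
have := key2 x; rewrite x0 ge_min lexx /= => /(_ isT) h.
have : K * x <= cabs (u m) / 2.
  have -> : cabs (u m) / 2 = K * (cabs (u m) / (2 * K)) by field; rewrite gt_eqF.
  by rewrite ler_pM2l // ge_min lexx orbT.
by move=> /(le_trans h); lra.
Qed.

Lemma has_power_series_sumB (u1 u2 : nat -> C) z (v1 v2 : C) :
  has_power_series_sum u1 z v1 -> has_power_series_sum u2 z v2 ->
  has_power_series_sum (fun n => u1 n - u2 n) z (v1 - v2).
Proof.
move=> /has_power_series_sumP/cvg_complexP h1 /has_power_series_sumP/cvg_complexP h2.
apply/has_power_series_sumP/num_cvgP => eps /pos_complexP[x x0 ->].
have x20 : 0 < x / 2 by rewrite divr_gt0.
apply: filterS2 (h1 _ x20) (h2 _ x20) => n hn1 hn2.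
rewrite cabs_le.
under eq_bigr do rewrite mulrBl.
rewrite sumrB.
move: (\sum_(_ < _) _) (\sum_(_ < _) _) hn1 hn2 => S2 S1 hn1 hn2.
have -> : v1 - v2 - (S1 - S2) = (v1 - S1) + - (v2 - S2) by ring.
by rewrite (le_trans (ler_cabsD _ _)) // cabsN [x]splitr lerD.
Qed.

Lemma analytic_on_ball (U : set C) (G : C -> C) z :
  @analytic_on C U G -> U z -> exists u, exists2 e : R, 0 < e &
  forall w, cabs (w - z) < e -> has_power_series_sum u (w - z) (G w).
Proof.
move=> hG /hG[u] /nbhs_ballP[e /= /pos_complexP[x x0 ->] he].
exists u, x => // w hw; apply: he; rewrite /ball /= distrC cabs_lt //.
Qed.

(** Let s be the supremum of the x with G1 = G2 on [- x, 0]. The difference of the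
    two power series at - s vanishes on the side of the origin, hence identically,
    which pushes the equality beyond - s. For s = 0 the unit disc supplies the
    points on the positive side. *)
Lemma analytic_unique_neg_axis (G1 G2 : C -> C) :
  @analytic_on C (@slit_plane C) G1 -> @analytic_on C (@slit_plane C) G2 ->
  (forall z, `|z| < 1 -> G1 z = G2 z) ->
  forall x : R, 0 <= x -> G1 ((- x)%:C)%C = G2 ((- x)%:C)%C.
Proof.
move=> a1 a2 h01 X X0; apply/eqP/negPn/negP => hX.
pose S := [set x : R | forall y, 0 <= y <= x -> G1 ((- y)%:C)%C = G2 ((- y)%:C)%C].
have S0 : S 0.
  move=> y y0; apply: h01; have -> : y = 0 by apply/eqP; rewrite eq_le andbC.
  by rewrite oppr0 normr0 ltr01.
have SX : ubound S X.
  move=> x /= hx; rewrite leNgt; apply/negP => Xx; move/negP: hX; apply.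
  by apply/eqP/hx; rewrite X0 ltW.
have hs : has_sup S by split; [exists 0|exists X].
set s := sup S.
have s0 : 0 <= s by apply: ub_le_sup => //; exists X.
have zs : slit_plane ((- s)%:C)%C.
  rewrite /slit_plane /= lecE /= eqxx /= -ltNge (le_lt_trans _ ltr01) // oppr_le0 //.
have [u1 [e1 e10 hu1]] := analytic_on_ball a1 zs.
have [u2 [e2 e20 hu2]] := analytic_on_ball a2 zs.
pose e := Num.min e1 e2.
have e0 : 0 < e by rewrite lt_min e10.
have bel x : 0 <= x < s -> G1 ((- x)%:C)%C = G2 ((- x)%:C)%C.
  move=> /andP[x0 xs]; have [t St xt] := sup_gt hs.1 xs.
  by apply: St; rewrite x0 ltW.
have ser w : cabs (w - ((- s)%:C)%C) < e ->
   has_power_series_sum (fun n => u1 n - u2 n) (w - ((- s)%:C)%C) (G1 w - G2 w).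
  rewrite lt_min => /andP[w1 w2].
  by apply: has_power_series_sumB; [exact: hu1|exact: hu2].
have u0 n : u1 n - u2 n = 0.
  case: (ltP 0 s) => [s_gt0|s_le0].
    move: n; apply: (@power_series_zero (fun n => u1 n - u2 n) (Num.min e s)); first by rewrite lt_min e0.
    move=> x /andP[x0]; rewrite lt_min => /andP[xe xs].
    have E : ((- (s - x))%:C)%C - ((- s)%:C)%C = (x%:C)%C :> C.
      by rewrite -rmorphB /=; congr (_%:C)%C; ring.
    have := ser ((- (s - x))%:C)%C; rewrite E cabs_real gtr0_norm // => /(_ xe).
    by rewrite bel ?subrr // subr_ge0 ltW //= ltrBlDr ltrDl.
  move: n; apply: (@power_series_zero (fun n => u1 n - u2 n) (Num.min e 1)); first by rewrite lt_min e0 /=.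
  have s00 : s = 0 by apply/eqP; rewrite eq_le s_le0.
  move=> x /andP[x0]; rewrite lt_min => /andP[xe x1].
  have E : (x%:C)%C - ((- s)%:C)%C = (x%:C)%C :> C.
    by rewrite s00 oppr0 subr0.
  have := ser (x%:C)%C; rewrite E cabs_real gtr0_norm // => /(_ xe).
  by rewrite h01 ?subrr // normr_cabs cabs_real gtr0_norm // ltcR.
have Ss : S (s + e / 2).
  move=> y /andP[y0 ys]; case: (ltP y s) => [ys'|sy]; first by apply: bel; rewrite y0.
  have hw : cabs (((- y)%:C)%C - ((- s)%:C)%C : C) < e.
    rewrite -rmorphB cabs_real /= opprK addrC -normrN opprB ger0_norm ?subr_ge0 //.
    lra.
  have /has_power_series_sumP/cvg_complexP hc := ser _ hw.
  apply/eqP; rewrite -subr_eq0 -normr_le0 normr_cabs lecR.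
  apply/ler_addgt0Pr => d d0; rewrite add0r.
  have [N _ /(_ N (leqnn _))] := hc _ d0.
  by rewrite big1 ?subr0 // => i _; rewrite u0 mul0r.
have := ub_le_sup (ex_intro _ X SX) Ss.
by rewrite -/s; lra.
Qed.

(** [hyp2F1] picks some continuation; on the negative axis it can only be Euler's
    integral. *)
Lemma hyp2F1_real_neg r b x : 0 < b -> 0 <= x ->
  hyp2F1_real r.+1%:R b r.+2%:R (- x) =
  \int[mu]_(t in `[0%R, 1%R]) (r.+1%:R * t ^+ r * (1 + x * t) `^ (- b)).
Proof.
move=> b0 x0; rewrite /hyp2F1_real /hyp2F1.
set S := [set G | _].
have hE : S (euler_integral r b) by exact: euler_integral_is_hyp2F1.
have [a1 s1] : S (xget (fun=> 0) S) by apply: xgetPex; exists (euler_integral r b).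
have [a2 s2] := hE.
have -> : xget (fun=> 0) S ((- x)%:C)%C = euler_integral r b ((- x)%:C)%C.
  apply: (@analytic_unique_neg_axis (xget (fun=> 0) S) (euler_integral r b) a1 a2 _ x x0) => z z1.
  have /has_power_series_sumP/cvg_complexP h1 := s1 _ z1.
  have /has_power_series_sumP/cvg_complexP h2 := s2 _ z1.
  apply/eqP; rewrite -subr_eq0 -normr_le0 normr_cabs lecR.
  apply/ler_addgt0Pr => d d0; rewrite add0r.
  have d20 : 0 < d / 2 by rewrite divr_gt0.
  have [N1 _ hN1] := h1 _ d20; have [N2 _ hN2] := h2 _ d20.
  have := hN1 (maxn N1 N2) (leq_maxl _ _); have := hN2 (maxn N1 N2) (leq_maxr _ _).
  set T := \sum_(_ < _) _; move=> q2 q1.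
  set g1 := xget _ _ _ in q1 *; set g2 := euler_integral _ _ _ in q2 *.
  have -> : g1 - g2 = (g1 - T) + - (g2 - T) by ring.
  rewrite (le_trans (ler_cabsD _ _)) // cabsN [d]splitr.
  by rewrite lerD.
have E t : 0 <= t <= 1 -> Re (euler_integrand r b ((- x)%:C)%C t) =
    r.+1%:R * t ^+ r * (1 + x * t) `^ (- b).
  move=> /andP[t0 t1]; rewrite /euler_integrand.
  have -> : 1 - (t%:C)%C * ((- x)%:C)%C = ((1 + x * t)%:C)%C :> C.
    by rewrite -rmorphM /= mulrN rmorphN opprK rmorphD /= mulrC.
  rewrite cpowN_real ?ltr_pwDl ?mulr_ge0 // ReM !Re_real !Im_real.
  by rewrite mul0r subr0.
transitivity (\int[mu]_(t in `[0%R, 1%R]) Re (euler_integrand r b ((- x)%:C)%C t)) => //.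
apply: eq_Rintegral => t /set_mem ht; rewrite E //.
Qed.

End identity_theorem.

(** * Riemann-Stieltjes sums *)

Section riemann_sums.
Variable R : realType.
Local Notation mu := (@lebesgue_measure R).
Implicit Types (f : R -> R) (x y : R).

Lemma Rintegral_monomial_bounds r f x y lo hi : 0 <= x -> x < y ->
  {within `[x, y], continuous f} ->
  (forall t, x <= t <= y -> lo <= f t <= hi) ->
  lo * (y ^+ r.+1 - x ^+ r.+1) <=
  \int[mu]_(t in `[x, y]) (r.+1%:R * t ^+ r * f t) <=
  hi * (y ^+ r.+1 - x ^+ r.+1).
Proof.
move=> x0 xy cf hf.
have cw : {within `[x, y], continuous (fun t : R => r.+1%:R * t ^+ r)}.
  apply: derivable_within_continuous => t _.
  exact: (@ex_derive _ _ _ _ _ _ _ (is_deriveZ (r.+1%:R : R) (is_derive_exp r t))).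
have iw := continuous_integrable01 cw.
have iwf : mu.-integrable `[x, y] (EFin \o (fun t => r.+1%:R * t ^+ r * f t)).
  by apply: continuous_integrable01 => t; apply: cvgM; [exact: cw|exact: cf].
have iZ (c : R) : mu.-integrable `[x, y] (EFin \o (fun t => c * (r.+1%:R * t ^+ r))).
  rewrite (_ : _ \o _ = fun t => c%:E * (EFin \o (fun t => (r.+1%:R * t ^+ r)%R)) t)%E //.
  exact: integrableZl.
have w0 t : x <= t -> 0 <= r.+1%:R * t ^+ r :> R.
  by move=> xt; rewrite mulr_ge0 ?exprn_ge0 // (le_trans x0).
rewrite -!Rintegral_monomial // -!RintegralZl //; apply/andP; split.
  apply: le_Rintegral => // t; rewrite /= in_itv /= => /andP[xt ty].
  by have /andP[h _] := hf t (introT andP (conj xt ty)); rewrite mulrC ler_wpM2l // w0.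
apply: le_Rintegral => // t; rewrite /= in_itv /= => /andP[xt ty].
by have /andP[_ h] := hf t (introT andP (conj xt ty)); rewrite [X in _ <= X]mulrC ler_wpM2l // w0.
Qed.

Lemma Rintegral_split f x y : 0 <= x -> x < y ->
  {within `[0%R, y], continuous f} ->
  \int[mu]_(t in `[0%R, y]) f t =
  \int[mu]_(t in `[0%R, x]) f t + \int[mu]_(t in `[x, y]) f t.
Proof.
move=> x0 xy cf; have i := continuous_integrable01 cf.
have := Rintegral_itvB i (x := x); rewrite !bnd_simp => /(_ x0 (ltW xy)).
rewrite Rintegral_itv_obnd_cbnd; last first.
  apply: integrableS i => //; apply: subset_itv; rewrite bnd_simp //.
by move=> <-; rewrite addrC subrK.
Qed.

(** Sum for the integral of f against d (t ^ (r + 1)), with f taken at the right end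
    of each of M equal blocks. *)
Definition riemann_stieltjes_sum r f M : R :=
  \sum_(j < M) ((j.+1%:R / M%:R) ^+ r.+1 - (j%:R / M%:R) ^+ r.+1) *
    f (j.+1%:R / M%:R).

(** On each block f lies between its values at the two ends, and the weight of a
    block is at most (r + 1) / M, so the total error telescopes to f 0 - f 1 times
    this quotient. *)
Lemma riemann_stieltjes_bounds r f M : (0 < M)%N ->
  {within `[0%R, 1%R], continuous f} ->
  (forall s t, 0 <= s -> s <= t -> t <= 1 -> f t <= f s) -> (forall t, 0 <= t <= 1 -> 0 <= f t) ->
  riemann_stieltjes_sum r f M <=
  \int[mu]_(t in `[0%R, 1%R]) (r.+1%:R * t ^+ r * f t) <=
  riemann_stieltjes_sum r f M + r.+1%:R / M%:R * f 0.
Proof.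
move=> M0 cf fdec f0.
pose s j : R := j%:R / M%:R.
pose S := \sum_(j < M) (s j.+1 ^+ r.+1 - s j ^+ r.+1) * f (s j.+1).
rewrite -[riemann_stieltjes_sum r f M]/S.
have Mr : (0 : R) < M%:R by rewrite ltr0n.
have s0 : s 0%N = 0 by rewrite /s mul0r.
have sM : s M = 1 by rewrite /s divff // gt_eqF.
have sge j : 0 <= s j by rewrite /s divr_ge0.
have sle i j : (i <= j)%N -> s i <= s j.
  by move=> ij; rewrite /s ler_pM2r ?invr_gt0 // ler_nat.
have slt j : s j < s j.+1 by rewrite /s ltr_pM2r ?invr_gt0 // ltr_nat.
have s1 j : (j <= M)%N -> s j <= 1 by move=> jM; rewrite -sM sle.
pose w t := r.+1%:R * t ^+ r * f t.
have cw : {within `[0%R, 1%R], continuous w}.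
  have cw' : {within `[0%R, 1%R], continuous (fun t : R => r.+1%:R * t ^+ r)}.
    apply: derivable_within_continuous => t _.
    exact: (@ex_derive _ _ _ _ _ _ _ (is_deriveZ (r.+1%:R : R) (is_derive_exp r t))).
  by move=> t; apply: cvgM; [exact: cw'|exact: cf].
have sub x y (g : R -> R) : 0 <= x -> y <= 1 -> {within `[0%R, 1%R], continuous g} ->
    {within `[x, y], continuous g}.
  move=> x0 y1; apply: continuous_subspaceW; apply: subset_itv; rewrite bnd_simp //.
have key j : (j <= M)%N ->
  \sum_(i < j) (s i.+1 ^+ r.+1 - s i ^+ r.+1) * f (s i.+1) <=
  \int[mu]_(t in `[0%R, s j]) w t <=
  \sum_(i < j) (s i.+1 ^+ r.+1 - s i ^+ r.+1) * f (s i.+1) +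
    r.+1%:R / M%:R * (f 0 - f (s j)).
  elim: j => [_|j IH jM].
    by rewrite !big_ord0 s0 set_itv1 Rintegral_set1 subrr mulr0 add0r lexx.
  have /andP[IH1 IH2] := IH (ltnW jM).
  rewrite (Rintegral_split (sge j) (slt j)); last by apply: sub => //; exact: s1.
  have hb t : s j <= t <= s j.+1 -> f (s j.+1) <= f t <= f (s j).
    move=> /andP[t1 t2]; rewrite !fdec //.
    - exact: le_trans t2 (s1 _ jM).
    - exact: le_trans t1.
    - exact: s1.
  have cj : {within `[s j, s j.+1], continuous f} by apply: sub => //; exact: s1.
  have /andP[B1 B2] := Rintegral_monomial_bounds r (sge j) (slt j) cj hb.
  rewrite !big_ord_recr /=; apply/andP; split.
    by rewrite lerD // mulrC.
  rewrite (le_trans (lerD IH2 B2)) //.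
  have D : s j.+1 ^+ r.+1 - s j ^+ r.+1 <= r.+1%:R / M%:R.
    rewrite subrXX.
    have -> : s j.+1 - s j = M%:R^-1 by rewrite /s -mulrBl -natrB // subSnn mul1r.
    rewrite mulrC ler_wpM2r ?invr_ge0 //.
    have -> : r.+1%:R = \sum_(i < r.+1) (1 : R) by rewrite sumr_const card_ord.
    apply: ler_sum => i _; apply: mulr_ile1; rewrite ?exprn_ge0 ?exprn_ile1 ?s1 //; exact: ltnW.
  have := ler_wpM2r (_ : 0 <= f (s j) - f (s j.+1)) D.
  rewrite subr_ge0 fdec ?sle ?s1 // => /(_ isT).
  lra.
have := key M (leqnn _); rewrite sM -/S => /andP[-> h] /=.
rewrite (le_trans h) // lerD2l ler_wpM2l ?divr_ge0 // gerBl f0 //.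
by rewrite ler01 lexx.
Qed.

End riemann_sums.

(** * Order statistics and the net amount *)

Section sorted_lists.
Variable R : realType.
Implicit Types (s t : seq R) (b y K : R).

(** Past the end of the list nth returns 0, and the equivalence survives only for
    nonnegative y; hence the side condition. *)
Lemma gt_nth_count s y i : sorted >=%O s -> (i < size s)%N || (0 <= y) ->
  (y < nth 0 s i) = (i < count (fun x => (y < x)%R) s)%N.
Proof.
elim: s i => [|x s IH] i; first by move=> _ /= y0; rewrite nth_nil /= ltNge y0.
rewrite /= => sx iy; have ss := path_sorted sx.
have xs : all (fun z => z <= x) s.
  by have := order_path_min ge_trans sx; apply: sub_all => z.
have c0 : y < x = false -> count (fun x => (y < x)%R) s = 0%N.
  move=> yx; apply/eqP; rewrite -leqn0 leqNgt -has_count; apply/hasPn => z zs.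
  by rewrite -leNgt (le_trans (allP xs _ zs)) // leNgt yx.
case: i iy => [|i] /= iy.
  by case yx: (y < x) => //=; rewrite c0.
rewrite IH //; case yx: (y < x) => //=; by rewrite c0.
Qed.

Lemma sum_drop s r :
  \sum_(x <- s) x = \sum_(i < r) nth 0 s i + \sum_(x <- drop r s) x.
Proof.
elim: r s => [|r IH] [|x s]; rewrite ?drop0 ?big_ord0 ?add0r //.
  by rewrite big_nil big1 ?addr0 // => i _; rewrite nth_nil.
by rewrite big_cons (IH s) big_ord_recl addrA.
Qed.

Lemma drop_nthS s r :
  \sum_(x <- drop r s) x = nth 0 s r + \sum_(x <- drop r.+1 s) x.
Proof.
have := sum_drop s r; rewrite (sum_drop s r.+1) big_ord_recr /= -addrA.
by move/addrI.
Qed.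

(** All but the r largest entries are at most b, so truncation leaves them
    unchanged. *)
Lemma sum_drop_le s r b : sorted >=%O s -> 0 <= b -> {in s, forall x, 0 <= x} ->
  (count (fun x => (b < x)%R) s <= r)%N ->
  \sum_(x <- drop r s) x <= \sum_(x <- s) Num.min x b.
Proof.
move=> ss b0 s0 cb.
rewrite -[in X in _ <= X](cat_take_drop r s) big_cat /= -[X in X <= _]add0r lerD //.
  rewrite big_seq; apply: sumr_ge0 => x /mem_take xs.
  by rewrite le_min b0 s0.
rewrite !big_seq; apply: ler_sum => x xd.
rewrite le_min lexx /= leNgt -(nth_index 0 xd) nth_drop gt_nth_count ?b0 ?orbT // -leqNgt.
by rewrite (leq_trans cb) // leq_addr.
Qed.

(** Each of the r largest entries contributes at most K to the truncated sum. *)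
Lemma sum_drop_ge s r K : 0 <= K ->
  \sum_(x <- s) Num.min x K - r%:R * K <= \sum_(x <- drop r s) x.
Proof.
move=> K0; rewrite -[in X in X <= _](cat_take_drop r s) big_cat /= addrAC.
rewrite -[X in _ <= X]add0r lerD //.
  rewrite subr_le0 (le_trans (_ : _ <= \sum_(x <- take r s) K)) //.
    by apply: ler_sum => x _; rewrite ge_min lexx orbT.
  rewrite big_const_seq count_predT iter_addr_0 -(mulr_natl K) ler_wpM2r //.
  by rewrite ler_nat size_take_min geq_minl.
by apply: ler_sum => x _; rewrite ge_min lexx.
Qed.

End sorted_lists.

Section risk_paths.
Variables (T : Type) (R : realType) (X : nat -> T -> R) (N : R -> T -> nat).
Implicit Types (m : reinsurance) (r n : nat) (t y b K : R) (w : T).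

Definition exceedances y n w : nat := \sum_(i < n) (y < X i w)%R.

Definition truncated_sum b n w : R := \sum_(i < n) Num.min (X i w) b.

Definition net_amount m r t w : R :=
  aggregate_claims X N t w - reinsured_amount X N m r t w.

(** Multiplicity with which the largest claim that is not fully reinsured enters
    the net amount: ECOMOR hands back [r] copies of it to the insurer. *)
Definition net_factor m r : R := if m is LCR then 1 else r.+1%:R.

Lemma net_factor_ge1 m r : 1 <= net_factor m r.
Proof. by case: m => //=; rewrite ler1n. Qed.

Let claims t w := [seq X j w | j <- iota 0 (N t w)].
Let sclaims t w := sort >=%O (claims t w).

Let sclaims_sorted t w : sorted >=%O (sclaims t w).
Proof. by apply: sort_sorted; exact: ge_total. Qed.

Let big_sclaims t w (f : R -> R) :
  \sum_(x <- sclaims t w) f x = \sum_(i < N t w) f (X i w).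
Proof.
rewrite (perm_big (claims t w)) /=; last by rewrite /sclaims perm_sort.
by rewrite big_map -(big_mkord xpredT (fun i => f (X i w))) /index_iota subn0.
Qed.

Let count_sclaims t w y :
  count (fun x => (y < x)%R) (sclaims t w) = exceedances y (N t w) w.
Proof.
rewrite /sclaims count_sort count_map -sum1_count big_mkcond /=.
rewrite /exceedances -(big_mkord xpredT (fun i => (y < X i w)%R : nat)) /index_iota subn0.
by apply: eq_bigr => i _; case: ifP.
Qed.

Lemma order_stat_gt t w y i : (i < N t w)%N || (0 <= y) ->
  (y < order_stat X N t w i) = (i < exceedances y (N t w) w)%N.
Proof.
move=> h; rewrite -count_sclaims -gt_nth_count //.
by rewrite size_sort size_map size_iota.
Qed.

Lemma order_stat_default t w i : (N t w <= i)%N -> order_stat X N t w i = 0.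
Proof. by move=> h; rewrite /order_stat nth_default // size_sort size_map size_iota. Qed.

Let net_amountE m r t w : net_amount m r t w =
  net_factor m r * order_stat X N t w r + \sum_(x <- drop r.+1 (sclaims t w)) x.
Proof.
have e : aggregate_claims X N t w = \sum_(x <- sclaims t w) x.
  by rewrite (big_sclaims t w id).
have e2 : \sum_(x <- sclaims t w) x - \sum_(i < r) order_stat X N t w i =
    order_stat X N t w r + \sum_(x <- drop r.+1 (sclaims t w)) x.
  by rewrite (sum_drop _ r) drop_nthS addrAC subrr add0r.
rewrite /net_amount e; case: m => /=; rewrite ?mul1r //.
by rewrite opprB addrCA e2 -natr1 mulrDl mul1r addrA.
Qed.

(** Of the claims that are not fully reinsured, all but the largest are at most b. *)
Lemma net_amount_le m r t w b : 0 <= b -> (forall i, 0 <= X i w) ->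
  (exceedances b (N t w) w <= r.+1)%N ->
  net_amount m r t w <=
    net_factor m r * order_stat X N t w r + truncated_sum b (N t w) w.
Proof.
move=> b0 X0 hb; rewrite net_amountE lerD2l.
rewrite /truncated_sum -(big_sclaims t w (fun x => Num.min x b)).
apply: sum_drop_le => //; last by rewrite count_sclaims.
by move=> x; rewrite mem_sort => /mapP[i _ ->].
Qed.

Lemma net_amount_ge m r t w K : 0 <= K ->
  net_factor m r * order_stat X N t w r + truncated_sum K (N t w) w - r.+1%:R * K
    <= net_amount m r t w.
Proof.
move=> K0; rewrite net_amountE -addrA lerD2l.
rewrite /truncated_sum -(big_sclaims t w (fun x => Num.min x K)).
exact: sum_drop_ge.
Qed.

Lemma exceedances_mono y n n' w : (n <= n')%N ->
  (exceedances y n w <= exceedances y n' w)%N.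
Proof.
move=> nn'; rewrite /exceedances -!(big_mkord xpredT (fun i => (y < X i w)%R : nat)).
by rewrite (@big_cat_nat _ _ _ n 0 n') //= leq_addr.
Qed.

Lemma exceedances_anti y y' n w : y <= y' ->
  (exceedances y' n w <= exceedances y n w)%N.
Proof.
move=> yy; apply: leq_sum => i _; case: (ltP y' (X i w)) => // h.
by rewrite (le_lt_trans yy h).
Qed.

Lemma truncated_sum_mono b n n' w : 0 <= b -> (forall i, 0 <= X i w) -> (n <= n')%N ->
  truncated_sum b n w <= truncated_sum b n' w.
Proof.
move=> b0 X0 nn'; rewrite /truncated_sum.
rewrite -!(big_mkord xpredT (fun i => Num.min (X i w) b)).
rewrite (@big_cat_nat _ _ _ n 0 n') //= lerDl sumr_ge0 // => i _.
by rewrite le_min X0.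
Qed.

Lemma ruin_eventP m r pD u h w : ruin_event X N m r pD u h w <->
  exists2 t, 0 <= t <= h & u < net_amount m r t w - pD * t.
Proof.
rewrite /ruin_event /=; split.
  move=> /ereal_sup_gt[_ [t /= + <-]]; rewrite in_itv /= lte_fin => th ut.
  by exists t => //; rewrite /net_amount addrAC.
move=> [t th ut]; apply: (lt_le_trans (y := (net_amount m r t w - pD * t)%:E)).
  by rewrite lte_fin.
apply: ereal_sup_ubound; exists t; first by rewrite /= in_itv.
by rewrite /net_amount addrAC.
Qed.

End risk_paths.

Import HBNNSimple.

(** * Integrals against independent variables *)

Section independent_factor.
Context d d' (T : measurableType d) (U : measurableType d') (R : realType).
Variable P : {measure set T -> \bar R}.
Local Open Scope ereal_scope.

(** A weight enters only through the masses that it gives to the events of Z: for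
    simple g this is linearity, and monotone convergence does the rest. *)
Lemma eq_weighted_integral (H1 H2 : T -> R) (Z : T -> U) (g : U -> R) :
  measurable_fun [set: T] H1 -> measurable_fun [set: T] H2 ->
  (forall x, (0 <= H1 x)%R) -> (forall x, (0 <= H2 x)%R) ->
  measurable_fun [set: T] Z ->
  measurable_fun [set: U] g -> (forall x, (0 <= g x)%R) ->
  (forall A, measurable A -> \int[P]_x (H1 x * \1_A (Z x))%:E =
                             \int[P]_x (H2 x * \1_A (Z x))%:E) ->
  \int[P]_x (H1 x * g (Z x))%:E = \int[P]_x (H2 x * g (Z x))%:E.
Proof.
move=> mH1 mH2 H10 H20 mZ mg g0 hA.
have mg' : measurable_fun [set: U] (EFin \o g) by exact/measurable_EFinP.
pose f := nnsfun_approx (@measurableT _ U) mg'.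
have mf n : measurable_fun [set: T] (f n \o Z) by exact: measurableT_comp.
have simple (H : T -> R) n : measurable_fun [set: T] H -> (forall x, (0 <= H x)%R) ->
  \int[P]_x (H x * f n (Z x))%:E =
  \sum_(y \in range (f n)) y%:E * \int[P]_x (H x * \1_(f n @^-1` [set y]) (Z x))%:E.
  move=> mH H0.
  have mi y : measurable_fun [set: T] (fun x => (H x * \1_(f n @^-1` [set y]) (Z x))%R).
    by apply: measurable_funM => //; apply: (measurableT_comp _ mZ).
  transitivity (\int[P]_x \sum_(y \in range (f n))
      (y * (H x * \1_(f n @^-1` [set y]) (Z x)))%:E).
    apply: eq_integral => x _; rewrite fsumEFin // fimfunE mulr_fsumr //.
    by congr (_%:E); apply: eq_fsbigr => y _; rewrite mulrCA.
  have nn y x : (0 <= y * (H x * \1_(f n @^-1` [set y]) (Z x)))%R.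
    rewrite mulrCA mulr_ge0 // indicE.
    case: (boolP (_ \in _)) => [/set_mem /= <-|_]; last by rewrite mulr0.
    by rewrite mulr1.
  rewrite ge0_integral_fsum //; last 2 first.
  - by move=> y; apply/measurable_EFinP; exact: measurable_funM.
  - by move=> y x _; rewrite lee_fin.
  apply: eq_fsbigr => y /set_mem[u _ <-].
  under eq_integral do rewrite EFinM.
  rewrite ge0_integralZl //.
  - exact/measurable_EFinP.
  - by move=> x _; rewrite lee_fin mulr_ge0.
  - by rewrite lee_fin.
have mc (H : T -> R) : measurable_fun [set: T] H -> (forall x, (0 <= H x)%R) ->
  \int[P]_x (H x * f n (Z x))%:E @[n --> \oo] --> \int[P]_x (H x * g (Z x))%:E.
  move=> mH H0.
  rewrite (_ : \int[P]_x (H x * g (Z x))%:E =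
     \int[P]_x limn (fun n => (H x * f n (Z x))%:E)); last first.
    apply: eq_integral => x _; apply/esym/cvg_lim => //.
    under eq_fun do rewrite EFinM.
    rewrite EFinM; apply: cvgeZl => //.
    by apply: (cvg_nnsfun_approx (@measurableT _ U) mg') => // y _; rewrite lee_fin.
  apply: cvg_monotone_convergence => //.
  - by move=> n; apply/measurable_EFinP; apply: measurable_funM => //; exact: mf.
  - by move=> n x _; rewrite lee_fin mulr_ge0.
  - move=> x _ n m nm; rewrite lee_fin ler_wpM2l //.
    exact/lefP/nd_nnsfun_approx.
have c1 := mc _ mH1 H10; have c2 := mc _ mH2 H20.
apply: (cvg_unique _ c1) => //.
apply: cvg_trans c2; apply: near_eq_cvg; apply: nearW => n.
rewrite !simple //; apply: eq_fsbigr => y _; rewrite hA //.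
Qed.

End independent_factor.

Section laws.
Context d (T : measurableType d) (R : realType) (P : probability T R).

(** Half-lines form a pi-system that generates the Borel sets. *)
Lemma cdf_inj_law (X Y : {RV P >-> R}) : (forall x, cdf X x = cdf Y x) ->
  forall A, measurable A -> P (X @^-1` A) = P (Y @^-1` A).
Proof.
move=> h A mA.
have {}mA : (@RGenOInfty.G R).-sigma.-measurable A by rewrite -RGenOInfty.measurableE.
have hG : @RGenOInfty.G R `<=` @measurable _ (measurableTypeR R).
  by move=> _ [x ->]; exact: measurable_itv.
have Gn (n : nat) : @RGenOInfty.G R `]- n%:R, +oo[%classic by exists (- n%:R).
have GT : \bigcup_n `]- n%:R, +oo[%classic = [set: R].
  apply/seteqP; split => // x _; exists (Num.truncn `|x|).+1 => //=.
  rewrite in_itv /= andbT ltrNl (le_lt_trans (ler_norm _)) // normrN.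
  exact: truncnS_gt.
have GI : setI_closed (@RGenOInfty.G R).
  move=> _ _ [x ->] [y ->]; exists (Num.max x y).
  apply/seteqP; split=> z /=; rewrite !in_itv /= !andbT gt_max.
    by move=> [-> ->].
  by move=> /andP[-> ->].
have GE B : @RGenOInfty.G R B -> distribution P X B = distribution P Y B.
  move=> [x ->].
  have e (V : {RV P >-> R}) : distribution P V `]x, +oo[%classic = (1 - cdf V x)%E.
    rewrite /cdf -probability_setC; last exact: measurable_itv.
    by congr (distribution P V _); rewrite setCitvl.
  by rewrite !e h.
have Gf (n : nat) : (distribution P X (`]- n%:R, +oo[%classic)%R < +oo)%E.
  by rewrite (le_lt_trans (probability_le1 _ _)) ?ltry //; exact: measurable_itv.
exact: (@g_sigma_algebra_measure_unique _ _ _ _ hG _ Gn GT _ _ GI GE Gf A mA).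
Qed.

End laws.

(** * Claims counted by the Poisson process *)

Section poisson_sums.
Variable R : realType.
Implicit Types (mu p q : R).

Lemma nneseries_EFin (a : nat -> R) (s : R) : series a @ \oo --> s ->
  (\sum_(0 <= m <oo) (a m)%:E = s%:E)%E.
Proof.
move=> h; rewrite (_ : (fun n => (\sum_(0 <= i < n) (a i)%:E)%E) = EFin \o series a).
  by apply/cvg_lim => //; apply: cvg_EFin; [exact: nearW|exact: h].
by apply/funext => n /=; rewrite sumEFin.
Qed.

(** Thinning: among a Poisson number of points, k carry the weight p and the others
    the weight q. The k marked points factor out and the rest is an exponential
    series. *)
Lemma cvg_poisson_binomial mu p q k : 0 < mu ->
  series (fun m => poisson_pmf mu m * ('C(m, k)%:R * p ^+ k * q ^+ (m - k))) @ \oo -->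
  (mu * p) ^+ k / k`!%:R * expR (mu * (q - 1)).
Proof.
move=> mu0; rewrite -(cvg_shiftn k).
pose a m := poisson_pmf mu m * ('C(m, k)%:R * p ^+ k * q ^+ (m - k)).
change (series a (n + k)%N @[n --> \oo] --> (mu * p) ^+ k / k`!%:R * expR (mu * (q - 1))).
have -> : (fun n => series a (n + k)%N) =
   (fun n => (mu * p) ^+ k / k`!%:R * expR (- mu) * series (exp_coeff (mu * q)) n).
  apply/funext => n; rewrite /series /=.
  rewrite (@big_cat_nat _ _ _ k) ?leq_addl //= big_nat_cond big1 ?add0r; last first.
    by move=> m /andP[/andP[_ mk] _]; rewrite /a bin_small // !mul0r mulr0.
  rewrite -{1}[k]add0n big_addn addnK big_distrr /=; apply: eq_big_nat => l _.
  rewrite /a /poisson_pmf mu0 addnK /exp_coeff /=.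
  have -> : 'C(l + k, k)%:R = (l + k)`!%:R / (l`!%:R * k`!%:R) :> R.
    have := bin_fact (leq_addl l k); rewrite addnK => <-.
    by rewrite [(k`! * _)%N]mulnC !natrM mulfK // mulf_neq0 // pnatr_eq0 -lt0n fact_gt0.
  have f0 n' : n'`!%:R != 0 :> R by rewrite pnatr_eq0 -lt0n fact_gt0.
  rewrite !exprMn exprD invfM.
  transitivity ((l + k)`!%:R^-1 * (l + k)`!%:R * (mu ^+ l * mu ^+ k * expR (- mu) *
     (l`!%:R^-1 * k`!%:R^-1) * p ^+ k * q ^+ l)); first by ring.
  by rewrite mulVf // mul1r; ring.
have -> : (mu * p) ^+ k / k`!%:R * expR (mu * (q - 1)) =
   (mu * p) ^+ k / k`!%:R * expR (- mu) * expR (mu * q).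
  by rewrite -[RHS]mulrA -expRD; congr (_ * expR _); ring.
by apply: cvgMr; exact: is_cvg_series_exp_coeff.
Qed.

End poisson_sums.

Section claims_model.
Context (d : measure_display) (T : measurableType d) (R : realType)
  (P : probability T R) (X : nat -> {RV P >-> R})
  (N : R -> {RV P >-> nat}).
Hypothesis X_indep : independent_RVs P (fun i w => X i w).
Hypothesis XN_indep : independent_sigma P
  (sigma_family setT (fun i w => X i w))
  (sigma_family [set t : R | 0 <= t] (fun t w => N t w)).
Implicit Types (t y x : R) (m n k : nat) (w : T).

Definition number_is t m : set T := [set w | N t w = m].

Lemma measurable_number_is t m : measurable (number_is t m).
Proof.
by rewrite -[number_is t m]setTI; exact: (measurable_funP (N t) measurableT [set m]).
Qed.

Lemma measurable_claim i (A : set R) : measurable A -> measurable (X i @^-1` A).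
Proof.
by move=> mA; rewrite -[_ @^-1` _]setTI; exact: (measurable_funP (X i) measurableT).
Qed.

Definition claims_event m (A : nat -> set R) : set T :=
  \bigcap_(i in `I_m) (X i @^-1` A i).

Lemma measurable_claims_event m A : (forall i, measurable (A i)) ->
  measurable (claims_event m A).
Proof.
by move=> mA; apply: fin_bigcap_measurable => // i _; exact: measurable_claim.
Qed.

Lemma indic_claims_event m A w :
  \1_(claims_event m A) w = \prod_(i < m) \1_(A i) (X i w) :> R.
Proof.
rewrite indicE; case: (boolP (w \in _)) => [/set_mem h|].
  by rewrite big1 // => i _; rewrite indicE mem_set //; exact: (h _ (ltn_ord i)).
move=> /negP h; have [i iA] : exists i : 'I_m, X i w \notin A i.
  apply: contrapT => /forallNP h'; apply: h; apply/mem_set => i im.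
  by have /negP/negPn/set_mem := h' (Ordinal im).
by rewrite (bigD1 i) //= indicE (negbTE iA) mul0r.
Qed.

Lemma joint_law t m (A : nat -> set R) : 0 <= t -> (forall i, measurable (A i)) ->
  P (number_is t m `&` claims_event m A) =
  (P (number_is t m) * \prod_(i < m) P (X i @^-1` A i))%E.
Proof.
move=> t0 mA; pose J : {fset nat} := [fset i in iota 0 m]%fset.
have JE i : (i \in J) = (i < m)%N by rewrite !inE /= mem_iota.
have -> : claims_event m A = \bigcap_(i in [set` J]) (X i @^-1` A i).
  apply/seteqP; split => w /= h i; first by rewrite /= JE => /h.
  by have := h i; rewrite /= JE; exact.
rewrite setIC XN_indep.
- rewrite (X_indep (J := J)) // muleC; congr (_ * _)%E.
  rewrite -(big_mkord xpredT (fun i => P (X i @^-1` A i))) /=.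
  apply: perm_big; apply: uniq_perm; rewrite ?fset_uniq ?iota_uniq //.
  by move=> i; rewrite JE mem_index_iota.
- apply: (@fin_bigcap_measurable _ (g_sigma_algebraType
    (\bigcup_(i in [set: nat]) g_sigma_algebra_preimage (fun w => X i w)))) => //.
  move=> i _; apply: sub_sigma_algebra; exists i => //=.
  by exists (A i) => //; rewrite setTI.
- apply: sub_sigma_algebra; exists t => //; exists [set m] => //.
  by rewrite setTI.
Qed.

(** Independence is a statement about events, that is about indicators; they are
    replaced by the f i one at a time with [eq_weighted_integral]. *)
Lemma integral_prod_claims t m (f : nat -> R -> R) (e : nat -> R) : 0 <= t ->
  (forall i, measurable_fun [set: R] (f i)) -> (forall i x, 0 <= f i x) ->
  (forall i, (\int[P]_w (f i (X i w))%:E)%E = (e i)%:E) ->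
  (\int[P]_w (\1_(number_is t m) w * \prod_(i < m) f i (X i w))%:E)%E =
  (P (number_is t m) * (\prod_(i < m) e i)%:E)%E.
Proof.
move=> t0.
(* Induction on the number j of factors that are no longer indicators. *)
suff key j : (j <= m)%N -> forall (f : nat -> R -> R) (e : nat -> R),
  (forall i, measurable_fun [set: R] (f i)) -> (forall i x, 0 <= f i x) ->
  (forall i, (\int[P]_w (f i (X i w))%:E)%E = (e i)%:E) ->
  (forall i, (j <= i < m)%N -> exists2 A, measurable A & f i = \1_A) ->
  (\int[P]_w (\1_(number_is t m) w * \prod_(i < m) f i (X i w))%:E)%E =
  (P (number_is t m) * (\prod_(i < m) e i)%:E)%E.
  move=> mf f0 fe; apply: (key m) => // i /andP[mi im].
  by move: (leq_ltn_trans mi im); rewrite ltnn.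
elim: j => [_|j IH jm] {}f {}e mf f0 fe hf.
  have [A hA] : {A : nat -> set R & forall i, measurable (A i) /\
      ((i < m)%N -> f i = \1_(A i))}.
    apply: (@choice _ _ (fun i A => measurable A /\ ((i < m)%N -> f i = \1_A))) => i.
    have [im|im] := ltnP i m; last by exists setT.
    by have [A mA fA] := hf i im; exists A.
  transitivity (P (number_is t m `&` claims_event m A)).
    rewrite -[LHS](eq_integral _ (fun w => (\1_(number_is t m `&` claims_event m A) w)%:E)).
      rewrite integral_indic // ?setIT //; apply: measurableI.
        exact: measurable_number_is.
      by apply: measurable_claims_event => i; have [] := hA i.
    move=> w _; rewrite indicI /= indic_claims_event; congr (_ * _)%:E.
    by apply: eq_bigr => i _; have [_ ->] := hA i.
  rewrite joint_law //; last by move=> i; have [] := hA i.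
  congr (_ * _)%E; rewrite -prodEFin; apply: eq_bigr => i _.
  have [mA fA] := hA i; rewrite -fe fA //.
  rewrite -[RHS](eq_integral _ (fun w => (\1_(X i @^-1` A i) w)%:E)) //.
  by rewrite integral_indic ?setIT //; exact: measurable_claim.
pose G w := \1_(number_is t m) w * \prod_(i < m | i != j :> nat) f i (X i w).
pose c := fine (P (number_is t m)) * \prod_(i < m | i != j :> nat) e i.
have pf w (g : R -> R) : \1_(number_is t m) w *
   \prod_(i < m) (if i == j :> nat then g else f i) (X i w) = G w * g (X j w).
  rewrite /G (bigD1 (Ordinal jm)) //= eqxx mulrCA mulrC; congr (_ * _ * _).
  by apply: eq_bigr => i ij; rewrite ifN.
have pe (a : R) : (P (number_is t m) * (\prod_(i < m) (if i == j :> nat then a else e i))%:E =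
    (c * a)%:E)%E.
  rewrite -[P _]fineK ?fin_num_measure //; last exact: measurable_number_is.
  rewrite -EFinM; congr (_%:E); rewrite /c (bigD1 (Ordinal jm)) //= eqxx.
  rewrite mulrCA mulrC; congr (_ * _ * _).
  by apply: eq_bigr => i ij; rewrite ifN.
have e0 i : 0 <= e i.
  by rewrite -lee_fin -fe; apply: integral_ge0 => w _; rewrite lee_fin.
have c0 : 0 <= c.
  by rewrite mulr_ge0 ?fine_ge0 // prodr_ge0.
transitivity (\int[P]_w (G w * f j (X j w))%:E)%E.
  apply: eq_integral => w _; rewrite -pf; congr (_ * _)%:E.
  by apply: eq_bigr => i _; case: eqP => // ->.
have -> : (P (number_is t m) * (\prod_(i < m) e i)%:E = (c * e j)%:E)%E.
  by rewrite -pe; congr (_ * _%:E)%E; apply: eq_bigr => i _; case: eqP => // ->.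
have mX i : measurable_fun [set: T] (X i) by exact: measurable_funP.
rewrite (@eq_weighted_integral _ _ _ _ R P G (fun=> c) (X j) (f j)) //.
- under eq_integral do rewrite EFinM.
  rewrite ge0_integralZl_EFin // ?fe //.
  + by move=> w _; rewrite lee_fin.
  + by apply/measurable_EFinP; apply: measurableT_comp.
- apply: measurable_funM; first by apply: measurable_indic; exact: measurable_number_is.
  under eq_fun do rewrite big_mkcond /=.
  apply: (@measurable_prod _ _ _ _ _ _ (fun (i : 'I_m) w => if i != j :> nat then f i (X i w) else 1)) => i _.
  by case: (i != j :> nat); [exact: measurableT_comp|exact: measurable_cst].
- by move=> w; rewrite mulr_ge0 // prodr_ge0.
move=> A mA.
transitivity ((c * fine (P (X j @^-1` A)))%:E)%E.
  rewrite -pe -(IH (ltnW jm) (fun i => if i == j :> nat then \1_A else f i)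
    (fun i => if i == j :> nat then fine (P (X j @^-1` A)) else e i)).
  - by apply: eq_integral => w _; rewrite pf.
  - by move=> i; case: ifP => // _; exact: measurable_indic.
  - by move=> i x; case: ifP.
  - move=> i; case: eqP => [->|_]; last exact: fe.
    rewrite fineK ?fin_num_measure //; last exact: measurable_claim.
    rewrite -[LHS](eq_integral _ (fun w => (\1_(X j @^-1` A) w)%:E)) //.
    by rewrite integral_indic ?setIT //; exact: measurable_claim.
  - move=> i /andP[ji im]; case: eqP => [_|/eqP ij]; first by exists A.
    by apply: hf; rewrite im andbT ltn_neqAle eq_sym ij.
under [RHS]eq_integral do rewrite EFinM.
rewrite ge0_integralZl_EFin //; last first.
  by apply/measurable_EFinP; apply: (measurableT_comp (measurable_indic mA)).
rewrite EFinM fineK ?fin_num_measure //; last exact: measurable_claim.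
congr (_ * _)%E.
rewrite -[RHS](eq_integral _ (fun w => (\1_(X j @^-1` A) w)%:E)) //.
by rewrite integral_indic ?setIT //; exact: measurable_claim.
Qed.

End claims_model.

Section claim_counts.
Context (d : measure_display) (T : measurableType d) (R : realType)
  (P : probability T R) (lambda : R) (X : nat -> {RV P >-> R})
  (N : R -> {RV P >-> nat}) (F : R -> R).
Hypothesis lambda_gt0 : 0 < lambda.
Hypothesis X_indep : independent_RVs P (fun i w => X i w).
Hypothesis X_cdf : forall i x, cdf (X i) x = (F x)%:E.
Hypothesis N_poisson : poisson_process lambda N.
Hypothesis XN_indep : independent_sigma P
  (sigma_family setT (fun i w => X i w))
  (sigma_family [set t : R | 0 <= t] (fun t w => N t w)).
Implicit Types (t y x p q : R) (m n k : nat) (w : T).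

Lemma integral_indicT (A : set T) : measurable A ->
  (\int[P]_w (\1_A w)%:E)%E = P A.
Proof. by move=> mA; rewrite integral_indic // setIT. Qed.

Lemma measurable_random_index t (E : nat -> set T) : (forall m, measurable (E m)) ->
  measurable [set w | E (N t w) w].
Proof.
move=> mE.
have -> : [set w | E (N t w) w] = \bigcup_m (number_is N t m `&` E m).
  by apply/seteqP; split=> [w /= h|w [m _ [/= <-]]//]; exists (N t w).
by apply: bigcupT_measurable => m; apply: measurableI => //; exact: measurable_number_is.
Qed.

Lemma random_index_probability t (E : nat -> set T) : (forall m, measurable (E m)) ->
  (P [set w | E (N t w) w] = \sum_(0 <= m <oo) P (number_is N t m `&` E m))%E.
Proof.
move=> mE.
have -> : [set w | E (N t w) w] = \bigcup_m (number_is N t m `&` E m).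
  by apply/seteqP; split=> [w /= h|w [m _ [/= <-]]//]; exists (N t w).
rewrite measure_bigcup.
- by apply: eq_eseriesl => m; rewrite in_setT.
- by move=> m _; apply: measurableI => //; exact: measurable_number_is.
- by move=> i j _ _ [w [[/= <- _] [/= <- _]]].
Qed.

Lemma number_is_pmf t m : 0 < t ->
  P (number_is N t m) = (poisson_pmf (lambda * t) m)%:E.
Proof.
move=> t0; have [N0 _ _ _ hP] := N_poisson.
have := hP 0 t (lexx _) t0 m; rewrite subr0 => <-; congr (P _).
by apply/seteqP; split => w /=; rewrite N0 subn0.
Qed.

(** The values of N t are summed with [cvg_poisson_binomial]; the cases k = 0 and q
    = 1 give exponential moments and exceedance counts. *)
Lemma random_index_probability_le t (E : nat -> set T) c p q k : 0 < t -> 0 <= c ->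
  (forall m, measurable (E m)) ->
  (forall m, (P (number_is N t m `&` E m) <= P (number_is N t m) *
     (c * ('C(m, k)%:R * p ^+ k * q ^+ (m - k)))%:E)%E) ->
  (P [set w | E (N t w) w] <=
   (c * ((lambda * t * p) ^+ k / k`!%:R * expR (lambda * t * (q - 1))))%:E)%E.
Proof.
move=> t0 c0 mE hE; rewrite random_index_probability //.
have mu0 : 0 < lambda * t by rewrite mulr_gt0.
have s := nneseries_EFin (a := fun m => c * (poisson_pmf (lambda * t) m *
  ('C(m, k)%:R * p ^+ k * q ^+ (m - k)))).
rewrite -[leRHS](s _).
  apply: lee_nneseries => [m _ _|m _]; first exact: measure_ge0.
  rewrite (le_trans (hE m)) // number_is_pmf // -EFinM lee_fin.
  by rewrite mulrCA.
rewrite [X in X @ _ --> _](_ : _ = fun n => c * series (fun m => poisson_pmf (lambda * t) m *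
  ('C(m, k)%:R * p ^+ k * q ^+ (m - k))) n); last first.
  by apply/funext => n; rewrite /series /= big_distrr.
apply: cvgMr; exact: cvg_poisson_binomial.
Qed.

Lemma random_index_probability_ge t (E : nat -> set T) p q k : 0 < t ->
  (forall m, measurable (E m)) ->
  (forall m, (P (number_is N t m) *
     ('C(m, k)%:R * p ^+ k * q ^+ (m - k))%:E <= P (number_is N t m `&` E m))%E) ->
  0 <= p -> 0 <= q ->
  (((lambda * t * p) ^+ k / k`!%:R * expR (lambda * t * (q - 1)))%:E <=
   P [set w | E (N t w) w])%E.
Proof.
move=> t0 mE hE p0 q0; rewrite random_index_probability //.
have mu0 : 0 < lambda * t by rewrite mulr_gt0.
rewrite -(nneseries_EFin (@cvg_poisson_binomial R _ p q k mu0)).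
apply: lee_nneseries => [m _ _|m _].
  by rewrite lee_fin !mulr_ge0 ?exprn_ge0 // poisson_pmf_ge0.
by rewrite (le_trans _ (hE m)) // number_is_pmf // -EFinM.
Qed.

(** Markov's inequality for a product over the claims: the generating function of a
    Poisson number of factors of mean phi is exp (lambda t (phi - 1)). *)
Lemma compound_poisson_bound t (E : nat -> set T) (g : R -> R) c phi : 0 < t -> 0 <= c ->
  (forall m, measurable (E m)) -> measurable_fun [set: R] g -> (forall x, 0 <= g x) ->
  (forall i, (\int[P]_w (g (X i w))%:E)%E = phi%:E) ->
  (forall m w, E m w -> 1 <= c * \prod_(i < m) g (X i w)) ->
  (P [set w | E (N t w) w] <= (c * expR (lambda * t * (phi - 1)))%:E)%E.
Proof.
move=> t0 c0 mE mg g0 gphi hE.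
have := @random_index_probability_le t E c 0 phi 0 t0 c0 mE.
rewrite expr0 fact0 divr1 mul1r; apply => m.
rewrite bin0 !mul1r subn0.
have phi0 : 0 <= phi.
  by rewrite -lee_fin -(gphi 0%N); apply: integral_ge0 => w _; rewrite lee_fin.
have e : (\int[P]_w (c * (\1_(number_is N t m) w * \prod_(i < m) g (X i w)))%:E)%E =
   (P (number_is N t m) * (c * phi ^+ m)%:E)%E.
  under eq_integral do rewrite EFinM.
  rewrite ge0_integralZl_EFin //.
  - rewrite (integral_prod_claims X_indep XN_indep m (ltW t0) (fun=> mg) (fun=> g0) gphi).
    by rewrite prodr_const card_ord EFinM muleCA.
  - by move=> w _; rewrite lee_fin mulr_ge0 // prodr_ge0.
  - apply/measurable_EFinP; apply: measurable_funM.
      by apply: measurable_indic; exact: measurable_number_is.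
    apply: measurable_prod => i _; exact: measurableT_comp.
rewrite -e -[leLHS]integral_indicT; last first.
  by apply: measurableI => //; exact: measurable_number_is.
apply: ge0_le_integral => //.
- apply/measurable_EFinP/measurable_indic; apply: measurableI => //.
  exact: measurable_number_is.
- apply/measurable_EFinP; apply: measurable_funM => //; apply: measurable_funM.
    by apply: measurable_indic; exact: measurable_number_is.
  apply: measurable_prod => i _; exact: measurableT_comp.
move=> w _; rewrite lee_fin indicI /=.
have [Ew|Ew] := pselect (E m w).
  rewrite [\1_(E m) w]indicE mem_set // mulr1 mulrCA ler_peMr //.
  exact: hE.
rewrite [\1_(E m) w]indicE memNset // mulr0 !mulr_ge0 // prodr_ge0 //.
Qed.

Let pick m (I : {set 'I_m}) (i : nat) : bool :=
  if insub i is Some j then j \in I else false.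

Let pickE m (I : {set 'I_m}) (i : 'I_m) : pick I i = (i \in I).
Proof. by rewrite /pick valK. Qed.

Let mixed y (h : R -> R) m (I : {set 'I_m}) i : R -> R :=
  if pick I i then \1_(`]y, +oo[%classic) else h.

Lemma tail_probability i y : P (X i @^-1` `]y, +oo[%classic) = (1 - F y)%:E.
Proof.
have -> : X i @^-1` `]y, +oo[%classic = ~` (X i @^-1` `]-oo, y]%classic).
  by rewrite -setCitvl.
rewrite probability_setC; last exact: measurable_claim.
by rewrite EFinB -(X_cdf i).
Qed.

Lemma tail_ge0 y : 0 <= 1 - F y.
Proof. by rewrite -lee_fin -(tail_probability 0%N). Qed.

Lemma tail_le1 y : 1 - F y <= 1.
Proof. by rewrite -lee_fin -(tail_probability 0%N) probability_le1 //; exact: measurable_claim. Qed.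

(** Used with two choices of h. For the indicator of the half-line up to y the sum
    over I is the indicator of exactly k exceedances; for h = 1 it counts the sets
    of k exceedances, and so dominates the indicator of at least k of them. *)
Let binomial_integral t m k y (h : R -> R) q : 0 <= t ->
  measurable_fun [set: R] h -> (forall x, 0 <= h x) ->
  (forall i, (\int[P]_w (h (X i w))%:E)%E = q%:E) ->
  (\int[P]_w (\1_(number_is N t m) w *
     \sum_(I : {set 'I_m} | #|I| == k) \prod_(i < m) mixed y h I i (X i w))%:E)%E =
  (P (number_is N t m) * ('C(m, k)%:R * (1 - F y) ^+ k * q ^+ (m - k))%:E)%E.
Proof.
move=> t0 mh h0 hq.
have mm I i : measurable_fun [set: R] (mixed y h (m := m) I i).
  by rewrite /mixed; case: ifP => // _; apply: measurable_indic; exact: measurable_itv.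
have m0 (I : {set 'I_m}) i x : 0 <= mixed y h I i x by rewrite /mixed; case: ifP.
transitivity (\sum_(I : {set 'I_m} | #|I| == k) P (number_is N t m) *
   ((1 - F y) ^+ k * q ^+ (m - k))%:E)%E.
  under eq_integral do rewrite mulr_sumr -sumEFin.
  rewrite -big_filter; under eq_integral do rewrite -big_filter.
  rewrite ge0_integral_sum //.
  - rewrite [RHS]big_seq [LHS]big_seq; apply: eq_bigr => I.
    rewrite mem_filter => /andP[/eqP cI _].
    rewrite (integral_prod_claims X_indep XN_indep m t0
      (e := fun i => if pick I i then 1 - F y else q)) //.
    + congr (_ * _%:E)%E; under eq_bigr do rewrite pickE.
      rewrite (bigID (mem I)) /=; congr (_ * _).
        by under eq_bigr => i -> do []; rewrite prodr_const cI.
      under eq_bigr => i /negbTE -> do [].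
      rewrite prodr_const; congr (_ ^+ _).
      have e : (#|I| + #|[predC I]| = m)%N by rewrite cardC card_ord.
      rewrite -cI -[X in (X - _)%N]e addKn; exact: eq_card.
    + move=> i; rewrite /mixed; case: ifP => // _.
      by rewrite -(tail_probability i) -[RHS]integral_indicT //; exact: measurable_claim.
  - move=> I; apply/measurable_EFinP; apply: measurable_funM.
      by apply: measurable_indic; exact: measurable_number_is.
    by apply: measurable_prod => i _; exact: measurableT_comp.
  - by move=> I w _; rewrite lee_fin mulr_ge0 // prodr_ge0.
rewrite -(@fineK _ (P (number_is N t m))) ?fin_num_measure //; last exact: measurable_number_is.
rewrite -EFinM sumEFin -EFinM; congr (_%:E).
have cd : #|[pred I : {set 'I_m} | #|I| == k]| = 'C(m, k).
  by have := card_draws 'I_m k; rewrite card_ord cardsE.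
rewrite sumr_const -[#|_|]/(#|[pred I : {set 'I_m} | #|I| == k]|) cd.
have alg (a b c : R) n : a * (b * c) *+ n = a * (n%:R * b * c).
  by rewrite -[LHS]mulr_natr; ring.
exact: alg.
Qed.

Lemma measurable_exceedances y m (Q : set nat) :
  measurable [set w | Q (exceedances X y m w)].
Proof.
elim: m Q => [|m IH] Q.
  rewrite (_ : [set w | _] = [set w : T | Q 0%N]).
    have [Q0|Q0] := pselect (Q 0%N).
      by rewrite (_ : [set w | _] = setT) //; apply/seteqP; split.
    by rewrite (_ : [set w | _] = set0) //; apply/seteqP; split.
  by apply/seteqP; split => w /=; rewrite /exceedances big_ord0.
have mX : measurable (X m @^-1` `]y, +oo[%classic).
  by apply: measurable_claim; exact: measurable_itv.
rewrite (_ : [set w | _] =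
  (X m @^-1` `]y, +oo[%classic `&` [set w | (fun n => Q (n + 1)%N) (exceedances X y m w)]) `|`
  (~` (X m @^-1` `]y, +oo[%classic) `&` [set w | Q (exceedances X y m w)])).
  apply: measurableU; first exact: (measurableI _ _ mX (IH (fun n => Q (n + 1)%N))).
  exact: (measurableI _ _ (measurableC mX) (IH Q)).
apply/seteqP; split => w; rewrite /exceedances /= big_ord_recr /= in_itv /= andbT.
  by case: (boolP (y < X m w)) => h /=; rewrite ?addn0; [left|right; split => //; exact/negP].
by case: (boolP (y < X m w)) => h /= [] [] //; rewrite addn0.
Qed.

Let exceedances_card y m w : exceedances X y m w = #|finset (fun i : 'I_m => y < X i w)|.
Proof.
rewrite /exceedances -sum1_card [RHS]big_mkcond /=; apply: eq_bigr => i _.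
by rewrite finset.in_set; case: ifP.
Qed.

Lemma exceedances_eq_probability t y k : 0 < t ->
  (((lambda * t * (1 - F y)) ^+ k / k`!%:R * expR (- (lambda * t * (1 - F y))))%:E <=
   P [set w | exceedances X y (N t w) w == k])%E.
Proof.
move=> t0.
have -> : - (lambda * t * (1 - F y)) = lambda * t * (F y - 1) by ring.
apply: (@random_index_probability_ge t (fun m => [set w | exceedances X y m w == k])) => //.
- by move=> m; exact: (measurable_exceedances y m [set n | n == k]).
- move=> m.
  rewrite -(@binomial_integral t m k y (\1_(`]-oo, y]%classic)) (F y) (ltW t0)) //.
  + rewrite -[leRHS]integral_indicT; last first.
      by apply: measurableI; [exact: measurable_number_is|exact: (measurable_exceedances y m [set n | n == k])].
    rewrite (@eq_integral _ _ _ P setT (EFin \o \1_(number_is N t m `&` [set w | exceedances X y m w == k]))) // => w _ /=.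
    rewrite indicI /=; congr (_ * _)%:E.
    pose B : {set 'I_m} := finset (fun i : 'I_m => y < X i w).
    have pB (I : {set 'I_m}) : \prod_(i < m) mixed y (\1_(`]-oo, y]%classic)) I i (X i w) = (I == B)%:R.
      have [->|IB] := eqVneq I B.
        rewrite big1 // => i _; rewrite /mixed pickE finset.in_set; case: ltP => yX.
          by rewrite indicE mem_set //= in_itv /= yX.
        by rewrite indicE mem_set //= in_itv /= yX.
      have [i hi] : exists i, (i \in I) != (i \in B).
        apply: contrapT => /forallNP h; move/eqP: IB; apply; apply/setP => i.
        by apply/eqP; have /negP/negPn := h i.
      rewrite (bigD1 i) //= /mixed pickE; move: hi; rewrite [i \in B]finset.in_set.
      case: (i \in I); case: ltP => //= yX _.
        by rewrite indicE memNset ?mul0r //= in_itv /= andbT => /(le_lt_trans yX); rewrite ltxx.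
      by rewrite indicE memNset ?mul0r //= in_itv /= leNgt yX.
    under eq_bigr do rewrite pB.
    rewrite indicE.
    have [Bk|Bk] := boolP (#|B| == k); last first.
      rewrite memNset /=; last by rewrite exceedances_card; exact/negP.
      by rewrite big1 // => I /eqP Ik; case: eqP => // IB; rewrite -IB Ik eqxx in Bk.
    rewrite mem_set /=; last by rewrite exceedances_card.
    by rewrite (bigD1 B) //= eqxx big1 ?addr0 // => I /andP[_ /negbTE ->].
  + by move=> i; rewrite -(X_cdf i) -[RHS]integral_indicT //; exact: measurable_claim.
- exact: tail_ge0.
- by rewrite -lee_fin -(X_cdf 0%N) cdf_ge0.
Qed.

Lemma exceedances_ge_probability t y k : 0 < t ->
  (P [set w | (k <= exceedances X y (N t w) w)%N] <=
   ((lambda * t * (1 - F y)) ^+ k / k`!%:R)%:E)%E.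
Proof.
move=> t0.
have := @random_index_probability_le t (fun m => [set w | (k <= exceedances X y m w)%N])
  1 (1 - F y) 1 k t0 ler01.
rewrite subrr mulr0 expR0 mulr1 mul1r; apply.
  by move=> m; exact: (measurable_exceedances y m [set n | (k <= n)%N]).
move=> m; rewrite mul1r.
have mE : measurable [set w | (k <= exceedances X y m w)%N].
  exact: (measurable_exceedances y m [set n | (k <= n)%N]).
rewrite -(@binomial_integral t m k y (fun=> 1) 1 (ltW t0)) //; last first.
  move=> i; rewrite -[RHS](probability_setT P) -[RHS](integral_indicT measurableT).
  by apply: eq_integral => w _; rewrite indicT.
rewrite -[leLHS]integral_indicT; last first.
  by apply: measurableI; [exact: measurable_number_is|].
have mx (I : {set 'I_m}) i w : 0 <= mixed y (fun=> 1) I i (X i w).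
  by rewrite /mixed; case: ifP.
apply: ge0_le_integral => //.
- by apply/measurable_EFinP/measurable_indic; apply: measurableI => //; exact: measurable_number_is.
- apply/measurable_EFinP; apply: measurable_funM.
    by apply: measurable_indic; exact: measurable_number_is.
  under eq_fun do rewrite -big_filter.
  apply: measurable_sum => I; apply: measurable_prod => i _.
  rewrite /mixed; case: (pick _ _) => //.
  apply: measurableT_comp => //; apply: measurable_indic; exact: measurable_itv.
move=> w _; rewrite lee_fin indicI /=; apply: ler_wpM2l => //.
rewrite indicE; case: (boolP (w \in _)) => [/set_mem /=|_]; last first.
  by rewrite sumr_ge0 // => I _; apply: prodr_ge0.
rewrite exceedances_card => /card_geqP[s [us ss sB]].
pose I : {set 'I_m} := finset (mem s).
have cI : #|I| == k by rewrite cardsE -ss; apply/eqP/card_uniqP.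
rewrite (bigD1 I) //= -[leLHS]addr0 lerD //; last first.
  by rewrite sumr_ge0 // => J _; apply: prodr_ge0.
rewrite big1 // => i _; rewrite /mixed pickE finset.in_set; case: ifP => // /sB; rewrite finset.in_set => yX.
by rewrite indicE mem_set //= in_itv /= yX.
Qed.

End claim_counts.

(** * Measurability of ruin *)

Section ruin_measurability.
Context (d : measure_display) (T : measurableType d) (R : realType)
  (P : probability T R) (lambda : R) (X : nat -> {RV P >-> R})
  (N : R -> {RV P >-> nat}).
Hypothesis N_poisson : poisson_process lambda N.
Implicit Types (t u h pD : R) (m : reinsurance) (r n i : nat) (w : T).

Let XX i w := X i w.
Let NN t w := N t w.

(** The number of claims is frozen at n; the time 0 is a dummy. *)
Let stat n i w := order_stat XX (fun _ _ => n) (0 : R) w i.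

Let measurable_stat n i : measurable_fun [set: T] (stat n i).
Proof.
have [ni|ni] := leqP n i.
  rewrite (_ : stat n i = cst 0) //.
  by apply/funext => w; rewrite /stat order_stat_default.
apply: (measurability _ (RGenOInfty.measurableE R)) => //.
move=> _ [_ [y ->] <-]; rewrite setTI.
rewrite (_ : _ @^-1` _ = [set w | (i < exceedances XX y n w)%N]).
  exact: (measurable_exceedances X y n [set k | (i < k)%N]).
apply/seteqP; split => w /=; rewrite in_itv /= andbT order_stat_gt ?ni //.
Qed.

Let net m r n w := net_amount XX (fun _ _ => n) m r (0 : R) w.

Let measurable_net m r n : measurable_fun [set: T] (net m r n).
Proof.
have ms : measurable_fun [set: T] (fun w => \sum_(i < r) stat n i w).
  by apply: measurable_sum => i; exact: measurable_stat.
apply: measurable_funB; first by apply: measurable_sum => i; exact: measurable_funP.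
case: m => //=.
apply: measurable_funB => //; apply: measurable_funM => //; exact: measurable_stat.
Qed.

Let measurable_above m r pD u t :
  measurable [set w | u < net_amount XX NN m r t w - pD * t].
Proof.
apply: (@measurable_random_index _ _ _ _ N t
  (fun n => [set w | u < net m r n w - pD * t])) => n.
rewrite (_ : [set w | _] = net m r n @^-1` `]u + pD * t, +oo[%classic).
  by rewrite -[X in measurable X]setTI; apply: measurable_net => //; exact: measurable_itv.
by apply/seteqP; split => w /=; rewrite in_itv /= andbT => h; lra.
Qed.

(** The claim number is right continuous and the premium income is continuous, so
    ruin is visible at rational times or at the horizon. *)
Lemma measurable_ruin_event m r pD u h : 0 <= h ->
  measurable (ruin_event XX NN m r pD u h).
Proof.
move=> h0; have [_ _ Nrc _ _] := N_poisson.
pose above t := [set w | u < net_amount XX NN m r t w - pD * t].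
have -> : ruin_event XX NN m r pD u h = above h `|`
    \bigcup_(q : rat) (if 0 <= (ratr q : R) <= h then above (ratr q) else set0).
  apply/seteqP; split => w; last first.
    move=> [hw|[q _]]; first by apply/ruin_eventP; exists h; rewrite ?h0 //=.
    by case: ifP => // qh hw; apply/ruin_eventP; exists (ratr q).
  move=> /ruin_eventP[t /andP[t0 th] ut].
  have [->|tneh] := eqVneq h t; first by left.
  have tlth : t < h by rewrite lt_neqAle eq_sym tneh.
  right.
  pose g := net_amount XX NN m r t w - pD * t - u.
  have g0 : 0 < g by rewrite subr_gt0.
  have := Nrc w t t0; rewrite /at_right near_withinE => /nbhs_ballP[e /= e0 he].
  pose e' := Num.min e (Num.min (h - t) (g / (`|pD| + 1))).
  have pD1 : 0 < `|pD| + 1 by rewrite ltr_pwDr.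
  have e'0 : 0 < e' by rewrite !lt_min e0 subr_gt0 tlth divr_gt0.
  have [q] := rat_in_itvoo (ltr_pwDr e'0 (lexx t)).
  rewrite in_itv /= => /andP[tq qe].
  have /andP[qe1 /andP[qe2 qe3]] : (ratr q - t < e) && ((ratr q - t < h - t) &&
      (ratr q - t < g / (`|pD| + 1))).
    by rewrite -!lt_min ltrBlDl.
  have qh : 0 <= (ratr q : R) <= h.
    rewrite (le_trans t0 (ltW tq)) /= ltW //.
    by move: qe2; rewrite ltrBlDr subrK.
  exists q => //; rewrite qh /above /=.
  have -> : net_amount XX NN m r (ratr q) w = net_amount XX NN m r t w.
    have nE : NN (ratr q) w = NN t w.
      by apply: he => //; rewrite /ball /= ltr0_norm ?subr_lt0 // opprB.
    by rewrite /net_amount /aggregate_claims /reinsured_amount /order_stat nE.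
  have : `|pD| * (ratr q - t) < g.
    move: qe3; rewrite ltr_pdivlMr // => /(le_lt_trans _); apply.
    by rewrite mulrC ler_wpM2l ?subr_ge0 ?(ltW tq) // lerDl.
  have := ler_norm pD; have : 0 < ratr q - t by rewrite subr_gt0.
  rewrite /g; nra.
apply: measurableU; first exact: measurable_above.
apply: bigcupT_measurable_rat => q; case: ifP => // _; exact: measurable_above.
Qed.

End ruin_measurability.

(** * Regularly varying tails and moments *)

Section regularly_varying_tail.
Variables (R : realType) (alpha : R) (G : R -> R).
Hypothesis alpha_gt0 : 0 < alpha.
Hypothesis G_anti : forall x y, x <= y -> G y <= G x.
Hypothesis G_gt0 : forall x, 0 < G x.
Hypothesis G_le1 : forall x, G x <= 1.
Hypothesis G_rv : forall x, 0 < x -> G (x * t) / G t @[t --> +oo] --> x `^ (- alpha).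
Implicit Types (p x t : R).

Lemma ltr_powR2 (x y : R) : x < y -> (2 : R) `^ x < 2 `^ y.
Proof. by move=> xy; rewrite /powR pnatr_eq0 /= ltr_expR ltr_pM2r // ln_gt0 // ltr1n. Qed.

Lemma powR_pow2 (i : nat) (x : R) : (2 ^+ i) `^ x = (2 `^ x) ^+ i :> R.
Proof.
rewrite -powR_mulrn ?ler0n // -powRrM mulrC powRrM powR_mulrn // powR_ge0 //.
Qed.

(** Regular variation enters the moment and tail bounds only through the ratio of
    the tails at 2 t and t. *)
Lemma doubling_le p : p < alpha ->
  exists2 t0, 0 < t0 & forall t, t0 <= t -> G (2 * t) <= 2 `^ (- p) * G t.
Proof.
move=> pa; have h2 : (2 : R) `^ (- alpha) < 2 `^ (- p).
  by apply: ltr_powR2; rewrite ltrN2.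
have [M [_ hM]] := cvgr_lt _ (G_rv (ltr0Sn _ 1)) _ h2.
exists (Num.max 1 (M + 1)); first by rewrite lt_max ltr01.
move=> t; rewrite ge_max => /andP[_ Mt].
have /hM : M < t by rewrite (lt_le_trans _ Mt) // ltrDl.
by rewrite ltr_pdivrMr // => /ltW.
Qed.

Lemma doubling_ge p : alpha < p ->
  exists2 t0, 0 < t0 & forall t, t0 <= t -> 2 `^ (- p) * G t <= G (2 * t).
Proof.
move=> pa; have h2 : (2 : R) `^ (- p) < 2 `^ (- alpha).
  by apply: ltr_powR2; rewrite ltrN2.
have [M [_ hM]] := cvgr_gt _ (G_rv (ltr0Sn _ 1)) _ h2.
exists (Num.max 1 (M + 1)); first by rewrite lt_max ltr01.
move=> t; rewrite ge_max => /andP[_ Mt].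
have /hM : M < t by rewrite (lt_le_trans _ Mt) // ltrDl.
by rewrite ltr_pdivlMr // => /ltW.
Qed.

Lemma dyadic_le p : p < alpha ->
  exists2 t0, 0 < t0 & forall i : nat, G (2 ^+ i * t0) <= (2 `^ (- p)) ^+ i.
Proof.
move=> /doubling_le[t0 t00 h]; exists t0 => //; elim=> [|i IH].
  by rewrite !expr0 mul1r.
rewrite exprS -mulrA (le_trans (h _ _)) //.
  by rewrite ler_peMl ?(ltW t00) // exprn_ege1 // ler1n.
by rewrite exprS ler_wpM2l ?powR_ge0.
Qed.

Lemma dyadic_index (x t0 : R) : 0 < t0 -> t0 < x ->
  exists i : nat, 2 ^+ i * t0 < x <= 2 ^+ i.+1 * t0.
Proof.
move=> t00 tx.
have ex : exists i : nat, x <= 2 ^+ i * t0.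
  exists (Num.truncn (x / t0)).+1; rewrite -ler_pdivrMr //.
  rewrite (le_trans (ltW (truncnS_gt _))) // -natrX ler_nat.
  exact: ltnW (ltn_expl _ _).
case: (ex_minnP ex) => [[|i] hi hmin].
  by move: hi; rewrite expr0 mul1r leNgt tx.
exists i; rewrite hi andbT ltNge; apply/negP => /hmin.
by rewrite ltnn.
Qed.

(** Iterate [doubling_ge] along t0 2 ^ i and interpolate by monotonicity; p > alpha
    absorbs the slowly varying factor. *)
Lemma tail_lower_bound p : alpha < p ->
  exists2 c, 0 < c & forall x, 1 <= x -> c * x `^ (- p) <= G x.
Proof.
move=> /[dup] ap /doubling_ge[t0 t00 h].
have hi i : (2 `^ (- p)) ^+ i * G t0 <= G (2 ^+ i * t0).
  elim: i => [|i IH]; first by rewrite !expr0 !mul1r.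
  rewrite exprS -mulrA [2 ^+ _]exprS -mulrA (le_trans _ (h _ _)) //.
    by rewrite ler_wpM2l ?powR_ge0.
  by rewrite ler_peMl ?(ltW t00) // exprn_ege1 // ler1n.
have p0 : 0 < p by exact: lt_trans alpha_gt0 ap.
pose c1 := 2 `^ (- p) * G t0 * t0 `^ p.
have c10 : 0 < c1 by rewrite !mulr_gt0 ?powR_gt0.
exists (Num.min c1 (G t0)); first by rewrite lt_min c10 G_gt0.
move=> x x1; have x0 := lt_le_trans ltr01 x1.
have [xt|tx] := leP x t0.
  apply: le_trans (G_anti xt); apply: le_trans (_ : G t0 * 1 <= _); last by rewrite mulr1.
  apply: ler_pM; rewrite ?powR_ge0 ?le_min ?(ltW c10) ?(ltW (G_gt0 _)) ?ge_min ?lexx ?orbT //.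
  rewrite powRN invf_le1 ?powR_gt0 //.
  by have := ler_powR x1 (ltW p0); rewrite powRr0.
have [i /andP[xi xi1]] := dyadic_index t00 tx.
apply: le_trans (G_anti xi1); apply: le_trans (hi i.+1).
have h1 : x `^ (- p) <= (2 `^ (- p)) ^+ i * t0 `^ (- p).
  rewrite -powR_pow2 -powRM ?exprn_ge0 ?(ltW t00) // !powRN.
  rewrite lef_pV2 ?posrE ?powR_gt0 ?mulr_gt0 ?exprn_gt0 //.
  by rewrite ge0_ler_powR ?nnegrE ?(ltW p0) ?mulr_ge0 ?exprn_ge0 ?(ltW x0) ?(ltW t00) ?(ltW xi).
have h2 : Num.min c1 (G t0) <= c1 by rewrite ge_min lexx.
apply: le_trans (_ : c1 * ((2 `^ (- p)) ^+ i * t0 `^ (- p)) <= _).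
  by apply: ler_pM; rewrite ?powR_ge0 ?le_min ?(ltW c10) ?(ltW (G_gt0 _)).
rewrite /c1 exprS; have e : t0 `^ p * t0 `^ (- p) = 1.
  by rewrite powRN mulfV // gt_eqF // powR_gt0.
rewrite le_eqVlt; apply/orP; left; apply/eqP.
transitivity (2 `^ (- p) * (2 `^ (- p)) ^+ i * G t0 * (t0 `^ p * t0 `^ (- p))); first by ring.
by rewrite e mulr1.
Qed.

End regularly_varying_tail.

Section moments.
Context (d : measure_display) (T : measurableType d) (R : realType)
  (P : probability T R) (X : nat -> {RV P >-> R}) (F : R -> R) (alpha : R).
Hypothesis X_cdf : forall i x, cdf (X i) x = (F x)%:E.
Let G x := 1 - F x.
Hypothesis G_gt0 : forall x, 0 < G x.
Hypothesis G_rv : forall x, 0 < x -> G (x * t) / G t @[t --> +oo] --> x `^ (- alpha).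
Implicit Types (x y q : R).

Lemma tail_anti x y : x <= y -> G y <= G x.
Proof.
move=> xy; rewrite lerD2l lerN2 -lee_fin -!(X_cdf 0%N).
exact: cdf_nondecreasing.
Qed.

Lemma integral_same_law (g : R -> R) i : measurable_fun [set: R] g -> (forall x, 0 <= g x) ->
  (\int[P]_w (g (X i w))%:E = \int[P]_w (g (X 0%N w))%:E)%E.
Proof.
move=> mg g0; have mg' : measurable_fun [set: R] (EFin \o g) by exact/measurable_EFinP.
have e j : (\int[P]_w (g (X j w))%:E = \int[distribution P (X j)]_x (g x)%:E)%E.
  rewrite /distribution ge0_integral_pushforward //=.
  by move=> x _; rewrite lee_fin.
rewrite !e; apply: eq_measure_integral => A mA _.
have h x : cdf (X i) x = cdf (X 0%N) x by rewrite !X_cdf.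
exact: (cdf_inj_law h mA).
Qed.

(** Claims are positive only almost surely. Their positive parts make sums and
    exponential moments well behaved at every sample point. *)
Definition pos_part x : R := Num.max x 0.

Lemma pos_part_ge0 x : 0 <= pos_part x.
Proof. by rewrite le_max lexx orbT. Qed.

Lemma measurable_pos_part : measurable_fun [set: R] pos_part.
Proof. exact: measurable_maxr. Qed.

(** For p between q and alpha the layer between t0 2 ^ i and t0 2 ^ (i + 1) has
    probability O(2 ^ (- p i)), whereas the q-th power is at most a multiple of 2 ^
    (q i) on it. *)
Lemma moment_finite q : 0 < q < alpha ->
  (\int[P]_w ((pos_part (X 0%N w)) `^ q)%:E < +oo)%E.
Proof.
move=> /andP[q0 qa].
pose p := (q + alpha) / 2.
have [qp pa] : q < p /\ p < alpha by rewrite /p; split; lra.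
have G1 x : G x <= 1 by exact: (tail_le1 X_cdf).
have [t0 t00 hd] := dyadic_le G_gt0 G1 G_rv pa.
have mX : measurable_fun [set: T] (X 0%N) by exact: measurable_funP.
pose f i w : R := (2 ^+ i.+1 * t0) `^ q * \1_(X 0%N @^-1` `]2 ^+ i * t0, +oo[%classic) w.
have f0 i w : 0 <= f i w by rewrite mulr_ge0 ?powR_ge0.
have mset i : measurable (X 0%N @^-1` `]2 ^+ i * t0, +oo[%classic).
  by apply: measurable_claim; exact: measurable_itv.
have mf i : measurable_fun [set: T] (f i).
  by apply: measurable_funM => //; exact: measurable_indic.
have ms : measurable_fun [set: T] (fun w => \sum_(0 <= i <oo) (f i w)%:E)%E.
  apply: ge0_emeasurable_sum => [i w _ _|i _]; first by rewrite lee_fin.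
  exact/measurable_EFinP.
have le_f w : ((pos_part (X 0%N w) `^ q)%:E <= (t0 `^ q)%:E + \sum_(0 <= i <oo) (f i w)%:E)%E.
  have s0 : (0 <= \sum_(0 <= i <oo) (f i w)%:E)%E.
    by apply: nneseries_ge0 => i _ _; rewrite lee_fin.
  have [xt|tx] := leP (X 0%N w) t0.
    rewrite -[leLHS]adde0 leeD // lee_fin ge0_ler_powR ?nnegrE ?(ltW q0) ?pos_part_ge0 ?(ltW t00) //.
    by rewrite ge_max xt ltW.
  have [i /andP[xi xi1]] := dyadic_index t00 tx.
  have x0 : 0 <= X 0%N w by rewrite ltW // (lt_trans t00).
  apply: le_trans (_ : (f i w)%:E <= _)%E.
    rewrite lee_fin /f indicE mem_set ?mulr1; last by rewrite /= in_itv /= xi.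
    by rewrite /pos_part max_l // ge0_ler_powR ?nnegrE ?(ltW q0) // mulr_ge0 ?exprn_ge0 ?ltW.
  rewrite -[leLHS]add0e leeD ?lee_fin ?powR_ge0 //.
  apply: le_trans (nneseries_lim_ge i.+1 _); last by move=> j _ _; rewrite lee_fin.
  rewrite big_nat_recr //= -[leLHS]add0e leeD // sume_ge0 // => j _; by rewrite lee_fin.
apply: le_lt_trans (_ : (t0 `^ q)%:E + \sum_(0 <= i <oo) ((2 ^+ i.+1 * t0) `^ q * G (2 ^+ i * t0))%:E < +oo)%E.
  apply: le_trans (_ : \int[P]_w ((t0 `^ q)%:E + \sum_(0 <= i <oo) (f i w)%:E) <= _)%E.
    apply: ge0_le_integral => //.
    - by move=> w _; rewrite lee_fin powR_ge0.
    - apply/measurable_EFinP; apply: (measurableT_comp (measurable_powR q)).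
      by apply: measurableT_comp => //; exact: measurable_pos_part.
    - by apply: emeasurable_funD.
  rewrite ge0_integralD //; last 2 first.
    by move=> w _; rewrite lee_fin powR_ge0.
    by move=> w _; apply: nneseries_ge0 => i _ _; rewrite lee_fin.
  have -> : (\int[P]_w (t0 `^ q)%:E = (t0 `^ q)%:E)%E.
    by rewrite integral_cst // -[RHS]mule1 -(probability_setT P).
  rewrite leeD2l // integral_nneseries //; last 2 first.
    by move=> i; exact/measurable_EFinP.
    by move=> i w _; rewrite lee_fin.
  apply: lee_nneseries => [i _ _|i _].
    by apply: integral_ge0 => w _; rewrite lee_fin.
  under eq_integral do rewrite EFinM.
  rewrite ge0_integralZl_EFin ?powR_ge0 //; last first.
    by apply/measurable_EFinP; exact: measurable_indic.
  by rewrite integral_indicT // (tail_probability X_cdf) EFinM.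
have z1 : 2 `^ (q - p) < 1 :> R.
  by rewrite -[X in _ < X](powRr0 2); apply: ltr_powR2; rewrite subr_lt0.
have z0 : 0 <= 2 `^ (q - p) :> R by rewrite powR_ge0.
apply: lte_add_pinfty; rewrite ?ltry //.
apply: le_lt_trans (_ : \sum_(0 <= i <oo) ((2 * t0) `^ q * (2 `^ (q - p)) ^+ i)%:E < +oo)%E.
  apply: lee_nneseries => [i _ _|i _].
    by rewrite lee_fin mulr_ge0 ?powR_ge0 // ltW.
  rewrite lee_fin exprSr -mulrA powRM ?exprn_ge0 ?mulr_ge0 ?(ltW t00) // powR_pow2.
  rewrite [X in X * _]mulrC -mulrA ler_wpM2l ?powR_ge0 //.
  rewrite powRD ?pnatr_eq0 ?implybT // exprMn ler_wpM2l ?exprn_ge0 ?powR_ge0 //.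
have zn : `|(2 : R) `^ (q - p)| < 1 by rewrite ger0_norm.
have h := @cvg_geometric_series _ ((2 * t0) `^ q) _ zn.
by rewrite (nneseries_EFin h) ltry.
Qed.

End moments.

(** * Concentration of sums of truncated claims *)

Section elementary_bounds.
Variable R : realType.
Implicit Types (x y q K A eta : R).

(** Second-order remainder of the exponential with the square replaced by a power q,
    since only moments of order less than alpha are available. *)
Lemma expR_le_powR y q : 0 <= y -> 0 <= q <= 2 ->
  expR y <= 1 + y + y `^ q * expR y.
Proof.
move=> y0 /andP[q0 q2]; have [y1|y1] := leP y 1; last first.
  have h : 1 <= y `^ q by have := ler_powR (ltW y1) q0; rewrite powRr0.
  rewrite -[leLHS]add0r lerD ?addr_ge0 //.
  by rewrite -[leLHS]mul1r ler_wpM2r ?expR_ge0.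
have h : y ^+ 2 <= y `^ q.
  have [->|y00] := eqVneq y 0; first by rewrite expr0n powR_ge0.
  by rewrite -powR_mulrn // ger_powR // lt_neqAle eq_sym y00 y0.
have h2 : (1 - y) * expR y <= 1.
  have := expR_ge1Dx (- y); rewrite expRN => h3.
  by rewrite -ler_pdivlMr ?expR_gt0 // div1r.
apply: le_trans (_ : 1 + y + y ^+ 2 * expR y <= _).
  have : (1 + y) * ((1 - y) * expR y) <= (1 + y) * 1.
    by rewrite ler_wpM2l // addr_ge0.
  by move: (expR y) => e; nra.
by rewrite lerD2l ler_wpM2r ?expR_ge0.
Qed.

Lemma expRN_le y : 0 <= y -> expR (- y) <= 1 - y + y ^+ 2.
Proof.
move=> y0; rewrite expRN; have h := expR_ge1Dx y.
have h1 : 0 < 1 + y by rewrite ltr_wpDr.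
apply: le_trans (_ : (1 + y)^-1 <= _).
  by rewrite lef_pV2 ?posrE ?expR_gt0.
rewrite -[leLHS]mul1r ler_pdivrMr //.
have := exprn_ge0 3 y0; by nra.
Qed.

Lemma truncation_error x K q : 0 <= x -> 0 < K -> 1 <= q ->
  x <= Num.min x K + K `^ (1 - q) * x `^ q.
Proof.
move=> x0 K0 q1; have [xK|Kx] := leP x K.
  by rewrite lerDl mulr_ge0 ?powR_ge0.
have xx : 0 < x by exact: lt_trans Kx.
apply: ler_wpDl; first exact: ltW.
have e : x = x `^ (1 - q) * x `^ q.
  by rewrite -powRD ?subrK ?powRr1 ?ltW // (gt_eqF xx) implybT.
rewrite [leLHS]e; apply: ler_wpM2r; first exact: powR_ge0.
rewrite -opprB !powRN lef_pV2 ?posrE ?powR_gt0 //.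
by rewrite ge0_ler_powR ?nnegrE ?subr_ge0 // ltW.
Qed.

Lemma ln_le_powR x kap : 0 < x -> 0 < kap -> ln x <= x `^ kap / kap.
Proof.
move=> x0 k0; rewrite ler_pdivlMr // mulrC -ln_powR.
by rewrite ltW // ln_sublinear // powR_gt0.
Qed.

(** By [ln_le_powR] with kap = (q - 1) / (2 q), after which all powers of x cancel. *)
Lemma log_power_bound x q B : 1 <= x -> 1 < q -> 0 <= B ->
  x * ((B * ln x / x) `^ q * x `^ ((q - 1) / 2)) <= B `^ q * ((q - 1) / (2 * q))^-1 `^ q.
Proof.
move=> x1 q1 B0; have x0 : 0 < x by rewrite (lt_le_trans ltr01).
have q0 : 0 < q by rewrite (lt_trans _ q1).
pose kap := (q - 1) / (2 * q); rewrite -/kap.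
have kap0 : 0 < kap by rewrite divr_gt0 ?subr_gt0 // mulr_gt0.
pose D := (B * ln x / x) `^ q * x `^ ((q - 1) / 2); rewrite -/D.
have l : ln x `^ q <= (x `^ kap / kap) `^ q.
  by rewrite ge0_ler_powR ?nnegrE ?(ltW q0) ?ln_ge0 ?mulr_ge0 ?powR_ge0 ?invr_ge0 ?(ltW kap0) // ln_le_powR.
have e : D = B `^ q * ln x `^ q * (x `^ (- q) * x `^ ((q - 1) / 2)).
  rewrite /D powRM ?mulr_ge0 ?ln_ge0 ?invr_ge0 ?(ltW x0) ?B0 //.
  rewrite powRM ?ln_ge0 ?B0 // mulrA; congr (_ * _ * _).
  by rewrite -powR_inv1 ?(ltW x0) // -powRrM mulN1r.
rewrite powRM ?powR_ge0 ?invr_ge0 ?(ltW kap0) // -powRrM in l.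
rewrite e.
apply: le_trans (_ : x * (B `^ q * (x `^ (kap * q) * kap^-1 `^ q) * (x `^ (- q) * x `^ ((q - 1) / 2))) <= _).
  by rewrite ler_wpM2l ?(ltW x0) // ler_wpM2r ?mulr_ge0 ?powR_ge0 // ler_wpM2l ?powR_ge0.
have -> : kap * q = (q - 1) / 2 by rewrite /kap; field; rewrite gt_eqF.
have hD (u v : R) : x `^ (u + v) = x `^ u * x `^ v by rewrite powRD // (gt_eqF x0) implybT.
have e1 : x * (x `^ ((q - 1) / 2) * x `^ ((q - 1) / 2)) * x `^ (- q) = 1.
  rewrite -hD -{1}(powRr1 (ltW x0)) -!hD (_ : _ - q = 0) ?powRr0 //; by field.
rewrite le_eqVlt; apply/orP; left; apply/eqP.
transitivity (B `^ q * kap^-1 `^ q * (x * (x `^ ((q - 1) / 2) * x `^ ((q - 1) / 2)) * x `^ (- q))).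
  by ring.
by rewrite e1 mulr1.
Qed.

(** The inequality ln y <= y at y = eta x / A. *)
Lemma expRN_le_powR x eta A : 0 < x -> 0 < eta -> 0 < A ->
  expR (- (eta * x)) <= expR (A * ln (A / eta)) * x `^ (- A).
Proof.
move=> x0 e0 A0; rewrite /powR gt_eqF // -expRD ler_expR.
have y0 : 0 < x * (eta / A) by rewrite mulr_gt0 ?divr_gt0.
have := ltW (ln_sublinear y0); rewrite lnM ?posrE ?divr_gt0 // -[eta / A]invf_div lnV ?posrE ?divr_gt0 //.
rewrite -(ler_pM2l A0) => h.
have e : A * (x / (A / eta)) = eta * x by rewrite invf_div; field; rewrite gt_eqF.
by move: h; rewrite e; lra.
Qed.

End elementary_bounds.

Section truncated_claims.
Context (d : measure_display) (T : measurableType d) (R : realType)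
  (P : probability T R) (lambda : R) (X : nat -> {RV P >-> R})
  (N : R -> {RV P >-> nat}) (F : R -> R) (mu Mq q : R).
Hypothesis lambda_gt0 : 0 < lambda.
Hypothesis X_indep : independent_RVs P (fun i w => X i w).
Hypothesis X_cdf : forall i x, cdf (X i) x = (F x)%:E.
Hypothesis N_poisson : poisson_process lambda N.
Hypothesis XN_indep : independent_sigma P
  (sigma_family setT (fun i w => X i w))
  (sigma_family [set t : R | 0 <= t] (fun t w => N t w)).
Hypothesis q_gt1 : 1 < q.
Hypothesis q_le2 : q <= 2.
Hypothesis meanE : (\int[P]_w (pos_part (X 0%N w))%:E)%E = mu%:E.
Hypothesis momentE : (\int[P]_w (pos_part (X 0%N w) `^ q)%:E)%E = Mq%:E.
Implicit Types (s del : R) (n m : nat).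

Let claim i w : R := pos_part (X i w).

Lemma measurable_pos_claim i : measurable_fun [set: T] (claim i).
Proof. by apply: measurableT_comp; [exact: measurable_pos_part|exact: measurable_funP]. Qed.

Lemma measurable_truncated_sum b m : measurable_fun [set: T] (truncated_sum claim b m).
Proof.
apply: measurable_sum => i; apply: measurable_minr => //; exact: measurable_pos_claim.
Qed.

(** The two uses below have either b = 0 or B = 0; keeping the linear term on the
    left allows a negative first-order term in the bound for g. *)
Lemma expectation_le (g : R -> R) (b A B C : R) : measurable_fun [set: R] g ->
  (forall x, 0 <= g x) -> 0 <= b -> 0 <= A -> 0 <= B -> 0 <= C ->
  (forall x, 0 <= x -> g x + b * x <= A + B * x + C * x `^ q) ->
  exists2 phi, (forall i, (\int[P]_w (g (pos_part (X i w)))%:E)%E = phi%:E) &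
    phi + b * mu <= A + B * mu + C * Mq.
Proof.
move=> mg g0 b0 A0 B0 C0 h.
have mgp : measurable_fun [set: R] (fun x => g (pos_part x)).
  by apply: measurableT_comp => //; exact: measurable_pos_part.
have mX := measurable_pos_claim 0%N.
have mXq : measurable_fun [set: T] (fun w => pos_part (X 0%N w) `^ q).
  by apply: (measurableT_comp (measurable_powR q)).
have mgX : measurable_fun [set: T] (fun w => g (pos_part (X 0%N w))).
  by apply: measurableT_comp => //.
have I1 : (\int[P]_w ((g (pos_part (X 0%N w)))%:E + b%:E * (pos_part (X 0%N w))%:E) =
   \int[P]_w (g (pos_part (X 0%N w)))%:E + (b * mu)%:E)%E.
  rewrite ge0_integralD //=.
  - by rewrite ge0_integralZl_EFin //; [rewrite meanE EFinM|
      by move=> w _; rewrite lee_fin pos_part_ge0|exact/measurable_EFinP].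
  - by move=> w _; rewrite lee_fin.
  - exact/measurable_EFinP.
  - by move=> w _; rewrite mule_ge0 ?lee_fin ?pos_part_ge0.
  - by apply: measurable_funeM; exact/measurable_EFinP.
have I2 : (\int[P]_w (A%:E + B%:E * (pos_part (X 0%N w))%:E + C%:E * (pos_part (X 0%N w) `^ q)%:E) =
   (A + B * mu + C * Mq)%:E)%E.
  have h1 w : [set: T] w -> (0 <= A%:E + B%:E * (pos_part (X 0%N w))%:E)%E.
    by move=> _; rewrite -EFinM -EFinD lee_fin addr_ge0 ?mulr_ge0 ?pos_part_ge0.
  rewrite ge0_integralD //=; first rewrite ge0_integralD //=.
  - rewrite !ge0_integralZl_EFin //.
    + by rewrite meanE momentE integral_cst // (_ : (A%:E * P [set: T] = A%:E)%E) //
        -[RHS]mule1 -(probability_setT P).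
    + by move=> w _; rewrite lee_fin powR_ge0.
    + exact/measurable_EFinP.
    + by move=> w _; rewrite lee_fin pos_part_ge0.
    + exact/measurable_EFinP.
  - by move=> w _; rewrite mule_ge0 ?lee_fin ?pos_part_ge0.
  - by apply: measurable_funeM; exact/measurable_EFinP.
  - by apply: emeasurable_funD => //; apply: measurable_funeM; exact/measurable_EFinP.
  - by move=> w _; rewrite mule_ge0 ?lee_fin ?powR_ge0.
  - by apply: measurable_funeM; exact/measurable_EFinP.
have le12 : (\int[P]_w (g (pos_part (X 0%N w)))%:E + (b * mu)%:E <= (A + B * mu + C * Mq)%:E)%E.
  rewrite -I1 -I2; apply: ge0_le_integral => //.
  - by move=> w _; rewrite -EFinM -EFinD lee_fin addr_ge0 ?mulr_ge0 ?pos_part_ge0.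
  - apply: emeasurable_funD; first exact/measurable_EFinP.
    by apply: measurable_funeM; exact/measurable_EFinP.
  - apply: emeasurable_funD; last by apply: measurable_funeM; exact/measurable_EFinP.
    by apply: emeasurable_funD => //; apply: measurable_funeM; exact/measurable_EFinP.
  - by move=> w _; rewrite -!EFinM -!EFinD lee_fin h // pos_part_ge0.
have fin : (\int[P]_w (g (pos_part (X 0%N w)))%:E)%E \is a fin_num.
  have g00 : (0 <= \int[P]_w (g (pos_part (X 0%N w)))%:E)%E.
    by apply: integral_ge0 => w _; rewrite lee_fin.
  move: le12 g00; case: (integral _ _ _) => //=.
exists (fine (\int[P]_w (g (pos_part (X 0%N w)))%:E)%E).
  by move=> i; rewrite fineK // (integral_same_law X_cdf _ mgp).
by rewrite -lee_fin EFinD fineK.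
Qed.

Lemma moment_ge0 : 0 <= Mq.
Proof. by rewrite -lee_fin -momentE; apply: integral_ge0 => w _; rewrite lee_fin powR_ge0. Qed.

(** th is positive for upper and negative for lower deviations. *)
Lemma chernoff t th b K phi : 0 < t ->
  (forall i, (\int[P]_w (expR (th * Num.min (pos_part (X i w)) b))%:E)%E = phi%:E) ->
  (P [set w | (th * K <= th * truncated_sum claim b (N t w) w)%R] <=
   (expR (- (th * K)) * expR (lambda * t * (phi - 1)))%:E)%E.
Proof.
move=> t0 hphi.
apply: (@compound_poisson_bound _ _ _ P lambda X N lambda_gt0 X_indep N_poisson XN_indep t
  (fun m => [set w | (th * K <= th * truncated_sum claim b m w)%R])
  (fun y => expR (th * Num.min (pos_part y) b))) => //.
- by move=> m; rewrite -[X in measurable X]setTI; apply: measurable_fun_le => //;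
    apply: measurable_funM => //; exact: measurable_truncated_sum.
- apply: measurableT_comp => //; apply: measurable_funM => //.
  by apply: measurable_minr => //; exact: measurable_pos_part.
- move=> m w /= h; rewrite -expR_sum -expRD -expR0 ler_expR.
  by rewrite -mulr_sumr addrC subr_ge0.
Qed.

Lemma measurable_truncated_gt t b K (th : R) :
  measurable [set w | (K < th * truncated_sum claim b (N t w) w)%R].
Proof.
apply: (@measurable_random_index _ _ _ _ N t (fun m => [set w | (K < th * truncated_sum claim b m w)%R])).
move=> m; have mf : measurable_fun [set: T] (fun w => th * truncated_sum claim b m w).
  by apply: measurable_funM => //; exact: measurable_truncated_sum.
have := mf measurableT `]K, +oo[%classic (measurable_itv _); rewrite setTI.
by congr measurable; apply/seteqP; split => w /=; rewrite in_itv /= andbT.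
Qed.

(** Chernoff's bound with th of order ln n / n. The deviation contributes n ^ (- A)
    if th del n = A ln n, and a truncation level eps n with small eps keeps exp (th
    eps n) below a small power of n, so that the term with the q-th moment stays
    bounded. Claims below eps n thus produce a deviation of order n only with
    probability O(n ^ (- A)). *)
Lemma truncated_sum_upper del A : 0 < del -> 0 < A ->
  exists2 eps, 0 < eps & exists2 C, 0 < C & forall s n, 0 < s -> s <= 1 -> (0 < n)%N ->
  (P [set w | ((lambda * mu * s + del) * n%:R < truncated_sum claim (eps * n%:R) (N (s * n%:R) w) w)%R]
     <= (C * n%:R `^ (- A))%:E)%E.
Proof.
move=> del0 A0; pose B := A / del; pose kap := (q - 1) / (2 * q).
have B0 : 0 < B by rewrite divr_gt0.
have q0 : 0 < q by rewrite (lt_trans _ q_gt1).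
have q10 : 0 < q - 1 by rewrite subr_gt0.
have kap0 : 0 < kap by rewrite divr_gt0 // mulr_gt0.
exists ((q - 1) / (2 * B)); first by rewrite divr_gt0 // mulr_gt0.
exists (expR (lambda * Mq * (B `^ q * (kap^-1 `^ q)))); first exact: expR_gt0.
move=> s n s0 s1 n0; pose x : R := n%:R.
have x1 : 1 <= x by rewrite ler1n.
have x0 : 0 < x by rewrite (lt_le_trans ltr01).
pose th := B * ln x / x; pose b := (q - 1) / (2 * B) * x.
have th0 : 0 <= th.
  apply: mulr_ge0; last by rewrite invr_ge0 ltW.
  by apply: mulr_ge0; [exact: ltW|exact: ln_ge0].
have b0 : 0 < b by apply: mulr_gt0 => //; rewrite divr_gt0 // mulr_gt0.
have ethb : expR (th * b) = x `^ ((q - 1) / 2).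
  rewrite /powR gt_eqF //; congr expR; rewrite /th /b.
  by field; rewrite !gt_eqF.
pose D := th `^ q * expR (th * b).
pose g y := expR (th * Num.min (pos_part y) b).
have D0 : 0 <= D by rewrite mulr_ge0 ?powR_ge0 ?expR_ge0.
have mg : measurable_fun [set: R] (fun y => expR (th * Num.min y b)).
  apply: measurableT_comp => //; apply: measurable_funM => //.
  by apply: measurable_minr.
have hg y : 0 <= y -> expR (th * Num.min y b) + 0 * y <= 1 + th * y + D * y `^ q.
  move=> y0; rewrite mul0r addr0.
  have m0 : 0 <= Num.min y b by rewrite le_min y0 ltW.
  have q02 : 0 <= q <= 2 by rewrite ltW.
  apply: le_trans (expR_le_powR (mulr_ge0 th0 m0) q02) _.
  have my : Num.min y b <= y by rewrite ge_min lexx.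
  apply: lerD; first by rewrite lerD2l ler_wpM2l.
  rewrite /D [leRHS]mulrAC -powRM //.
  apply: ler_pM; rewrite ?powR_ge0 ?expR_ge0 //.
    apply: ge0_ler_powR; rewrite ?nnegrE ?(ltW q0) //; last exact: ler_wpM2l.
      exact: mulr_ge0.
    exact: mulr_ge0.
  by rewrite ler_expR ler_wpM2l // ge_min lexx orbT.
have [phi phiE] := expectation_le mg (fun=> expR_ge0 _) (lexx 0) ler01 th0 D0 hg.
rewrite mul0r addr0 => hphi.
have t0 : 0 < s * x by rewrite mulr_gt0.
have hx : x * D <= B `^ q * kap^-1 `^ q.
  by rewrite /D ethb; apply: log_power_bound => //; exact: ltW.
pose K := (lambda * mu * s + del) * x.
apply: le_trans (_ : P [set w | (th * K <= th * truncated_sum claim b (N (s * x) w) w)%R] <= _)%E.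
  apply: le_measure; rewrite ?inE.
  - have := measurable_truncated_gt (s * x) b K 1.
    by congr measurable; apply/seteqP; split=> w /=; rewrite mul1r.
  - apply: (@measurable_random_index _ _ _ _ N (s * x)
      (fun m => [set w | (th * K <= th * truncated_sum claim b m w)%R])).
    by move=> m; rewrite -[X in measurable X]setTI; apply: measurable_fun_le => //;
      apply: measurable_funM => //; exact: measurable_truncated_sum.
  - by move=> w /= /ltW h; rewrite ler_wpM2l.
apply: le_trans (chernoff K t0 phiE) _; rewrite lee_fin -/x.
have -> : x `^ (- A) = expR (- A * ln x) by rewrite /powR gt_eqF.
rewrite -!expRD ler_expR.
have e1 : th * x = B * ln x by rewrite /th divfK // gt_eqF.
have e2 : B * del = A by rewrite /B divfK // gt_eqF.
have h1 : lambda * s * x * (phi - 1) <= lambda * s * x * (th * mu + D * Mq).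
  by apply: ler_wpM2l; [rewrite !mulr_ge0 // ltW|move: hphi; lra].
have h2 : lambda * s * Mq * (x * D) <= lambda * Mq * (B `^ q * kap^-1 `^ q).
  apply: ler_pM => //; first by rewrite !mulr_ge0 ?moment_ge0 // ltW.
    by apply: mulr_ge0 => //; exact: ltW.
  by rewrite ler_wpM2r ?moment_ge0 // ler_piMr // ltW.
have e3 : th * K = lambda * mu * s * (th * x) + (B * del) * ln x.
  by rewrite /K mulrDl mulrDr mulrCA [th * (del * x)]mulrCA e1; ring.
rewrite e3 e2 e1 mulrA; move: h1 h2.
have -> : lambda * s * x * (th * mu + D * Mq) = lambda * mu * s * (th * x) + lambda * s * Mq * (x * D) by ring.
rewrite e1; lra.
Qed.

(** Chernoff's bound for bounded claims with a fixed parameter is exponentially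
    small. K is so large that the mean loses little by truncation at K. *)
Lemma truncated_sum_lower del A : 0 < del -> 0 < A ->
  exists2 K, 0 < K & exists2 C, 0 < C & forall s n, 0 < s -> s <= 1 -> (0 < n)%N ->
  (P [set w | (truncated_sum claim K (N (s * n%:R) w) w < (lambda * mu * s - del) * n%:R)%R]
     <= (C * n%:R `^ (- A))%:E)%E.
Proof.
move=> del0 A0.
have q10 : 0 < q - 1 by rewrite subr_gt0.
have M1 : 0 < Mq + 1 by rewrite ltr_wpDl ?moment_ge0.
pose v := del / (2 * lambda * (Mq + 1)).
have v0 : 0 < v by rewrite divr_gt0 // !mulr_gt0.
pose K := v `^ (- (q - 1)^-1).
have K0 : 0 < K by rewrite powR_gt0.
(* [truncation_error] loses K ^ (1 - q) times the q-th moment, that is v Mq, of the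
   mean; v is chosen to keep this below del / 2. *)
have eK : K `^ (1 - q) = v.
  rewrite /K -powRrM (_ : - (q - 1)^-1 * (1 - q) = 1) ?powRr1 ?(ltW v0) //.
  by rewrite -[1 - q]opprB mulrNN mulVf // gt_eqF.
pose th := del / (4 * lambda * K ^+ 2).
have th0 : 0 < th by rewrite divr_gt0 // !mulr_gt0 // exprn_gt0.
exists K => //.
have mg : measurable_fun [set: R] (fun y => expR (- th * Num.min y K)).
  apply: measurableT_comp => //; apply: measurable_funM => //.
  by apply: measurable_minr.
have A'0 : 0 <= 1 + (th * K) ^+ 2 by rewrite addr_ge0 // sqr_ge0.
have C'0 : 0 <= th * v by rewrite mulr_ge0 ?ltW.
have hg y : 0 <= y -> expR (- th * Num.min y K) + th * y <= 1 + (th * K) ^+ 2 + 0 * y + (th * v) * y `^ q.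
  move=> y0; rewrite mul0r addr0.
  have m0 : 0 <= Num.min y K by rewrite le_min y0 ltW.
  have h1 := expRN_le (mulr_ge0 (ltW th0) m0).
  have h2 : th * y <= th * (Num.min y K + v * y `^ q).
    by rewrite ler_wpM2l ?(ltW th0) // -eK truncation_error // ltW.
  have h3 : (th * Num.min y K) ^+ 2 <= (th * K) ^+ 2.
    have mK : Num.min y K <= K by rewrite ge_min lexx orbT.
    have h3 : th * Num.min y K <= th * K by rewrite ler_wpM2l ?(ltW th0).
    by rewrite !expr2 ler_pM // mulr_ge0 // ltW.
  rewrite mulNr; move: h1 h2 h3; rewrite mulrDr mulrA; lra.
have [phi phiE] := expectation_le mg (fun=> expR_ge0 _) (ltW th0) A'0 (lexx 0) C'0 hg.
rewrite mul0r addr0 => hphi.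
pose eta := th * del / 4.
have eta0 : 0 < eta by rewrite divr_gt0 // mulr_gt0.
exists (expR (A * ln (A / eta))); first exact: expR_gt0.
move=> s n s0 s1 n0; pose x : R := n%:R.
have ls0 : 0 < lambda * s by rewrite mulr_gt0.
have ls : lambda * s <= lambda by rewrite ler_piMr // ltW.
have x0 : 0 < x by rewrite ltr0n.
have t0 : 0 < s * x by rewrite mulr_gt0.
pose K1 := (lambda * mu * s - del) * x.
apply: le_trans (_ : P [set w | (- th * K1 <= - th * truncated_sum claim K (N (s * x) w) w)%R] <= _)%E.
  apply: le_measure; rewrite ?inE.
  - have := measurable_truncated_gt (s * x) K (- K1) (- 1).
    by congr measurable; apply/seteqP; split=> w /=; rewrite mulN1r ltrN2.
  - apply: (@measurable_random_index _ _ _ _ N (s * x)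
      (fun m => [set w | (- th * K1 <= - th * truncated_sum claim K m w)%R])).
    by move=> m; rewrite -[X in measurable X]setTI; apply: measurable_fun_le => //;
      apply: measurable_funM => //; exact: measurable_truncated_sum.
  - by move=> w /= /ltW h; rewrite !mulNr lerN2 ler_wpM2l // ltW.
apply: le_trans (chernoff K1 t0 phiE) _.
rewrite lee_fin (le_trans _ (expRN_le_powR x0 eta0 A0)) // -expRD ler_expR.
have h1 : lambda * s * (phi - 1) <= lambda * s * ((th * K) ^+ 2 + th * v * Mq - th * mu).
  by rewrite ler_wpM2l ?(ltW ls0) //; move: hphi; lra.
have h2 : lambda * s * (th * v * Mq) <= th * del / 2.
  rewrite (_ : th * del / 2 = lambda * (th * v * (Mq + 1))); last first.
    by rewrite /v; field; rewrite !gt_eqF.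
  have thv0 := mulr_ge0 (ltW th0) (ltW v0).
  apply: ler_pM => //; first exact: ltW.
    by apply: mulr_ge0 => //; exact: moment_ge0.
  by apply: ler_wpM2l => //; rewrite lerDl.
have h3 : lambda * s * (th * K) ^+ 2 <= th * del / 4.
  apply: le_trans (_ : lambda * (th * K) ^+ 2 <= _); first by rewrite ler_wpM2r ?sqr_ge0.
  rewrite le_eqVlt; apply/orP; left; apply/eqP.
  by rewrite exprMn [th ^+ 2]expr2 {1}/th; field; rewrite !gt_eqF.
rewrite mulrA mulrAC.
have h4 : lambda * s * (phi - 1) <= - eta - th * (lambda * mu * s - del).
  by apply: le_trans h1 _; rewrite /eta mulrBr mulrDr; move: h2 h3; lra.
move: (ler_wpM2r (ltW x0) h4); rewrite /K1; lra.
Qed.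


End truncated_claims.

(** * Asymptotics of exceedance probabilities *)

Section real_probability.
Context (d : measure_display) (T : measurableType d) (R : realType)
  (P : probability T R).
Implicit Types (A B : set T) (C : nat -> set T) (M : nat).

Definition prob A : R := fine (P A).

Lemma probE A : measurable A -> (prob A)%:E = P A.
Proof. by move=> mA; rewrite /prob fineK // fin_num_measure. Qed.

Lemma prob_le A B : measurable A -> measurable B -> A `<=` B -> prob A <= prob B.
Proof. by move=> mA mB AB; rewrite -lee_fin !probE // le_measure ?inE. Qed.

Lemma prob0 : prob set0 = 0.
Proof. by rewrite /prob measure0. Qed.

Lemma probU_le A B : measurable A -> measurable B -> prob (A `|` B) <= prob A + prob B.
Proof.
move=> mA mB; have mU : measurable (A `|` B) by exact: measurableU.
by rewrite -lee_fin EFinD !probE // measureU2.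
Qed.

Lemma probU A B : measurable A -> measurable B -> A `&` B = set0 ->
  prob (A `|` B) = prob A + prob B.
Proof.
move=> mA mB AB; have mU : measurable (A `|` B) by exact: measurableU.
by apply/EFin_inj; rewrite EFinD !probE // measureU.
Qed.

Lemma probD_ge A B : measurable A -> measurable B -> prob A - prob B <= prob (A `\` B).
Proof.
move=> mA mB; rewrite lerBlDr.
apply: le_trans (probU_le _ _) => //; last exact: measurableD.
apply: prob_le => //; first by apply: measurableU => //; exact: measurableD.
by move=> w Aw; have [Bw|Bw] := pselect (B w); [right|left].
Qed.

Lemma probD A B : measurable A -> measurable B -> B `<=` A ->
  prob (A `\` B) = prob A - prob B.
Proof.
move=> mA mB BA; apply/eqP; rewrite eq_sym subr_eq; apply/eqP.
rewrite -probU //; last 2 first.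
- exact: measurableD.
- by apply/seteqP; split=> // w [[]].
congr prob; apply/seteqP; split=> w; last by case=> [[]|/BA].
by move=> Aw; have [Bw|Bw] := pselect (B w); [right|left].
Qed.

Lemma big_unionP M C w : (\big[setU/set0]_(j < M) C j) w <-> exists2 j, (j < M)%N & C j w.
Proof. by rewrite -bigcup_mkord; split=> -[j jM Cj]; exists j. Qed.

Lemma measurable_big_union M C : (forall j, (j < M)%N -> measurable (C j)) ->
  measurable (\big[setU/set0]_(j < M) C j).
Proof. by move=> mC; apply: bigsetU_measurable => j _; exact: mC. Qed.

Lemma prob_union_le M C A : measurable A -> (forall j, (j < M)%N -> measurable (C j)) ->
  (forall w, A w -> exists2 j, (j < M)%N & C j w) -> prob A <= \sum_(j < M) prob (C j).
Proof.
move=> mA mC AC; apply: le_trans (_ : prob (\big[setU/set0]_(j < M) C j) <= _).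
  apply: prob_le => //; first exact: measurable_big_union.
  by move=> w /AC /big_unionP.
elim: M mC {AC} => [|M IH] mC; first by rewrite !big_ord0 prob0.
rewrite !big_ord_recr /=; apply: le_trans (probU_le _ _) _.
- by apply: measurable_big_union => j jM; apply: mC; exact: ltnW.
- exact: mC.
- by rewrite lerD2r IH // => j jM; apply: mC; exact: ltnW.
Qed.

Lemma prob_big_union_le M C (v : R) : (forall j, (j < M)%N -> measurable (C j)) ->
  (forall j, (j < M)%N -> prob (C j) <= v) -> prob (\big[setU/set0]_(j < M) C j) <= M%:R * v.
Proof.
move=> mC hC; apply: le_trans (_ : \sum_(j < M) prob (C j) <= _).
  by apply: prob_union_le => // [|w /big_unionP]; first exact: measurable_big_union.
apply: le_trans (_ : \sum_(j < M) v <= _); first by apply: ler_sum => j _; exact: hC.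
by rewrite big_const_ord iter_addr_0 [leRHS]mulr_natl.
Qed.

Lemma prob_disjoint_union_ge M C A : measurable A ->
  (forall j, (j < M)%N -> measurable (C j)) ->
  (forall j, (j < M)%N -> C j `<=` A) ->
  (forall i j w, (i < j < M)%N -> C i w -> ~ C j w) ->
  \sum_(j < M) prob (C j) <= prob A.
Proof.
move=> mA mC CA dC; apply: le_trans (_ : prob (\big[setU/set0]_(j < M) C j) <= _); last first.
  apply: prob_le => //; first exact: measurable_big_union.
  by move=> w /big_unionP[j jM Cj]; exact: (CA j jM).
elim: M mC dC {CA} => [|M IH] mC dC; first by rewrite !big_ord0 prob0.
rewrite !big_ord_recr /= probU //.
- rewrite lerD2r IH // => [j jM|i j w /andP[ij jM]]; first by apply: mC; exact: ltnW.
  by apply: dC; rewrite ij ltnW.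
- by apply: measurable_big_union => j jM; apply: mC; exact: ltnW.
- exact: mC.
- apply/seteqP; split=> // w [/big_unionP[j jM Cj]].
  by apply: dC Cj; rewrite jM /=.
Qed.

End real_probability.

Section tail_asymptotics.
Context (d : measure_display) (T : measurableType d) (R : realType)
  (P : probability T R) (alpha lambda : R) (X : nat -> {RV P >-> R})
  (N : R -> {RV P >-> nat}) (F : R -> R).
Hypothesis lambda_gt0 : 0 < lambda.
Hypothesis alpha_gt1 : 1 < alpha.
Hypothesis X_indep : independent_RVs P (fun i w => X i w).
Hypothesis X_cdf : forall i x, cdf (X i) x = (F x)%:E.
Hypothesis N_poisson : poisson_process lambda N.
Hypothesis XN_indep : independent_sigma P
  (sigma_family setT (fun i w => X i w))
  (sigma_family [set t : R | 0 <= t] (fun t w => N t w)).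
Let G x := 1 - F x.
Hypothesis G_gt0 : forall x, 0 < G x.
Hypothesis G_rv : forall x, 0 < x -> G (x * t) / G t @[t --> +oo] --> x `^ (- alpha).
Implicit Types (s y q : R) (n k : nat).

Lemma cvg_powRN_pinfty q : 0 < q -> (n%:R : R) `^ (- q) @[n --> \oo] --> 0.
Proof.
move=> q0; apply/cvgrPdist_le => e e0.
near=> n; rewrite sub0r normrN ger0_norm ?powR_ge0 //.
have en : e `^ (- q^-1) <= n%:R by near: n; exact: nbhs_infty_ger.
have n0 : 0 < n%:R :> R by rewrite (lt_le_trans _ en) // powR_gt0.
rewrite powRN -[leRHS]invrK lef_pV2 ?posrE ?invr_gt0 ?powR_gt0 //.
apply: le_trans (_ : (e `^ (- q^-1)) `^ q <= _); last first.
  by rewrite ge0_ler_powR ?nnegrE ?powR_ge0 ?(ltW q0) // ltW.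
by rewrite -powRrM mulNr mulVf ?gt_eqF // powR_inv1 // ltW.
Unshelve. all: by end_near. Qed.

Lemma cvg_tail_ratio y : 0 < y -> G (y * n%:R) / G n%:R @[n --> \oo] --> y `^ (- alpha).
Proof.
move=> y0; apply: (@cvg_comp _ _ _ (fun n : nat => n%:R : R) (fun t => G (y * t) / G t) _ _ _ _ (G_rv y0)).
exact: cvgr_idn.
Qed.

Lemma tail_markov q Mq y : 0 <= q -> 0 < y ->
  (\int[P]_w (pos_part (X 0%N w) `^ q)%:E)%E = Mq%:E -> G y <= Mq * y `^ (- q).
Proof.
move=> q0 y0 hM; rewrite powRN ler_pdivlMr ?powR_gt0 // -lee_fin -hM mulrC EFinM.
rewrite -(tail_probability X_cdf 0%N) -integral_indicT; last exact: measurable_claim.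
rewrite -ge0_integralZl_EFin ?powR_ge0 //; last first.
  by apply/measurable_EFinP; apply: measurable_indic; exact: measurable_claim.
have mX := measurable_pos_claim X 0%N.
apply: ge0_le_integral => //.
- by move=> w _; rewrite -EFinM lee_fin mulr_ge0 ?powR_ge0.
- apply: measurable_funeM; apply/measurable_EFinP; apply: measurable_indic.
  exact: measurable_claim.
- by apply/measurable_EFinP; apply: (measurableT_comp (measurable_powR q)).
- move=> w _; rewrite -EFinM lee_fin indicE.
  case: (boolP (w \in _)) => [|_]; last by rewrite mulr0 powR_ge0.
  rewrite inE /= in_itv /= andbT => yX; rewrite mulr1.
  rewrite ge0_ler_powR ?nnegrE ?pos_part_ge0 ?(ltW y0) //.
  by rewrite /pos_part le_max (ltW yX).
Qed.

(** Markov's inequality for a moment of order q > 1. *)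
Lemma mean_tail_cvg0 : n%:R * G n%:R @[n --> \oo] --> 0.
Proof.
pose q := (1 + alpha) / 2.
have [q1 qa] : 1 < q /\ q < alpha by rewrite /q; move: alpha_gt1 => a1; split; lra.
have q0 : 0 < q by rewrite (lt_trans _ q1).
have qq : 0 < q < alpha by rewrite q0.
have fin := moment_finite X_cdf G_gt0 G_rv qq.
pose Mq := fine (\int[P]_w (pos_part (X 0%N w) `^ q)%:E)%E.
have hM : (\int[P]_w (pos_part (X 0%N w) `^ q)%:E)%E = Mq%:E.
  rewrite fineK // ge0_fin_numE //.
  by apply: integral_ge0 => w _; rewrite lee_fin powR_ge0.
have := cvg_powRN_pinfty (q := q - 1); rewrite subr_gt0 => /(_ q1) h.
have h2 : Mq * (n%:R : R) `^ (- (q - 1)) @[n --> \oo] --> 0.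
  by rewrite -[X in _ --> X](mulr0 Mq); apply: cvgMl_tmp.
apply: (squeeze_cvgr _ (cvg_cst 0) h2); near=> n.
have n0 : 0 < n%:R :> R by rewrite ltr0n; near: n; exact: nbhs_infty_gt.
rewrite mulr_ge0 ?(ltW n0) ?(ltW (G_gt0 _)) //=.
apply: le_trans (_ : n%:R * (Mq * n%:R `^ (- q)) <= _).
  by rewrite ler_wpM2l ?(ltW n0) // tail_markov // ltW.
rewrite opprB powRD ?(gt_eqF n0) ?implybT // powRr1 ?(ltW n0) //.
by rewrite mulrCA.
Unshelve. all: by end_near. Qed.

Definition many_exceedances k s y n : set T :=
  [set w | (k <= exceedances X (y * n%:R) (N (s * n%:R) w) w)%N].

Lemma measurable_many_exceedances k s y n : measurable (many_exceedances k s y n).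
Proof.
apply: (@measurable_random_index _ _ _ _ N (s * n%:R)
  (fun m => [set w | (k <= exceedances X (y * n%:R) m w)%N])).
by move=> m; exact: (measurable_exceedances X (y * n%:R) m [set i | (k <= i)%N]).
Qed.

(** Expected number of claims above n up to time n: the small parameter of all
    asymptotic statements. *)
Definition mean_exceedances n : R := lambda * n%:R * G n%:R.

Lemma mean_exceedances_cvg0 : mean_exceedances n @[n --> \oo] --> 0.
Proof.
rewrite -[X in _ --> X](mulr0 lambda).
rewrite (_ : mean_exceedances = fun n => lambda * (n%:R * G n%:R)); last first.
  by apply/funext => n; rewrite /mean_exceedances mulrA.
by apply: cvgMl_tmp; exact: mean_tail_cvg0.
Qed.

Lemma mean_exceedances_gt0 n : (0 < n)%N -> 0 < mean_exceedances n.
Proof. by move=> n0; rewrite !mulr_gt0 ?ltr0n. Qed.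

(** The number of exceedances is a Poisson variable with small mean lambda s n (1 -
    F (y n)), so k of them have probability close to the k-th power of the mean over
    k!. Regular variation compares 1 - F (y n) with 1 - F n. *)
Lemma many_exceedances_cvg k s y : 0 <= s -> 0 < y ->
  prob P (many_exceedances k.+1 s y n) / mean_exceedances n ^+ k.+1 @[n --> \oo] -->
    (s * y `^ (- alpha)) ^+ k.+1 / k.+1`!%:R.
Proof.
rewrite le_eqVlt => /predU1P[<- y0|s0 y0].
  apply: cvg_near_cst; apply: nearW => n.
  rewrite (_ : many_exceedances _ _ _ _ = set0) ?prob0 ?mul0r ?expr0n ?mul0r //.
  have [N0 _ _ _ _] := N_poisson.
  by apply/seteqP; split=> // w; rewrite /many_exceedances /= mul0r N0 /exceedances big_ord0.
pose rho n := s * (G (y * n%:R) / G n%:R).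
have hrho : rho n @[n --> \oo] --> s * y `^ (- alpha).
  by apply: cvgMl_tmp; exact: cvg_tail_ratio.
have hup : rho n ^+ k.+1 / k.+1`!%:R @[n --> \oo] --> (s * y `^ (- alpha)) ^+ k.+1 / k.+1`!%:R.
  apply: cvgMr_tmp.
  exact: (cvg_comp _ _ hrho (@exprn_continuous _ k.+1 _)).
have hlo : rho n ^+ k.+1 / k.+1`!%:R * expR (- (mean_exceedances n * rho n)) @[n --> \oo] -->
    (s * y `^ (- alpha)) ^+ k.+1 / k.+1`!%:R.
  rewrite -[X in _ --> X]mulr1; apply: cvgM => //.
  have h : - (mean_exceedances n * rho n) @[n --> \oo] --> 0.
    by rewrite -oppr0 -(mul0r (s * y `^ (- alpha))); apply: cvgN; apply: cvgM => //; exact: mean_exceedances_cvg0.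
  by rewrite -expR0; exact: (cvg_comp _ _ h (@continuous_expR _ _)).
apply: (squeeze_cvgr _ hlo hup); near=> n.
have n0 : (0 < n)%N by near: n; exact: nbhs_infty_gt.
have t0 : 0 < s * n%:R by rewrite mulr_gt0 // ltr0n.
have e : rho n * mean_exceedances n = lambda * (s * n%:R) * G (y * n%:R).
  rewrite /rho /mean_exceedances; have := G_gt0 n%:R; move: (G n%:R) (G (y * _)) => g1 g2 g10.
  by field; rewrite gt_eqF.
have r0 : 0 < mean_exceedances n ^+ k.+1 by rewrite exprn_gt0 // mean_exceedances_gt0.
rewrite ler_pdivlMr // ler_pdivrMr //.
have e2 : rho n ^+ k.+1 / k.+1`!%:R * mean_exceedances n ^+ k.+1 =
    (lambda * (s * n%:R) * G (y * n%:R)) ^+ k.+1 / k.+1`!%:R.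
  by rewrite mulrAC -exprMn e.
rewrite mulrAC e2 [mean_exceedances n * _]mulrC e -!lee_fin probE; last exact: measurable_many_exceedances.
apply/andP; split.
  apply: le_trans (@exceedances_eq_probability _ _ _ P lambda X N F lambda_gt0 X_indep X_cdf N_poisson XN_indep _ (y * n%:R) k.+1 t0) _.
  apply: le_measure; rewrite ?inE; last 1 first.
  - by move=> w /= /eqP h; rewrite /many_exceedances /= h.
  - apply: (@measurable_random_index _ _ _ _ N (s * n%:R)
      (fun m => [set w | exceedances X (y * n%:R) m w == k.+1])).
    by move=> m; exact: (measurable_exceedances X (y * n%:R) m [set i | i == k.+1]).
  - exact: measurable_many_exceedances.
exact: (@exceedances_ge_probability _ _ _ P lambda X N F lambda_gt0 X_indep X_cdf N_poisson XN_indep _ (y * n%:R) k.+1 t0).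
Unshelve. all: by end_near. Qed.

(** One exceedance more costs another factor of the small mean. *)
Lemma many_exceedances_succ_cvg0 k s y : 0 <= s -> 0 < y ->
  prob P (many_exceedances k.+2 s y n) / mean_exceedances n ^+ k.+1 @[n --> \oo] --> 0.
Proof.
move=> s0 y0; have h := cvgM (@many_exceedances_cvg k.+1 _ _ s0 y0) mean_exceedances_cvg0.
rewrite mulr0 in h; apply: cvg_trans (h _); apply: near_eq_cvg; near=> n.
have n0 : (0 < n)%N by near: n; exact: nbhs_infty_gt.
have := mean_exceedances_gt0 n0; rewrite /= !exprS; move: (mean_exceedances n) => x x0.
have := exprn_gt0 k x0; move: (x ^+ k) => z z0.
by field; rewrite !gt_eqF.
Unshelve. all: by end_near. Qed.

(** The tail decreases at most polynomially. *)
Lemma power_negligible k : exists2 A, 0 < A & forall C : R,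
  C * n%:R `^ (- A) / mean_exceedances n ^+ k @[n --> \oo] --> 0.
Proof.
have a0 : 0 < alpha by exact: lt_trans alpha_gt1.
have [|c c0 hc] := @tail_lower_bound _ alpha G a0 (tail_anti X_cdf) G_gt0 G_rv (alpha + 1).
  by rewrite ltrDl.
exists (alpha * k%:R + 1); first by rewrite ltr_wpDl // mulr_ge0 // ltW.
move=> C; pose D := (lambda * c) ^+ k.
have D0 : 0 < D by rewrite exprn_gt0 // mulr_gt0.
have lim : `|C| / D * n%:R `^ (- 1) @[n --> \oo] --> 0.
  by rewrite -[X in _ --> X](mulr0 (`|C| / D)); apply: cvgMl_tmp; exact: cvg_powRN_pinfty.
have limN : - (`|C| / D * n%:R `^ (- 1)) @[n --> \oo] --> 0 by rewrite -oppr0; exact: cvgN.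
apply: (squeeze_cvgr _ limN lim); near=> n.
have n0 : (0 < n)%N by near: n; exact: nbhs_infty_gt.
have x0 : 0 < n%:R :> R by rewrite ltr0n.
rewrite -ler_norml !normrM normrV ?unitfE ?gt_eqF ?exprn_gt0 ?mean_exceedances_gt0 //.
rewrite (ger0_norm (powR_ge0 _ _)) (ger0_norm (ltW (exprn_gt0 _ (mean_exceedances_gt0 n0)))).
rewrite ler_pdivrMr ?exprn_gt0 ?mean_exceedances_gt0 // -!mulrA ler_wpM2l //.
rewrite ler_pdivlMl //.
have hD (u v : R) : n%:R `^ (u + v) = n%:R `^ u * n%:R `^ v by rewrite powRD // (gt_eqF x0) implybT.
rewrite opprD addrC hD mulrCA ler_wpM2l ?powR_ge0 //.
have -> : D * n%:R `^ (- (alpha * k%:R)) = (lambda * c * n%:R `^ (- alpha)) ^+ k.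
  by rewrite exprMn -/D -mulNr powRrM powR_mulrn // powR_ge0.
rewrite lerXn2r ?nnegrE ?mulr_ge0 ?powR_ge0 ?(ltW c0) ?(ltW lambda_gt0) ?(ltW (mean_exceedances_gt0 n0)) ?(ltW (G_gt0 _)) //.
rewrite /mean_exceedances -!mulrA ler_wpM2l ?(ltW lambda_gt0) //.
apply: le_trans (_ : n%:R * (c * n%:R `^ (- (alpha + 1))) <= _); last first.
  by rewrite ler_wpM2l ?(ltW x0) // hc // ler1n.
have e1 : n%:R * n%:R `^ (- 1) = 1 :> R by rewrite powR_inv1 ?(ltW x0) // mulfV // gt_eqF.
by rewrite opprD hD mulrCA [n%:R * _]mulrCA e1 mulr1.
Unshelve. all: by end_near. Qed.

End tail_asymptotics.

(** * Ruin and exceedances over blocks of time *)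

Section path_blocks.
Variables (T : Type) (R : realType) (X : nat -> T -> R) (N : R -> T -> nat).
Variables (m : reinsurance) (r : nat) (pD a c ell : R).
Hypothesis c_def : c = pD - ell.
Hypothesis a_gt0 : 0 < a.
Hypothesis ca_gt0 : 0 < c + a.
Implicit Types (M j : nat) (w : T) (s t x th del b eps K : R).

Definition block_time M j : R := j.+1%:R / M%:R.

(** Level, in units of n, that the (r + 1)-st largest claim has to exceed at time s
    n in order to cause ruin: the capital a plus the drift c s, divided by the
    multiplicity of that claim. The factor th, close to 1, absorbs all errors of
    approximation. *)
Definition level th s : R := (a + c * s) * th / net_factor R m r.

Lemma block_time_gt0 M j : (0 < M)%N -> 0 < block_time M j.
Proof. by move=> M0; rewrite divr_gt0 ?ltr0n. Qed.

Lemma block_time_le1 M j : (j < M)%N -> block_time M j <= 1.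
Proof. by move=> jM; rewrite ler_pdivrMr ?ltr0n ?(leq_ltn_trans _ jM) // mul1r ler_nat. Qed.

Lemma slope_ge s : 0 <= s -> s <= 1 -> Num.min a (a + c) <= a + c * s.
Proof.
move=> s0 s1; rewrite ge_min; have [c0|c0] := leP 0 c.
  by rewrite lerDl mulr_ge0.
by apply/orP; right; rewrite lerD2l; nra.
Qed.

Lemma slope_min_gt0 : 0 < Num.min a (a + c).
Proof. by rewrite lt_min a_gt0 addrC. Qed.

Lemma net_factor_gt0 : 0 < net_factor R m r.
Proof. exact: lt_le_trans ltr01 (net_factor_ge1 _ _ _). Qed.

Lemma level_gt0 th s : 0 < th -> 0 <= s -> s <= 1 -> 0 < level th s.
Proof.
move=> th0 s0 s1; rewrite divr_gt0 ?net_factor_gt0 // mulr_gt0 //.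
exact: lt_le_trans slope_min_gt0 (slope_ge s0 s1).
Qed.

Lemma block_index M t x : (0 < M)%N -> 0 <= t -> t <= x ->
  exists2 j, (j < M)%N & block_time M j * x - x / M%:R <= t <= block_time M j * x.
Proof.
move=> M0 t0 tx; have M0' : 0 < M%:R :> R by rewrite ltr0n.
have ex : exists j, (j < M)%N && (t <= block_time M j * x).
  by exists M.-1; rewrite /block_time prednK // leqnn mulfV ?gt_eqF // mul1r.
case: (ex_minnP ex) => [j /andP[jM tj] jmin]; exists j => //; rewrite tj andbT.
have e : block_time M j * x - x / M%:R = j%:R / M%:R * x.
  by rewrite /block_time -natr1; field; rewrite gt_eqF.
rewrite e; case: j jM tj jmin {e} => [|j] jM tj jmin; first by rewrite mul0r mul0r.
by rewrite leNgt; apply/negP => /ltW tj'; have := jmin j; rewrite tj' (ltnW jM) ltnn => /(_ isT).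
Qed.

(** With at most r + 1 claims above eps x, the net amount is the (r + 1)-st largest
    claim with its multiplicity plus a sum of truncated claims, which follows its
    mean. What is missing at ruin has to come from that one claim. The reduction of
    the level by del pays for the fluctuations and for moving to the end of the
    block. *)
Lemma ruin_path_upper w M x del eps :
  (forall i, 0 <= X i w) ->
  (forall s t, 0 <= s -> s <= t -> (N s w <= N t w)%N) ->
  (0 < M)%N -> 0 < x -> 0 < del -> del < 1 -> 0 < eps ->
  `|pD| / M%:R <= del * Num.min a (a + c) / 2 ->
  ~ (r.+2 <= exceedances X (eps * x) (N (1 * x) w) w)%N ->
  (forall j, (j < M)%N ->
     ~ (ell * block_time M j + del * Num.min a (a + c) / 2) * x <
       truncated_sum X (eps * x) (N (block_time M j * x) w) w) ->
  ruin_event X N m r pD (x * a) x w ->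
  exists2 j, (j < M)%N &
    (r.+1 <= exceedances X (level (1 - del) (block_time M j) * x) (N (block_time M j * x) w) w)%N.
Proof.
move=> X0 Nmono M0 x0 del0 del1 eps0 hM hD hV /ruin_eventP[t /andP[t0 tx] ut].
have [j jM /andP[jt tj]] := block_index M0 t0 tx; exists j => //.
set s := block_time M j in jt tj *; have s0 : 0 < s by exact: block_time_gt0.
have s1 : s <= 1 by exact: block_time_le1.
have Nts : (N t w <= N (s * x) w)%N by exact: Nmono.
have Ntx : (N t w <= N (1 * x) w)%N by rewrite mul1r; exact: Nmono.
have b0 : 0 <= eps * x by rewrite mulr_ge0 // ltW.
have hex : (exceedances X (eps * x) (N t w) w <= r.+1)%N.
  rewrite -ltnS ltnNge; apply/negP => h; apply: hD.
  exact: leq_trans h (exceedances_mono _ _ _ Ntx).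
have hnet := net_amount_le m b0 X0 hex.
have htr := truncated_sum_mono b0 X0 Nts.
have /negP := hV _ jM; rewrite -leNgt -/s => hVj.
have hp : pD * (s * x) - `|pD| / M%:R * x <= pD * t.
  have h1 : `|pD * (s * x - t)| <= `|pD| * (x / M%:R).
    rewrite normrM ler_wpM2l // ger0_norm ?subr_ge0 //.
    by move: jt; lra.
  move: (ler_norm (pD * (s * x - t))) h1; rewrite mulrBr [_ / _ * _]mulrAC mulrA; lra.
have hm := slope_ge (ltW s0) s1.
have hl : level (1 - del) s * x < order_stat X N t w r.
  have h2 : (a + c * s) * (1 - del) * x < net_factor R m r * order_stat X N t w r.
    have h3 : del * Num.min a (a + c) * x <= del * (a + c * s) * x.
      by rewrite ler_wpM2r ?(ltW x0) // ler_wpM2l // ltW.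
    have h4 : `|pD| / M%:R * x <= del * Num.min a (a + c) / 2 * x.
      by rewrite ler_wpM2r // ltW.
    move: ut hnet htr hVj hp h3 h4.
    move: (Num.min a (a + c)) (`|pD| / M%:R) (net_factor R m r * _)
      (truncated_sum _ _ _ _) (truncated_sum _ _ _ _) (net_amount _ _ _ _ _ _) (pD * t).
    rewrite c_def => v1 v2 v3 v4 v5 v6 v7; nra.
  by rewrite /level mulrAC ltr_pdivrMr ?net_factor_gt0 // [ltRHS]mulrC.
have l0 : 0 < level (1 - del) s by rewrite level_gt0 ?subr_gt0 // ltW.
move: hl; rewrite order_stat_gt; last by rewrite mulr_ge0 ?orbT // ltW.
by move=> h; apply: leq_trans h (exceedances_mono _ _ _ Nts).
Qed.

(** The truncated claims follow their mean from below, and the reserve del in the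
    level pays for the deviation and for the r + 1 truncated claims that are counted
    separately. *)
Lemma ruin_path_lower w M j x del K : (j < M)%N -> 0 < x -> 0 < del -> 0 < K ->
  r.+1%:R * K <= del * Num.min a (a + c) / 2 * x ->
  (ell * block_time M j - del * Num.min a (a + c) / 2) * x <=
     truncated_sum X K (N (block_time M j * x) w) w ->
  (r.+1 <= exceedances X (level (1 + del) (block_time M j) * x) (N (block_time M j * x) w) w)%N ->
  ruin_event X N m r pD (x * a) x w.
Proof.
move=> jM x0 del0 K0 hK hW hex; set s := block_time M j in hW hex.
have M0 : (0 < M)%N by exact: leq_ltn_trans jM.
have s0 : 0 < s by exact: block_time_gt0.
have s1 : s <= 1 by exact: block_time_le1.
apply/ruin_eventP; exists (s * x).
  by rewrite mulr_ge0 ?(ltW s0) ?(ltW x0) //= ler_piMl // ltW.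
have l0 : 0 < level (1 + del) s by rewrite level_gt0 ?addr_gt0 // ltW.
move: hex; rewrite -order_stat_gt; last by rewrite mulr_ge0 ?orbT // ltW.
rewrite /level mulrAC ltr_pdivrMr ?net_factor_gt0 // [ltRHS]mulrC => hos.
have hnet := net_amount_ge X N m r (s * x) w (ltW K0).
have hm := slope_ge (ltW s0) s1.
have h3 : del * Num.min a (a + c) * x <= del * (a + c * s) * x.
  by rewrite ler_wpM2r ?(ltW x0) // ler_wpM2l // ltW.
move: hnet hos h3 hK hW.
move: (Num.min a (a + c)) (net_factor R m r * _)
  (truncated_sum _ _ _ _) (net_amount _ _ _ _ _ _) (r.+1%:R * K).
rewrite c_def => v1 v2 v3 v4 v5; nra.
Qed.

End path_blocks.

Section ruin_and_blocks.
Context (d : measure_display) (T : measurableType d) (R : realType)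
  (P : probability T R) (alpha lambda : R) (X : nat -> {RV P >-> R})
  (N : R -> {RV P >-> nat}) (F : R -> R) (m : reinsurance) (r : nat)
  (pD a c mu q Mq : R).
Hypothesis lambda_gt0 : 0 < lambda.
Hypothesis alpha_gt1 : 1 < alpha.
Hypothesis X_pos : forall i, {ae P, forall w, 0 < X i w}.
Hypothesis X_indep : independent_RVs P (fun i w => X i w).
Hypothesis X_cdf : forall i x, cdf (X i) x = (F x)%:E.
Hypothesis N_poisson : poisson_process lambda N.
Hypothesis XN_indep : independent_sigma P
  (sigma_family setT (fun i w => X i w))
  (sigma_family [set t : R | 0 <= t] (fun t w => N t w)).
Hypothesis G_gt0 : forall x, 0 < 1 - F x.
Hypothesis G_rv : forall x, 0 < x ->
  (1 - F (x * t)) / (1 - F t) @[t --> +oo] --> x `^ (- alpha).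
Hypothesis q_gt1 : 1 < q.
Hypothesis q_le2 : q <= 2.
Hypothesis meanE : (\int[P]_w (pos_part (X 0%N w))%:E)%E = mu%:E.
Hypothesis momentE : (\int[P]_w (pos_part (X 0%N w) `^ q)%:E)%E = Mq%:E.
Hypothesis c_def : c = pD - lambda * mu.
Hypothesis a_gt0 : 0 < a.
Hypothesis ca_gt0 : 0 < c + a.
Implicit Types (M j n : nat) (th del : R).

Let XX i w : R := X i w.
Let NN t w : nat := N t w.
Let claim i w : R := pos_part (X i w).

Definition block_event th M n j : set T :=
  many_exceedances X N r.+1 (block_time R M j) (level m r a c th (block_time R M j)) n.

Definition block_union th M n : set T := \big[setU/set0]_(j < M) block_event th M n j.

Let ruin n : set T := ruin_event XX NN m r pD (n%:R * a) n%:R.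

Lemma measurable_block_union th M n : measurable (block_union th M n).
Proof. by apply: measurable_big_union => j _; exact: measurable_many_exceedances. Qed.

Let measurable_ruin n : measurable (ruin n).
Proof. exact: (measurable_ruin_event _ N_poisson). Qed.

Lemma positive_claims : exists2 Z : set T, measurable Z & prob P Z = 0 /\
  forall w, ~ Z w -> forall i, 0 < X i w.
Proof.
exists (\bigcup_i X i @^-1` `]-oo, 0%R]%classic).
  by apply: bigcupT_measurable => i; apply: measurable_claim; exact: measurable_itv.
split; last first.
  move=> w Zw i; rewrite ltNge; apply/negP => h; apply: Zw.
  by exists i => //=; rewrite in_itv.
rewrite /prob; suff -> : (P (\bigcup_i X i @^-1` `]-oo, 0%R]%classic) = 0)%E by [].
apply/negligibleP.
  by apply: bigcupT_measurable => i; apply: measurable_claim; exact: measurable_itv.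
apply: negligible_bigcup => i; apply: negligibleS (X_pos i) => w /=.
by rewrite in_itv /= leNgt => /negP.
Qed.

Let truncated_pos b n w : (forall i, 0 < X i w) -> truncated_sum claim b n w = truncated_sum XX b n w.
Proof.
by move=> X0; apply: eq_bigr => i _; rewrite /claim /pos_part max_l // ltW.
Qed.

(** The exceptional events are: r + 2 claims above eps n, upward deviations of the
    truncated sums at the ends of the M blocks, and the null event of a nonpositive
    claim. *)
Lemma ruin_upper del : 0 < del -> del < 1 -> exists2 M, (0 < M)%N &
  exists2 negl : nat -> R, negl n / mean_exceedances lambda F n ^+ r.+1 @[n --> \oo] --> 0 &
  forall n, (0 < n)%N -> prob P (ruin n) <= prob P (block_union (1 - del) M n) + negl n.
Proof.
move=> del0 del1; pose m0 := Num.min a (a + c).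
have m00 : 0 < m0 by rewrite lt_min a_gt0 addrC.
have d10 : 0 < del * m0 / 2 by rewrite divr_gt0 // mulr_gt0.
pose M := (Num.truncn (`|pD| / (del * m0 / 2))).+1.
have hM : `|pD| / M%:R <= del * m0 / 2.
  by rewrite ler_pdivrMr ?ltr0n // mulrC -ler_pdivrMr // ltW // truncnS_gt.
have [A A0 negA] := power_negligible lambda_gt0 alpha_gt1 X_cdf G_gt0 G_rv r.+1.
have [eps eps0 [C C0 hV]] := truncated_sum_upper lambda_gt0 X_indep X_cdf N_poisson XN_indep
  q_gt1 q_le2 meanE momentE d10 A0.
have [Z mZ [Z0 hZ]] := positive_claims.
exists M => //; exists (fun n => M%:R * C * n%:R `^ (- A) + prob P (many_exceedances X N r.+2 1 eps n)).
  rewrite (_ : (fun n => _) = (fun n => M%:R * C * n%:R `^ (- A) / mean_exceedances lambda F n ^+ r.+1 +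
      prob P (many_exceedances X N r.+2 1 eps n) / mean_exceedances lambda F n ^+ r.+1)); last first.
    by apply/funext => n; rewrite mulrDl.
  rewrite -[X in _ --> X]addr0; apply: cvgD; first exact: negA.
  exact: (many_exceedances_succ_cvg0 lambda_gt0 alpha_gt1 X_indep X_cdf N_poisson XN_indep G_gt0 G_rv).
move=> n n0.
pose V j := [set w | ((lambda * mu * block_time R M j + del * m0 / 2) * n%:R <
   truncated_sum claim (eps * n%:R) (N (block_time R M j * n%:R) w) w)%R].
have mV j : measurable (V j).
  have := measurable_truncated_gt X N (block_time R M j * n%:R) (eps * n%:R)
    ((lambda * mu * block_time R M j + del * m0 / 2) * n%:R) 1.
  by congr measurable; apply/seteqP; split=> w /=; rewrite mul1r.
pose VV := \big[setU/set0]_(j < M) V j.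
have mVV : measurable VV by exact: measurable_big_union.
have hVV : prob P VV <= M%:R * C * n%:R `^ (- A).
  rewrite -mulrA; apply: prob_big_union_le => // j jM; rewrite -lee_fin probE //.
  by apply: hV => //; [exact: block_time_gt0|exact: block_time_le1].
set D := many_exceedances X N r.+2 1 eps n; have mD : measurable D by exact: measurable_many_exceedances.
have mB := measurable_block_union (1 - del) M n.
apply: le_trans (_ : prob P (block_union (1 - del) M n `|` (VV `|` (D `|` Z))) <= _); last first.
  apply: le_trans (probU_le _ mB _) _; first by repeat apply: measurableU.
  rewrite lerD2l; apply: le_trans (probU_le _ mVV _) _; first by apply: measurableU.
  rewrite lerD //; apply: le_trans (probU_le _ mD mZ) _.
  by rewrite Z0 addr0.
apply: prob_le; [exact: measurable_ruin|by repeat apply: measurableU|].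
move=> w hw; have [Zw|/hZ Xw] := pselect (Z w); first by right; right; right.
have [Dw|Dw] := pselect (D w); first by right; right; left.
have [VVw|VVw] := pselect (VV w); first by right; left.
left; apply/big_unionP; have [_ Nmono _ _ _] := N_poisson.
apply: (@ruin_path_upper _ _ XX NN m r pD a c (lambda * mu) c_def a_gt0 ca_gt0 w M n%:R del eps) => //.
- by move=> i; rewrite ltW // Xw.
- by move=> s t; exact: Nmono.
- by rewrite ltr0n.
- move=> j jM; rewrite -truncated_pos // => h; apply: VVw; apply/big_unionP; by exists j.
Qed.

(** Only downward deviations at the ends of the M blocks have to be excluded. *)
Lemma ruin_lower del M : 0 < del -> (0 < M)%N ->
  exists2 negl : nat -> R, negl n / mean_exceedances lambda F n ^+ r.+1 @[n --> \oo] --> 0 &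
  \forall n \near \oo, prob P (block_union (1 + del) M n) <= prob P (ruin n) + negl n.
Proof.
move=> del0 M0; pose m0 := Num.min a (a + c).
have m00 : 0 < m0 by rewrite lt_min a_gt0 addrC.
have d10 : 0 < del * m0 / 2 by rewrite divr_gt0 // mulr_gt0.
have [A A0 negA] := power_negligible lambda_gt0 alpha_gt1 X_cdf G_gt0 G_rv r.+1.
have [K K0 [C C0 hW]] := truncated_sum_lower lambda_gt0 X_indep X_cdf N_poisson XN_indep
  q_gt1 meanE momentE d10 A0.
have [Z mZ [Z0 hZ]] := positive_claims.
exists (fun n => M%:R * C * n%:R `^ (- A)); first exact: negA.
near=> n.
have n0 : (0 < n)%N by near: n; exact: nbhs_infty_gt.
have nK : r.+1%:R * K <= del * m0 / 2 * n%:R.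
  by rewrite -ler_pdivrMl // mulrC; near: n; exact: nbhs_infty_ger.
pose W j := [set w | (truncated_sum claim K (N (block_time R M j * n%:R) w) w <
   (lambda * mu * block_time R M j - del * m0 / 2) * n%:R)%R].
have mW j : measurable (W j).
  have := measurable_truncated_gt X N (block_time R M j * n%:R) K
    (- ((lambda * mu * block_time R M j - del * m0 / 2) * n%:R)) (- 1).
  by congr measurable; apply/seteqP; split=> w /=; rewrite mulN1r ltrN2.
pose WW := \big[setU/set0]_(j < M) W j.
have mWW : measurable WW by exact: measurable_big_union.
have hWW : prob P WW <= M%:R * C * n%:R `^ (- A).
  rewrite -mulrA; apply: prob_big_union_le => // j jM; rewrite -lee_fin probE //.
  by apply: hW => //; [exact: block_time_gt0|exact: block_time_le1].
have mr := measurable_ruin n.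
apply: le_trans (_ : prob P (ruin n `|` (WW `|` Z)) <= _); last first.
  apply: le_trans (probU_le _ mr _) _; first by apply: measurableU.
  rewrite lerD2l; apply: le_trans (probU_le _ mWW mZ) _.
  by rewrite Z0 addr0.
apply: prob_le; [exact: measurable_block_union|by repeat apply: measurableU|].
move=> w /big_unionP[j jM hw].
have [Zw|/hZ Xw] := pselect (Z w); first by right; right.
have [WWw|WWw] := pselect (WW w); first by right; left.
left; apply: (@ruin_path_lower _ _ XX NN m r pD a c (lambda * mu) c_def a_gt0 ca_gt0 w M j n%:R del K) => //.
  by rewrite ltr0n.
rewrite -truncated_pos // leNgt; apply/negP => h; apply: WWw; apply/big_unionP; by exists j.
Unshelve. all: by end_near. Qed.

End ruin_and_blocks.

(** * Asymptotics of the block events *)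

Section block_counts.
Variables (T : Type) (R : realType) (X : nat -> T -> R).

(** Every claim of index between n and n' that exceeds y' also exceeds y. *)
Lemma exceedances_increment (y y' : R) n n' w : y <= y' -> (n <= n')%N ->
  (exceedances X y' n' w + exceedances X y n w <=
   exceedances X y n' w + exceedances X y' n w)%N.
Proof.
move=> yy nn; rewrite /exceedances.
have split z : (\sum_(i < n') (z < X i w)%R)%N =
    (\sum_(i < n) (z < X i w)%R + \sum_(n <= i < n') (z < X i w)%R)%N.
  rewrite -!(big_mkord xpredT (fun i => (z < X i w)%R : nat)).
  by rewrite (@big_cat_nat _ _ _ n 0 n').
rewrite !split addnAC [leqRHS]addnAC [(\sum_(i < n) (y < _)%R + _)%N]addnC leq_add2l.
apply: leq_sum => i _; case: (ltP y' (X i w)) => // h.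
by rewrite (le_lt_trans yy h).
Qed.

End block_counts.

Section passage_integral.
Variables (R : realType) (alpha a c : R) (m : reinsurance) (r : nat).
Hypothesis alpha_gt0 : 0 < alpha.
Hypothesis a_gt0 : 0 < a.
Hypothesis ca_gt0 : 0 < c + a.
Implicit Types (s t th : R) (M : nat).

Let p := r.+1%:R * alpha.

Let p_gt0 : 0 < p.
Proof. by rewrite mulr_gt0. Qed.

Definition slope_power s : R := (a + c * s) `^ (- (r.+1%:R * alpha)).

(** Limiting weight of the union of the block events. For c > 0 the level rises and
    the decisive claim can come at any time; otherwise the end of the horizon, with
    the lowest level and the most claims, decides alone. *)
Definition passage_integral : R :=
  if 0 < c then \int[lebesgue_measure]_(t in `[0, 1]) (r.+1%:R * t ^+ r * slope_power t)
  else slope_power 1.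

(** Collects the factors of the limit probabilities that do not depend on time. *)
Definition level_scale th : R := (net_factor R m r / th) `^ (r.+1%:R * alpha) / r.+1`!%:R.

Lemma slope_gt0 s : 0 <= s -> s <= 1 -> 0 < a + c * s.
Proof.
by move=> s0 s1; exact: lt_le_trans (slope_min_gt0 a_gt0 ca_gt0) (slope_ge a c s0 s1).
Qed.

Lemma slope_power_anti s t : 0 <= c -> 0 <= s -> s <= t -> t <= 1 -> slope_power t <= slope_power s.
Proof.
move=> c0 s0 st t1; rewrite /slope_power !powRN.
have vs := slope_gt0 s0 (le_trans st t1); have vt := slope_gt0 (le_trans s0 st) t1.
rewrite -/p lef_pV2 ?posrE ?powR_gt0 //.
rewrite ge0_ler_powR ?nnegrE ?(ltW vs) ?(ltW vt) //.
  by rewrite mulr_ge0 // ltW //.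
by rewrite lerD2l ler_wpM2l.
Qed.

Lemma slope_power_bounds M : 0 < c -> (0 < M)%N ->
  riemann_stieltjes_sum r slope_power M <= passage_integral <=
  riemann_stieltjes_sum r slope_power M + r.+1%:R / M%:R * slope_power 0.
Proof.
move=> c0 M0; rewrite /passage_integral c0; apply: riemann_stieltjes_bounds => //.
- apply: derivable_within_continuous => t; rewrite in_itv /= => /andP[t0 t1].
  have hd := is_derive1_powR (- p) (slope_gt0 t0 t1).
  have hl : is_derive t 1 (fun s => a + c * s) c.
    by apply: is_derive_eq; rewrite add0r mul1r; exact: mulr1.
  by have [] := @is_derive1_comp _ (@powR R ^~ (- p)) (fun s => a + c * s) _ _ _ hd hl.
- by move=> s t s0 st t1; exact: slope_power_anti (ltW c0) s0 st t1.
- by move=> t _; exact: powR_ge0.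
Qed.

Lemma kappaE : kappa m alpha r = net_factor R m r `^ (r.+1%:R * alpha).
Proof. by case: m => //=; rewrite powR1. Qed.

(** Euler's integral at - c / a, rescaled by a. *)
Lemma asymp_constE : asymp_const m alpha a c r = level_scale 1 * passage_integral.
Proof.
rewrite /asymp_const /level_scale divr1 kappaE /passage_integral; congr (_ * _).
case: ltP => c0; last by rewrite /slope_power mulr1.
rewrite hyp2F1_real_neg //; last by rewrite divr_ge0 // ltW.
have x0 : 0 <= c / a by rewrite divr_ge0 // ltW.
have cf : {within `[0%R, 1%R], continuous (fun t : R => r.+1%:R * t ^+ r * (1 + c / a * t) `^ (- p))}.
  apply: derivable_within_continuous => t; rewrite in_itv /= => /andP[t0 t1].
  have v0 : 0 < 1 + c / a * t by rewrite ltr_wpDr // mulr_ge0.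
  have hd := is_derive1_powR (- p) v0.
  have hl : is_derive t 1 (fun s => 1 + c / a * s) (c / a).
    by apply: is_derive_eq; rewrite add0r mul1r; exact: mulr1.
  have h2 := @is_derive1_comp _ (@powR R ^~ (- p)) (fun s => 1 + c / a * s) _ _ _ hd hl.
  apply: derivableM; last by case: h2.
  exact: (@ex_derive _ _ _ _ _ _ _ (is_deriveZ (r.+1%:R : R) (is_derive_exp r t))).
rewrite -RintegralZl //; last exact: continuous_integrable01.
apply: eq_Rintegral => t; rewrite inE /= in_itv /= => /andP[t0 t1].
rewrite mulrCA; congr (_ * _); rewrite -powRM ?ltW //; last first.
  by rewrite ltr_wpDr // mulr_ge0.
by congr (_ `^ _); field; rewrite gt_eqF.
Qed.

Lemma passage_integral_gt0 : 0 < passage_integral.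
Proof.
have [c0|c0] := ltP 0 c; last first.
  by rewrite /passage_integral (ltNge 0 c) c0 /= powR_gt0 // slope_gt0.
have /andP[h _] := slope_power_bounds c0 (ltnSn 0); apply: lt_le_trans h.
rewrite /riemann_stieltjes_sum big_ord1 mul0r expr0n subr0 divr1 expr1n mul1r.
by rewrite /slope_power powR_gt0 // slope_gt0.
Qed.

Lemma asymp_const_gt0 : 0 < asymp_const m alpha a c r.
Proof.
rewrite asymp_constE mulr_gt0 ?passage_integral_gt0 //.
by rewrite /level_scale divr1 divr_gt0 // ?ltr0n ?fact_gt0 // powR_gt0 // net_factor_gt0.
Qed.

Lemma level_scaleE th : 0 < th ->
  level_scale th = level_scale 1 * th `^ (- p).
Proof.
move=> th0; rewrite /level_scale divr1 -/p mulrAC; congr (_ / _).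
rewrite powRM ?invr_ge0 ?(ltW th0) ?(ltW (net_factor_gt0 _ _ _)) //; congr (_ * _).
by rewrite -powR_inv1 ?(ltW th0) // -powRrM mulN1r.
Qed.

End passage_integral.

Section block_union_asymptotics.
Context (d : measure_display) (T : measurableType d) (R : realType)
  (P : probability T R) (alpha lambda : R) (X : nat -> {RV P >-> R})
  (N : R -> {RV P >-> nat}) (F : R -> R) (m : reinsurance) (r : nat) (a c : R).
Hypothesis lambda_gt0 : 0 < lambda.
Hypothesis alpha_gt1 : 1 < alpha.
Hypothesis X_indep : independent_RVs P (fun i w => X i w).
Hypothesis X_cdf : forall i x, cdf (X i) x = (F x)%:E.
Hypothesis N_poisson : poisson_process lambda N.
Hypothesis XN_indep : independent_sigma P
  (sigma_family setT (fun i w => X i w))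
  (sigma_family [set t : R | 0 <= t] (fun t w => N t w)).
Hypothesis G_gt0 : forall x, 0 < 1 - F x.
Hypothesis G_rv : forall x, 0 < x ->
  (1 - F (x * t)) / (1 - F t) @[t --> +oo] --> x `^ (- alpha).
Hypothesis a_gt0 : 0 < a.
Hypothesis ca_gt0 : 0 < c + a.
Implicit Types (M j n : nat) (th e s : R).

Let p := r.+1%:R * alpha.
Let slope_gt0 := slope_gt0 a_gt0 ca_gt0.
Let alpha_gt0 : 0 < alpha. Proof. exact: lt_trans alpha_gt1. Qed.

Let lev M j th := level m r a c th (block_time R M j).
Let A th M n j := block_event X N m r a c th M n j.
(* The level of a block is crossed before the block begins. *)
Let B th M n j := many_exceedances X N r.+1 (j%:R / M%:R) (lev M j th) n.
Let U th M n := block_union X N m r a c th M n.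

Let lev_gt0 M j th : (j < M)%N -> 0 < th -> 0 < lev M j th.
Proof.
move=> jM th0; apply: level_gt0 => //; last exact: block_time_le1.
by rewrite ltW // block_time_gt0 // (leq_ltn_trans _ jM).
Qed.

Let level_power th s' s : 0 < th -> 0 <= s -> s <= 1 ->
  (s' * level m r a c th s `^ (- alpha)) ^+ r.+1 / r.+1`!%:R =
  level_scale alpha m r th * (s' ^+ r.+1 * slope_power alpha a c r s).
Proof.
move=> th0 s0 s1; have v0 := slope_gt0 s0 s1; have nf0 := net_factor_gt0 R m r.
have e : level m r a c th s `^ (- alpha) ^+ r.+1 = (net_factor R m r / th) `^ p * slope_power alpha a c r s.
  rewrite -powR_mulrn ?powR_ge0 // -powRrM mulNr [alpha * _]mulrC -/p.
  rewrite /level -[(_ * th) / _]mulrA powRM ?divr_ge0 ?ltW // mulrC; congr (_ * _).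
  by rewrite -[net_factor R m r / th]invf_div -[X in _ = X `^ _]powR_inv1 ?divr_ge0 ?ltW // -powRrM mulN1r.
rewrite exprMn e /level_scale -/p; ring.
Qed.

Let measurable_A th M n j : measurable (A th M n j).
Proof. exact: measurable_many_exceedances. Qed.

Let measurable_B th M n j : measurable (B th M n j).
Proof. exact: measurable_many_exceedances. Qed.

Let N_mono w s t : 0 <= s -> s <= t -> (N s w <= N t w)%N.
Proof. by have [_ h _ _ _] := N_poisson; exact: h. Qed.

Let time_mono j i M n w : (j <= i)%N ->
  (N (j%:R / M%:R * n%:R) w <= N (i%:R / M%:R * n%:R) w)%N.
Proof.
move=> ji; apply: N_mono; first by rewrite !mulr_ge0.
by rewrite !ler_wpM2r // ler_nat.
Qed.

Let B_sub_A th M n j : B th M n j `<=` A th M n j.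
Proof.
move=> w h; apply: leq_trans h _; apply: exceedances_mono; exact: time_mono.
Qed.

Let A_cvg th M j : 0 < th -> (j < M)%N ->
  prob P (A th M n j) / mean_exceedances lambda F n ^+ r.+1 @[n --> \oo] -->
    level_scale alpha m r th * (block_time R M j ^+ r.+1 * slope_power alpha a c r (block_time R M j)).
Proof.
move=> th0 jM; have t0 : 0 < block_time R M j by rewrite block_time_gt0 // (leq_ltn_trans _ jM).
have t1 : block_time R M j <= 1 by exact: block_time_le1.
rewrite -level_power // ?(ltW t0) //.
by apply: (many_exceedances_cvg lambda_gt0 alpha_gt1 X_indep X_cdf N_poisson XN_indep G_gt0 G_rv); [exact: ltW|exact: lev_gt0].
Qed.

Let B_cvg th M j : 0 < th -> (j < M)%N ->
  prob P (B th M n j) / mean_exceedances lambda F n ^+ r.+1 @[n --> \oo] -->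
    level_scale alpha m r th * ((j%:R / M%:R) ^+ r.+1 * slope_power alpha a c r (block_time R M j)).
Proof.
move=> th0 jM; have t0 : 0 < block_time R M j by rewrite block_time_gt0 // (leq_ltn_trans _ jM).
have t1 : block_time R M j <= 1 by exact: block_time_le1.
rewrite -level_power // ?(ltW t0) //.
by apply: (many_exceedances_cvg lambda_gt0 alpha_gt1 X_indep X_cdf N_poisson XN_indep G_gt0 G_rv); [exact: divr_ge0|exact: lev_gt0].
Qed.

Let lev_mono i j M th : 0 <= c -> 0 < th -> (i <= j)%N -> lev M i th <= lev M j th.
Proof.
move=> c0 th0 ij; rewrite /lev /level ler_wpM2r ?invr_ge0 ?(ltW (net_factor_gt0 _ _ _)) //.
by rewrite ler_wpM2r ?(ltW th0) // lerD2l ler_wpM2l // ler_wpM2r ?invr_ge0 // ler_nat.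
Qed.

(** Only the first block event that occurs is needed, and for this block B fails:
    since the level rises, B is contained in the event of the previous block. *)
Let union_le th M n : 0 < c -> 0 < th ->
  prob P (U th M n) <= \sum_(j < M) (prob P (A th M n j) - prob P (B th M n j)).
Proof.
move=> c0 th0.
apply: le_trans (_ : \sum_(j < M) prob P (A th M n j `\` B th M n j) <= _); last first.
  apply: ler_sum => j _; rewrite probD //; exact: B_sub_A.
apply: (@prob_union_le _ _ _ P M (fun j => A th M n j `\` B th M n j)) => [|j jM|w]; first exact: measurable_block_union.
  exact: measurableD.
move=> /big_unionP ex0.
have ex : exists j, (j < M)%N && `[< A th M n j w >].
  by have [j jM h] := ex0; exists j; rewrite jM; apply/asboolP.
case: (ex_minnP ex) => j /andP[jM /asboolP Aj] jmin; exists j => //; split=> // Bj.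
case: j jM Aj jmin Bj => [|j] jM Aj jmin Bj.
  have [N0 _ _ _ _] := N_poisson.
  by move: Bj; rewrite /B /many_exceedances /= mul0r mul0r N0 /exceedances big_ord0.
suff : (j.+1 <= j)%N by rewrite ltnn.
apply: jmin; rewrite (ltnW jM); apply/asboolP.
apply: leq_trans Bj _; apply: exceedances_anti.
by rewrite ler_wpM2r // lev_mono // ltW.
Qed.

(** If the differences of A and B for two blocks both occur, then a new claim above
    the level arrives in the later block, in addition to the r + 1 claims of the
    earlier one: r + 2 claims exceed the lowest level. *)
Let union_ge th M n : 0 < c -> 0 < th -> (0 < M)%N ->
  \sum_(j < M) (prob P (A th M n j) - prob P (B th M n j) -
     prob P (many_exceedances X N r.+2 1 (lev M 0 th) n)) <= prob P (U th M n).
Proof.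
move=> c0 th0 M0; set D := many_exceedances X N r.+2 1 (lev M 0 th) n.
have mD : measurable D by exact: measurable_many_exceedances.
have mAB j : measurable (A th M n j `\` B th M n j) by exact: measurableD.
apply: le_trans (_ : \sum_(j < M) prob P ((A th M n j `\` B th M n j) `\` D) <= _).
  apply: ler_sum => j _; apply: le_trans (probD_ge _ (mAB j) mD).
  by rewrite lerD2r probD //; exact: B_sub_A.
apply: (@prob_disjoint_union_ge _ _ _ P M (fun j => (A th M n j `\` B th M n j) `\` D)).
- exact: measurable_block_union.
- by move=> j _; exact: measurableD.
- by move=> j jM w [[Aj _] _]; apply/big_unionP; exists j.
- move=> i j w /andP[ij jM] [[Ai _] Dw] [[Aj Bj] _]; apply: Dw.
  have yy : lev M i th * n%:R <= lev M j th * n%:R.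
    by rewrite ler_wpM2r // lev_mono // ?(ltW c0) // ltnW.
  have := exceedances_increment X w yy (time_mono M n w (leqnSn j)).
  have Ai' : (r.+1 <= exceedances X (lev M i th * n%:R) (N (j%:R / M%:R * n%:R) w) w)%N.
    by apply: leq_trans Ai _; apply: exceedances_mono; exact: time_mono.
  move/negP: Bj; rewrite /B /many_exceedances /= -ltnNge => Bj inc.
  have h1 : (r.+2 <= exceedances X (lev M i th * n%:R) (N (j.+1%:R / M%:R * n%:R) w) w)%N.
    rewrite -(leq_add2r (exceedances X (lev M j th * n%:R) (N (j%:R / M%:R * n%:R) w) w)).
    apply: leq_trans inc; rewrite addnC.
    by apply: leq_trans (leq_add Aj Ai'); rewrite addSnnS leq_add2r -ltnS.
  apply: leq_trans h1 _; apply: leq_trans (exceedances_anti X _ w _) (exceedances_mono _ _ _ _).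
    by rewrite ler_wpM2r // lev_mono // ltW.
  apply: N_mono; first by rewrite !mulr_ge0.
  by rewrite ler_wpM2r // block_time_le1.
Qed.

(** The level does not rise and the number of claims grows, so the last block event
    contains all others. *)
Let union_single th M n : c <= 0 -> 0 < th -> U th M.+1 n = A th M.+1 n M.
Proof.
move=> c0 th0; apply/seteqP; split=> w; last by move=> h; apply/big_unionP; exists M.
move=> /big_unionP[j jM h]; apply: leq_trans h _.
apply: leq_trans (exceedances_anti X _ w _) (exceedances_mono _ _ _ (time_mono _ _ _ jM)).
rewrite /lev /level !ler_wpM2r ?invr_ge0 ?(ltW (net_factor_gt0 _ _ _)) ?(ltW th0) //.
by rewrite lerD2l ler_wnM2l // ler_wpM2r ?invr_ge0 // ler_nat.
Qed.

Let union_diff_cvg th M : 0 < th ->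
  (\sum_(j < M) (prob P (A th M n j) - prob P (B th M n j))) / mean_exceedances lambda F n ^+ r.+1
   @[n --> \oo] --> level_scale alpha m r th * riemann_stieltjes_sum r (slope_power alpha a c r) M.
Proof.
move=> th0.
rewrite (_ : (fun n => _) = (fun n => \sum_(j < M)
   (prob P (A th M n j) / mean_exceedances lambda F n ^+ r.+1 - prob P (B th M n j) / mean_exceedances lambda F n ^+ r.+1)));
  last by apply/funext => n; rewrite mulr_suml; apply: eq_bigr => j _; rewrite mulrBl.
rewrite /riemann_stieltjes_sum mulr_sumr.
apply: cvg_big => [|j _].
  exact: add_continuous.
rewrite mulrBl mulrBr; apply: cvgB; first exact: A_cvg.
exact: B_cvg.
Qed.

Lemma block_union_upper th M e : 0 < th -> (0 < M)%N -> 0 < e ->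
  \forall n \near \oo, prob P (U th M n) <=
    (level_scale alpha m r th * passage_integral alpha a c r + e) * mean_exceedances lambda F n ^+ r.+1.
Proof.
move=> th0 M0 e0; have Q0 n : (0 < n)%N -> 0 < mean_exceedances lambda F n ^+ r.+1.
  by move=> n0; rewrite exprn_gt0 // mean_exceedances_gt0.
have [c0|c0] := ltP 0 c.
  have /andP[h _] := slope_power_bounds r alpha_gt0 a_gt0 ca_gt0 c0 M0.
  have h2 : level_scale alpha m r th * riemann_stieltjes_sum r (slope_power alpha a c r) M <
      level_scale alpha m r th * passage_integral alpha a c r + e.
    by rewrite (le_lt_trans (ler_wpM2l _ h)) ?ltrDl // mulr_ge0 ?powR_ge0.
  near=> n; have n0 : (0 < n)%N by near: n; exact: nbhs_infty_gt.
  apply: le_trans (union_le _ _ c0 th0) _; rewrite -ler_pdivrMr ?Q0 // ltW //.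
  by near: n; exact: (cvgr_lt _ (@union_diff_cvg th M th0) _ h2).
case: M M0 => // M _.
have h2 : level_scale alpha m r th * (block_time R M.+1 M ^+ r.+1 * slope_power alpha a c r (block_time R M.+1 M)) <
    level_scale alpha m r th * passage_integral alpha a c r + e.
  rewrite /passage_integral (ltNge 0 c) c0 /= /block_time divff ?pnatr_eq0 // expr1n mul1r.
  by rewrite /slope_power mulr1 ltrDl.
near=> n; have n0 : (0 < n)%N by near: n; exact: nbhs_infty_gt.
rewrite union_single // -ler_pdivrMr ?Q0 // ltW //.
by near: n; exact: (cvgr_lt _ (A_cvg th0 (ltnSn M)) _ h2).
Unshelve. all: by end_near. Qed.

Lemma block_union_lower th e : 0 < th -> 0 < e ->
  exists2 M, (0 < M)%N & \forall n \near \oo,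
    (level_scale alpha m r th * passage_integral alpha a c r - e) * mean_exceedances lambda F n ^+ r.+1 <=
    prob P (U th M n).
Proof.
move=> th0 e0; have Q0 n : (0 < n)%N -> 0 < mean_exceedances lambda F n ^+ r.+1.
  by move=> n0; rewrite exprn_gt0 // mean_exceedances_gt0.
have [c0|c0] := ltP 0 c.
  pose z := level_scale alpha m r th * (r.+1%:R * slope_power alpha a c r 0).
  have s0 : 0 <= level_scale alpha m r th by rewrite mulr_ge0 ?powR_ge0.
  pose M := (Num.truncn (z / e)).+1; exists M => //.
  have M0 : (0 < M)%N by [].
  have hM : z / M%:R < e.
    by rewrite ltr_pdivrMr ?ltr0n // mulrC -ltr_pdivrMr // truncnS_gt.
  have /andP[_ h] := slope_power_bounds r alpha_gt0 a_gt0 ca_gt0 c0 M0.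
  have h2 : level_scale alpha m r th * passage_integral alpha a c r - e <
      level_scale alpha m r th * riemann_stieltjes_sum r (slope_power alpha a c r) M - M%:R * 0.
    rewrite mulr0 subr0 ltrBlDr; apply: le_lt_trans (ler_wpM2l s0 h) _.
    rewrite mulrDr ltrD2l; apply: le_lt_trans hM.
    by rewrite le_eqVlt; apply/orP; left; apply/eqP; rewrite /z; ring.
  have lim : prob P (many_exceedances X N r.+2 1 (lev M 0 th) n) / mean_exceedances lambda F n ^+ r.+1 @[n --> \oo] --> 0.
    apply: (many_exceedances_succ_cvg0 lambda_gt0 alpha_gt1 X_indep X_cdf N_poisson XN_indep G_gt0 G_rv) => //.
    exact: lev_gt0.
  have lim2 : (\sum_(j < M) (prob P (A th M n j) - prob P (B th M n j))) / mean_exceedances lambda F n ^+ r.+1 -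
      M%:R * (prob P (many_exceedances X N r.+2 1 (lev M 0 th) n) / mean_exceedances lambda F n ^+ r.+1) @[n --> \oo] -->
      level_scale alpha m r th * riemann_stieltjes_sum r (slope_power alpha a c r) M - M%:R * 0.
    by apply: cvgB; [exact: union_diff_cvg|exact: cvgMl_tmp].
  near=> n; have n0 : (0 < n)%N by near: n; exact: nbhs_infty_gt.
  have h3 : level_scale alpha m r th * passage_integral alpha a c r - e <
      (\sum_(j < M) (prob P (A th M n j) - prob P (B th M n j))) / mean_exceedances lambda F n ^+ r.+1 -
      M%:R * (prob P (many_exceedances X N r.+2 1 (lev M 0 th) n) / mean_exceedances lambda F n ^+ r.+1).
    by near: n; exact: (cvgr_gt _ lim2 _ h2).
  move: h3; rewrite mulrA -mulrBl ltr_pdivlMr ?Q0 // => /ltW h3; apply: le_trans h3 _.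
  apply: le_trans (union_ge n c0 th0 M0).
  by rewrite [leRHS]sumrB big_const_ord iter_addr_0 mulr_natl.
exists 1%N => //.
have h2 : level_scale alpha m r th * passage_integral alpha a c r - e <
    level_scale alpha m r th * (block_time R 1 0 ^+ r.+1 * slope_power alpha a c r (block_time R 1 0)).
  rewrite /passage_integral (ltNge 0 c) c0 /= /block_time divff ?pnatr_eq0 // expr1n mul1r.
  by rewrite /slope_power mulr1 gtrBl.
near=> n; have n0 : (0 < n)%N by near: n; exact: nbhs_infty_gt.
rewrite union_single // -ler_pdivlMr ?Q0 // ltW //.
by near: n; exact: (cvgr_gt _ (A_cvg th0 (ltnSn 0)) _ h2).
Unshelve. all: by end_near. Qed.

End block_union_asymptotics.

(** * The ruin probability *)

Lemma tail_regularly_varying (R : realType) (alpha : R) (F L : R -> R) (x : R) :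
  slowly_varying L -> (forall x, 0 < x -> 1 - F x = L x * x `^ (- alpha)) -> 0 < x ->
  (1 - F (x * t)) / (1 - F t) @[t --> +oo] --> x `^ (- alpha).
Proof.
move=> [_ hL] hF x0; have h : L (x * t) / L t * x `^ (- alpha) @[t --> +oo] --> x `^ (- alpha).
  by rewrite -[X in _ --> X]mul1r; apply: cvgMr_tmp; exact: hL.
apply: cvg_trans h; apply: near_eq_cvg; near=> t.
have t0 : 0 < t by near: t; exact: nbhs_pinfty_gt.
rewrite !hF ?mulr_gt0 // powRM ?ltW // invfM.
have := powR_gt0 (- alpha) t0; move: (t `^ _) => z z0.
have e : z / z = 1 by rewrite divff // gt_eqF.
transitivity (L (x * t) / L t * x `^ (- alpha) * (z / z)); last by ring.
by rewrite e mulr1.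
Unshelve. all: by end_near. Qed.

Lemma tail_positive (R : realType) (alpha : R) (F L : R -> R) :
  slowly_varying L -> (forall x, 0 < x -> 1 - F x = L x * x `^ (- alpha)) ->
  (forall x y, x <= y -> 1 - F y <= 1 - F x) -> forall x, 0 < 1 - F x.
Proof.
move=> [[M [_ hM]] _] hF anti x.
pose t := Num.max x (Num.max (M + 1) 1).
have t0 : 0 < t by rewrite !lt_max ltr01 !orbT.
apply: lt_le_trans (anti x t _); last by rewrite le_max lexx.
by rewrite hF // mulr_gt0 ?powR_gt0 // hM // !lt_max ltrDl ltr01 orbT.
Qed.

Section positive_claims_mean.
Context (d : measure_display) (T : measurableType d) (R : realType)
  (P : probability T R) (X : nat -> {RV P >-> R}).

Lemma expectation_pos : {ae P, forall w, 0 < X 0%N w} ->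
  ('E_P[X 0%N] = \int[P]_w (pos_part (X 0%N w))%:E)%E.
Proof.
move=> X0; rewrite expectation_def; apply: ae_eq_integral => //.
- by apply/measurable_EFinP; exact: measurable_funP.
- by apply/measurable_EFinP; exact: measurable_pos_claim.
- by apply: filterS X0 => w /ltW Xw _; rewrite /pos_part max_l.
Qed.

Lemma moment_fin_num (g : T -> R) : (forall w, 0 <= g w) -> (\int[P]_w (g w)%:E < +oo)%E ->
  (\int[P]_w (g w)%:E = (fine (\int[P]_w (g w)%:E))%:E)%E.
Proof.
move=> g0 gy; rewrite fineK // ge0_fin_numE //.
by apply: integral_ge0 => w _; rewrite lee_fin.
Qed.

End positive_claims_mean.

Theorem theorem3p1 (R : realType) (d : measure_display) (T : measurableType d)
    (P : probability T R) (alpha lambda : R)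
    (X : nat -> {RV P >-> R}) (N : R -> {RV P >-> nat})
    (F L : R -> R) (pD c a : R) (r : nat) (m : reinsurance)
    (halpha : 1 < alpha) (hlambda : 0 < lambda)
    (hXpos : forall i, {ae P, forall w, 0 < X i w})
    (hXindep : independent_RVs P (fun i w => X i w))
    (hF : forall i x, cdf (X i) x = (F x)%:E)
    (hL : slowly_varying L)
    (hFL : forall x, 0 < x -> 1 - F x = L x * x `^ (- alpha))
    (hN : poisson_process lambda N)
    (hXN : independent_sigma P
       (sigma_family setT (fun i w => X i w))
       (sigma_family [set t : R | 0 <= t] (fun t w => N t w)))
    (hr : (0 < r)%N)
    (hc : c = pD - lambda * fine ('E_P[X 0%N])%E)
    (ha : 0 < a) (hca : 0 < c + a) (hc0 : c != 0) :
  ruin_prob P (fun i w => X i w) (fun t w => N t w) m r pD (n%:R * a) n%:R /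
    (asymp_const m alpha a c r * (lambda * L n%:R) ^+ r.+1 *
     n%:R `^ (- (r.+1%:R * (alpha - 1))))
  @[n --> \oo] --> (1 : R).
Proof.
have alpha_gt0 : 0 < alpha by exact: lt_trans halpha.
have G_gt0 := tail_positive hL hFL (tail_anti hF).
have G_rv x x0 := tail_regularly_varying hL hFL (x := x) x0.
(* A moment order available for the tail index and for the bounds of order at most 2. *)
pose q := Num.min 2 ((1 + alpha) / 2).
have [q1 [q2 qa]] : 1 < q /\ q <= 2 /\ q < alpha.
  by rewrite /q lt_min ge_min lexx gt_min; split; [|split]; lra.
pose mu := fine 'E_P[X 0%N]%E.
have meanE : (\int[P]_w (pos_part (X 0%N w))%:E)%E = mu%:E.
  rewrite /mu expectation_pos // -moment_fin_num // => [w|]; first exact: pos_part_ge0.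
  have h1 : (0 < 1 :> R) && (1 < alpha) by rewrite ltr01.
  have := moment_finite hF G_gt0 G_rv h1; congr (_ < _)%E.
  by apply: eq_integral => w _; rewrite powRr1 // pos_part_ge0.
have momentE : (\int[P]_w (pos_part (X 0%N w) `^ q)%:E)%E =
    (fine (\int[P]_w (pos_part (X 0%N w) `^ q)%:E)%E)%:E.
  apply: moment_fin_num => [w|]; first exact: powR_ge0.
  by apply: (moment_finite hF G_gt0 G_rv); rewrite qa (lt_trans _ q1).
pose Q n := mean_exceedances lambda F n ^+ r.+1.
have Q0 n : (0 < n)%N -> 0 < Q n by move=> n0; rewrite exprn_gt0 // mean_exceedances_gt0.
pose C := asymp_const m alpha a c r.
have C0 : 0 < C by exact: asymp_const_gt0.
pose psi n := ruin_prob P (fun i w => X i w) (fun t w => N t w) m r pD (n%:R * a) n%:R.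
suff lim : psi n / (C * Q n) @[n --> \oo] --> (1 : R).
  apply: cvg_trans lim; apply: near_eq_cvg; near=> n.
  have n0 : 0 < n%:R :> R by rewrite ltr0n; near: n; exact: nbhs_infty_gt.
  congr (_ / _); rewrite -mulrA; congr (_ * _); rewrite /Q /mean_exceedances hFL //.
  have -> : lambda * n%:R * (L n%:R * n%:R `^ (- alpha)) = lambda * L n%:R * n%:R `^ (1 - alpha).
    by rewrite powRD ?(gt_eqF n0) ?implybT // powRr1 ?(ltW n0) //; ring.
  rewrite exprMn; congr (_ * _).
  by rewrite -powR_mulrn ?powR_ge0 // -powRrM -mulrN opprB mulrC.
pose p := r.+1%:R * alpha; have p0 : 0 < p by rewrite mulr_gt0.
have scaleE v : 0 < v -> level_scale alpha m r (v `^ (- p^-1)) * passage_integral alpha a c r = C * v.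
  move=> v0; rewrite level_scaleE ?powR_gt0 // -powRrM mulrNN mulVf ?gt_eqF // powRr1 ?ltW //.
  by rewrite mulrAC -asymp_constE.
apply/cvgrPdist_le => e e0.
pose eta := Num.min (1 / 2) (e / 2).
have eta0 : 0 < eta by rewrite lt_min !divr_gt0.
have eta1 : eta <= 1 / 2 by rewrite ge_min lexx.
have etae : eta <= e / 2 by rewrite ge_min lexx orbT.
have Ceta : 0 < C * eta / 2 by rewrite divr_gt0 // mulr_gt0.
(* Slack factors whose power - p is exactly 1 + eta and 1 - eta. *)
pose thu := (1 + eta) `^ (- p^-1); pose thl := (1 - eta) `^ (- p^-1).
have v1 : 0 < 1 + eta by rewrite addr_gt0.
have v2 : 0 < 1 - eta by move: eta1; lra.
have thu0 : 0 < thu by rewrite powR_gt0.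
have thl0 : 0 < thl by rewrite powR_gt0.
have one_pow : (1 : R) `^ p^-1 = 1 by rewrite powR1.
have thu1 : thu < 1.
  rewrite /thu powRN invf_lt1 ?powR_gt0 // -[ltLHS]one_pow.
  by rewrite gt0_ltr_powR ?invr_gt0 ?nnegrE ?(ltW v1) // ltrDl.
have thl1 : 1 < thl.
  rewrite /thl powRN -[ltLHS]invr1 ltf_pV2 ?posrE ?powR_gt0 // -[ltRHS]one_pow.
  by rewrite gt0_ltr_powR ?invr_gt0 ?nnegrE ?(ltW v2) // gtrBl.
have du0 : 0 < 1 - thu by rewrite subr_gt0.
have du1 : 1 - thu < 1 by rewrite gtrBl.
have dl0 : 0 < thl - 1 by rewrite subr_gt0.
have [Mu Mu0 [nu nuQ hu]] := ruin_upper m r hlambda halpha hXpos hXindep hF hN hXN G_gt0 G_rv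
  q1 q2 meanE momentE hc ha hca du0 du1.
have [Ml Ml0 hl1] := block_union_lower m r hlambda halpha hXindep hF hN hXN G_gt0 G_rv ha hca thl0 Ceta.
have [nl nlQ hl] := ruin_lower m r hlambda halpha hXpos hXindep hF hN hXN G_gt0 G_rv
  q1 meanE momentE hc ha hca dl0 Ml0.
have hu1 := block_union_upper m r hlambda halpha hXindep hF hN hXN G_gt0 G_rv ha hca thu0 Mu0 Ceta.
rewrite (_ : 1 - (1 - thu) = thu) in hu; last by ring.
rewrite (_ : 1 + (thl - 1) = thl) in hl; last by ring.
rewrite scaleE // in hu1; rewrite scaleE // in hl1.
near=> n.
have n0 : (0 < n)%N by near: n; exact: nbhs_infty_gt.
have CQ0 : 0 < C * Q n by rewrite mulr_gt0 // Q0.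
have up : psi n <= C * (1 + 2 * eta) * Q n.
  apply: le_trans (hu n n0) _.
  have h1 : prob P (block_union X N m r a c thu Mu n) <= (C * (1 + eta) + C * eta / 2) * Q n by near: n.
  have h2 : nu n <= C * eta / 2 * Q n.
    rewrite -ler_pdivrMr ?Q0 // ltW //.
    by near: n; exact: (cvgr_lt _ nuQ _ Ceta).
  by apply: le_trans (lerD h1 h2) _; rewrite le_eqVlt; apply/orP; left; apply/eqP; field.
have lo : C * (1 - 2 * eta) * Q n <= psi n.
  have h0 : prob P (block_union X N m r a c thl Ml n) <= psi n + nl n by near: n.
  have h1 : (C * (1 - eta) - C * eta / 2) * Q n <= prob P (block_union X N m r a c thl Ml n) by near: n.
  have h2 : nl n <= C * eta / 2 * Q n.
    rewrite -ler_pdivrMr ?Q0 // ltW //.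
    by near: n; exact: (cvgr_lt _ nlQ _ Ceta).
  have -> : C * (1 - 2 * eta) * Q n = (C * (1 - eta) - C * eta / 2) * Q n - C * eta / 2 * Q n by field.
  by rewrite lerBlDr; apply: le_trans h1 _; apply: le_trans h0 _; rewrite lerD2l.
rewrite -/(psi n) -/C.
have h1 : psi n / (C * Q n) <= 1 + 2 * eta by rewrite ler_pdivrMr // mulrA [_ * C]mulrC.
have h2 : 1 - 2 * eta <= psi n / (C * Q n) by rewrite ler_pdivlMr // mulrA [_ * C]mulrC.
by rewrite ler_distl; apply/andP; split; move: h1 h2 etae; lra.
Unshelve. all: by end_near. Qed.
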